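(* Let $X=\{X(t)\}_{t\in[0,1]}$ and $\varepsilon=\{\varepsilon(t)\}_{t\in[0,1]}$ be independent zero-mean Gaussian processes with sample paths in $L^2[0,1]$, and let $Y(t)=G_0(X)(t)+\varepsilon(t)$, $t\in[0,1]$. Assume the following. (1) (Processes.) There are finite constants $\lambda>0$, $0<\beta\le 1$ with $\big(\mathbb E[(X(s)-X(t))^2]\big)^{1/2}\le\lambda|s-t|^\beta$ for all $s,t\in[0,1]$ ($X$ is identified with its modification with continuous sample paths), and $C_\varepsilon(s,t)=\mathbb E[\varepsilon(s)\varepsilon(t)]$ is uniformly bounded on $[0,1]^2$. (2) (Regression operator.) $G_0:C[0,1]\to C[0,1]$ satisfies $G_0(0)=0$, and there are constants $\alpha\in(0,1]$, $\nu>0$, $C_0<\infty$ such that for every $u\ge1$, $\|G_0(x_1)-G_0(x_2)\|_{\sup}\le C_0u^\nu\|x_1-x_2\|_{\sup}^\alpha$ whenever $\|x_1\|_{\sup},\|x_2\|_{\sup}\le u$, and $\|G_0(x)\|_{\sup}\le C_0(1\vee\|x\|_{\sup}^\nu)$ for all $x\in C[0,1]$. Moreover, for each $x\in C[0,1]$, $G_0(x)(\cdot)$ is absolutely continuous on $[0,1]$ with derivative $G_0(x)'$, and $\mathbb E[\operatorname{ess\,sup}_{t\in(0,1)}|G_0(X)'(t)|^2]<\infty$. (3) (Sampling.) $(X_i,Y_i)$, $i=1,\dots,n$, are i.i.d. copies of $(X,Y)$ (with errors $\varepsilon_i$), observed through $X_i(s_{n,j})$, $j\le J_n$, and $Y_{i,\ell}=Y_i(t_{n,\ell})+e_{i,\ell}$,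 $\ell\le L_n$, on non-random increasing grids $S_n=\{s_{n,j}\}_{j=1}^{J_n}$, $T_n=\{t_{n,\ell}\}_{\ell=1}^{L_n}$ in $(0,1)$ with $J_n,L_n\to\infty$; $S_n\subset S_{n+1}$ for all $n$; $\log J_n=o(n)$; the maximal spacings $\rho_n=\max_{0\le j\le J_n}(s_{n,j+1}-s_{n,j})$ and $\gamma_n=\max_{0\le\ell\le L_n}(t_{n,\ell+1}-t_{n,\ell})$ tend to $0$, where $s_{n,0}=t_{n,0}=0$, $s_{n,J_n+1}=t_{n,L_n+1}=1$; the $e_{i,\ell}$ are independent zero-mean Gaussian variables with variances uniformly bounded by some $\sigma_e^2<\infty$, independent of $\{(X_i,Y_i)\}_{i\le n}$. (4) (Network.) The parameters $1\le b_n,p_n,q_n,r_n\uparrow\infty$ of the class $\mathcal G_{n,u}$ (see context) satisfy, for each fixed $u\ge1$, as $n\to\infty$, $$p_nq_nb_n^2\gamma_n\,\sigma_{b_n(r_nu+1)}\to0,\qquad \frac{p_nq_nr_n\log\big(b_nJ_np_nq_n\,\sigma_{b_n(r_nu+1)}\big)}{n}\to0 .$$ Then, for every fixed $u\ge1$, the estimator $\widehat G_{n,u}$ and target $G_{0,n,u}$ defined in the context satisfy $$\lim_{n\to\infty}\mathbb E\Big[\big\|\widehat G_{n,u}(X)-G_{0,n,u}(X)\big\|_{L^2[0,1]}^2\Big]=0,$$ where the expectation is over both the training sample and an independent copy $X$ of the predictor.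
   Context: Norms: for $x\in C[0,1]$ and $S\subset[0,1]$, $\|x\|_{\sup,S}=\sup_{s\in S}|x(s)|$ and $\|x\|_{\sup}=\|x\|_{\sup,[0,1]}$. For $G$ mapping $C[0,1]$ to functions on $[0,1]$ and $u\ge1$, $\|G\|_{u,\infty}=\sup_{\|x\|_{\sup}\le u,\,t\in[0,1]}|G(x)(t)|$. Activation: $\sigma:\mathbb R\to\mathbb R$ is a fixed Lipschitz-continuous Tauber–Wiener (TW) function; TW means that the finite linear combinations $\sum_i c_i\sigma(\lambda_i t+\theta_i)$ ($c_i,\lambda_i,\theta_i\in\mathbb R$) are dense in $C[a,b]$ for every $a<b$ (a continuous function defining a tempered distribution is TW iff it is not a polynomial). Put $\sigma_s=\sup_{|t|\le s}|\sigma(t)|$. Sieve class: with a fixed constant $B\ge C_0$, $\mathcal G_{n,u}$ is the set of maps $$G(x)(t)=\mathbf 1(\|x\|_{\sup,S_n}\le u)\sum_{k=1}^{p_n}\sum_{i=1}^{q_n}c_i^k\,\sigma\Big(\sum_{j=1}^{J_n}\xi_{ij}^kx(s_{n,j})+\theta_i^k\Big)\sigma(w_kt+\zeta_k)$$ with $\|G\|_{u,\infty}\le Bu^\nu$, all of $c_i^k,\xi_{ij}^k,\theta_i^k,\zeta_k,w_k\in[-b_n,b_n]$, and $\sum_{j}\mathbf 1(\xi_{ij}^k\neq0)\le r_n$ for all $i,k$. Estimator: write $t_\ell=t_{n,\ell}$, $L=L_n$, and let $w_1=\frac{t_1+t_2}2$, $w_\ell=\frac{t_{\ell+1}-t_{\ell-1}}2$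 for $1<\ell<L$, $w_L=1-\frac{t_{L-1}+t_L}2$ (quadrature weights, distinct from the network parameters $w_k$). With $V_{i,n,u}=\mathbf 1(\|X_i\|_{\sup,S_n}\le u)$, $$\widehat G_{n,u}=\operatorname*{argmin}_{G\in\mathcal G_{n,u}}\frac1n\sum_{i=1}^nV_{i,n,u}\sum_{\ell=1}^Lw_\ell\{Y_{i,\ell}-G(X_i)(t_\ell)\}^2 .$$ Target: $G_{0,n,u}(x)=\mathbf 1(\|x\|_{\sup,S_n}\le u)\,G_0(x)$. *)

(* Defs.v *)
From HB Require Import structures.
From mathcomp Require Import all_boot all_order all_algebra.
From mathcomp Require Import all_classical all_reals all_analysis.
Set Implicit Arguments.
Unset Strict Implicit.
Unset Printing Implicit Defensive.
Import Order.TTheory GRing.Theory Num.Theory.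
Import numFieldNormedType.Exports.

Local Open Scope classical_set_scope.
Local Open Scope ring_scope.

(* Elements of C[0,1] are represented by functions R -> R that are continuous
   on [0,1]; only their values on [0,1] are meaningful. *)
Definition C01 (R : realType) (x : R -> R) : Prop :=
  {within `[0, 1], continuous x}.

(* Real-valued supremum: only used for functions bounded on S.
   The supremum over the empty set is 0. *)
Definition supnorm (R : realType) (S : set R) (x : R -> R) : R :=
  sup [set `|x t| | t in S].

Definition opnorm (R : realType) (u : R) (G : (R -> R) -> R -> R) : \bar R :=
  ereal_sup [set z | exists x t,
    [/\ C01 x, supnorm `[0, 1] x <= u, t \in `[0, 1] & z = `|G x t|%:E]].

Definition tauber_wiener (R : realType) (sigma : R -> R) : Prop :=
  forall a b : R, a < b ->
  forall f : R -> R, {within `[a, b], continuous f} ->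
  forall e : R, 0 < e ->
  exists (m : nat) (c lam theta : 'I_m -> R), forall t : R, t \in `[a, b] ->
    `|f t - \sum_(i < m) c i * sigma (lam i * t + theta i)| < e.

Definition abs_continuous (R : realType) (a b : R) (f : R -> R) : Prop :=
  forall e : R, 0 < e -> exists2 d : R, 0 < d &
  forall (m : nat) (x y : 'I_m -> R),
    (forall k, a <= x k /\ x k <= y k /\ y k <= b) ->
    trivIset setT (fun k => `]x k, y k[%classic) ->
    \sum_(k < m) (y k - x k) < d ->
    \sum_(k < m) `|f (y k) - f (x k)| < e.

Definition L2norm_sq (R : realType) (f : R -> R) : \bar R :=
  (\int[lebesgue_measure]_(t in `[0%R, 1%R]) (f t ^+ 2)%:E)%E.

Definition L2_01 (R : realType) (f : R -> R) : Prop :=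
  measurable_fun (`[0, 1]%classic : set R) f /\ (L2norm_sq f < +oo)%E.

Section probability.
Context d (T : measurableType d) (R : realType) (P : probability T R).

(* Zero-mean Gaussian law, degenerate case included: normal_prob 0 0 is not
   the Dirac mass at 0 in the library. *)
Definition centered_gaussian_law (s : R) : set R -> \bar R :=
  if s == 0 then \d_(0 : R) else normal_prob 0 s.

Definition centered_gaussian (Z : T -> R) : Prop :=
  measurable_fun setT Z /\
  exists s : R, forall A : set R, measurable A ->
    P (Z @^-1` A) = centered_gaussian_law s A.

Definition gaussian_process (Z : R -> T -> R) : Prop :=
  forall (m : nat) (t a : 'I_m -> R), (forall k, t k \in `[0, 1]) ->
    centered_gaussian (fun w => \sum_(k < m) a k * Z (t k) w).

Definition events (Z : T -> R) : set (set T) :=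
  preimage_set_system setT Z measurable.

Definition process_events (Z : R -> T -> R) : set (set T) :=
  \bigcup_(t in `[0, 1]) events (Z t).

Definition pair_events (X Y : R -> T -> R) : set (set T) :=
  process_events X `|` process_events Y.

(* Independence of two sigma-algebras. *)
Definition indep (F G : set (set T)) : Prop :=
  forall A B, F A -> G B -> P (A `&` B) = (P A * P B)%E.

(* Mutual independence of a family of sigma-algebras. *)
Definition mutual_indep (K : eqType) (F : K -> set (set T)) : Prop :=
  forall (D : seq K) (A : K -> set T), uniq D ->
    (forall k, k \in D -> F k (A k)) ->
    P (\bigcap_(k in [set` D]) A k) = (\prod_(k <- D) P (A k))%E.

(* Equality of the finite-dimensional joint laws. *)
Definition same_law (X Y X' Y' : R -> T -> R) : Prop :=
  forall (m : nat) (t : 'I_m -> R) (A B : 'I_m -> set R),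
    (forall k, t k \in `[0, 1]) ->
    (forall k, measurable (A k) /\ measurable (B k)) ->
    P (\bigcap_(k in setT) (X (t k) @^-1` A k `&` Y (t k) @^-1` B k)) =
    P (\bigcap_(k in setT) (X' (t k) @^-1` A k `&` Y' (t k) @^-1` B k)).

Definition response (G0 : (R -> R) -> R -> R) (X eps : R -> T -> R)
    : R -> T -> R :=
  fun t w => G0 (X ^~ w) t + eps t w.

End probability.

(* A grid of m points in (0,1) is the restriction to 1, ..., m of a sequence
   s, completed by s 0 = 0 and s (m + 1) = 1. *)
Definition is_grid (R : realType) (m : nat) (s : nat -> R) : Prop :=
  [/\ s 0%N = 0, s m.+1 = 1 & forall j, (j <= m)%N -> s j < s j.+1].

Definition grid_set (R : realType) (m : nat) (s : nat -> R) : set R :=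
  [set s j | j in [set j | (1 <= j <= m)%N]].

Definition spacing (R : realType) (m : nat) (s : nat -> R) : R :=
  \big[Num.max/0]_(j < m.+1) (s j.+1 - s j).

(* Meant for L >= 2 and 1 <= l <= L. *)
Definition quad_weight (R : realType) (L : nat) (t : nat -> R) (l : nat) : R :=
  if l == 1%N then (t 1%N + t 2%N) / 2
  else if l == L then 1 - (t L.-1 + t L) / 2
  else (t l.+1 - t l.-1) / 2.

Definition truncation (R : realType) (S : set R) (u : R) (x : R -> R) : R :=
  (supnorm S x <= u)%R%:R.

Definition network (R : realType) (sigma : R -> R) (u : R) (J p q : nat)
    (s : nat -> R) (c theta : 'I_p -> 'I_q -> R) (xi : 'I_p -> 'I_q -> 'I_J -> R)
    (w zeta : 'I_p -> R) : (R -> R) -> R -> R :=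
  fun x t => truncation (grid_set J s) u x *
    \sum_(k < p) \sum_(i < q)
      c k i * sigma (\sum_(j < J) xi k i j * x (s j.+1) + theta k i)
      * sigma (w k * t + zeta k).

Definition sieve (R : realType) (sigma : R -> R) (B nu u b r : R)
    (J p q : nat) (s : nat -> R) : set ((R -> R) -> R -> R) :=
  [set G | (opnorm u G <= (B * u `^ nu)%:E)%E /\
    exists (c theta : 'I_p -> 'I_q -> R) (xi : 'I_p -> 'I_q -> 'I_J -> R)
           (w zeta : 'I_p -> R),
    [/\ G = network sigma u s c theta xi w zeta,
        forall k i, `|c k i| <= b /\ `|theta k i| <= b,
        forall k i j, `|xi k i j| <= b,
        forall k, `|w k| <= b /\ `|zeta k| <= b &
        forall k i, #|[set j | xi k i j != 0]|%:R <= r]].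

(* x i and y i l are the i-th predictor path and its responses at the points
   t l, 1 <= l <= L; observations are numbered 0, ..., n - 1. *)
Definition empirical_loss (R : realType) (u : R) (n J L : nat)
    (s t : nat -> R) (x : nat -> R -> R) (y : nat -> nat -> R)
    (G : (R -> R) -> R -> R) : R :=
  n%:R^-1 * \sum_(i < n) truncation (grid_set J s) u (x i) *
    \sum_(1 <= l < L.+1) quad_weight L t l * (y i l - G (x i) (t l)) ^+ 2.

Definition is_argmin (R : realType) (U : Type) (A : set U) (f : U -> R) (a : U)
    : Prop :=
  A a /\ forall a', A a' -> f a <= f a'.

(* Main.v *)
Require Import Defs.
From HB Require Import structures.
From mathcomp Require Import all_boot all_order all_algebra.
From mathcomp Require Import all_classical all_reals all_analysis ess_sup_inf.
From mathcomp Require Import measurable_realfun.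
From mathcomp Require Import ring lra zify.
Set Implicit Arguments.
Unset Strict Implicit.
Unset Printing Implicit Defensive.
Import Order.TTheory GRing.Theory Num.Theory.
Import numFieldNormedType.Exports.
Local Open Scope classical_set_scope.
Local Open Scope ring_scope.

(* With H a fixed network close to G0, the argmin property gives
     sum_l w_l (Ghat - H)^2 <= 4 sum_l w_l (H - G0)^2 + 4 sum_l w_l (Y - G0) (Ghat - H)
   in sample average. The passage to the population risk is a union bound over a
   finite delta-net of the sieve, obtained by quantizing the parameters: for the
   centers of the net, the centered sample losses and both noise terms have
   exponential moments at most exp(n tau^2 C), so the largest of N of them has
   expectation at most (ln N + 1) / tau + n tau C. The second rate condition says
   ln N = o(n); the first one makes the quadrature error of Lipschitz networks
   vanish. Only simple functions below the prediction loss are integrated over the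
   product space, so that no joint measurability of Ghat is needed.
   The bias is small in mean square because G0 is close to G0 composed with
   piecewise linear interpolation on a grid, uniformly on paths with a bounded
   dyadic increment moment (chaining), and the latter is a continuous function of
   finitely many coordinates, approximated by Bernstein polynomials in
   exponentials, hence by sums of ridge functions, hence by networks. *)

(** * Interpolation and chaining *)

(** The estimator depends on the whole sample, so no law of large numbers applies to it directly.
    Replacing it by a net center turns this dependence into a maximum over finitely many fixed
    functions, at the price of the net radius times the mean size of the noise. Only consistency is
    claimed, so [tau] stays fixed while [n] grows: it is small enough for the variance term, and ln
    N = o(n) then removes the rest. Two gaps shape the proof. Truncation looks only at grid values,
    and a path may exceed [u] between them. A network reads a path only through its grid values and
    may be fed the interpolant instead, but G0 sees the whole path; its error is therefore bounded
    by an affine function of the path moment rather than by a constant. Moreover G0 comes with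
    continuity but no measurability on path space: a measurable version is built as a limit of
    networks, so that the noise becomes a function of the observed pair and independence and
    equality of laws apply to it. *)

Section Supnorm.
Context {R : realType}.
Implicit Types (x : R -> R) (S : set R) (c : R).

Lemma supnorm_ub S x c s : (forall s, S s -> `|x s| <= c) -> S s ->
  `|x s| <= supnorm S x.
Proof.
move=> xc Ss; apply: sup_upper_bound; last by exists s.
split; first by exists `|x s|, s.
by exists c => _ [t St <-]; exact: xc.
Qed.

Lemma supnorm_le S x c : 0 <= c -> (forall s, S s -> `|x s| <= c) ->
  supnorm S x <= c.
Proof.
move=> c0 xc; have [->|/set0P[s Ss]] := eqVneq S set0.
  by rewrite /supnorm image_set0 sup0.
by apply: ge_sup; [exists `|x s|, s | move=> _ [t St <-]; exact: xc].
Qed.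

Lemma supnorm_ge0 S x : 0 <= supnorm S x.
Proof.
rewrite /supnorm; set A := [set _ | _ in _].
have [hA|hA] := pselect (has_sup A); last by rewrite sup_out.
have [[z Az] _] := hA; have := Az => -[t St tz].
by apply: le_trans (sup_upper_bound hA Az); rewrite -tz.
Qed.

Lemma C01_bounded x : C01 x -> exists c, forall t, t \in `[0, 1] -> `|x t| <= c.
Proof.
move=> xc.
have := compact_bounded (continuous_compact xc (@segment_compact R 0 1)).
move=> [M [_ /(_ (M + 1))]]; rewrite ltrDl ltr01 => /(_ isT) H.
by exists (M + 1) => t t01; apply: H; exists t.
Qed.

Lemma C01_supnorm x t : C01 x -> t \in `[0, 1] -> `|x t| <= supnorm `[0, 1] x.
Proof.
by move=> /C01_bounded[c xc] t01; apply: (supnorm_ub (c := c)) => //= s.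
Qed.

(** The sign of [u] handles [J = 0], where the supremum over the empty grid is 0. As a finite
    conjunction the truncation visibly depends on the grid values only and is measurable. *)
Lemma truncationE (J : nat) (s : nat -> R) (u : R) x : 0 <= u ->
  truncation (grid_set J s) u x = [forall j : 'I_J, `|x (s j.+1)| <= u]%:R.
Proof.
move=> u0; rewrite /truncation; congr (_ _); congr (_ : nat).
congr nat_of_bool.
apply/idP/forallP => [xu j|xu].
  apply: le_trans xu; pose c := \sum_(i < J) `|x (s i.+1)|.
  apply: (supnorm_ub (c := c)) => [_ [i /= /andP[i1 iJ] <-]|].
    have i'J : (i.-1 < J)%N by rewrite prednK.
    rewrite /c (bigD1 (Ordinal i'J))//= prednK// lerDl.
    by apply: sumr_ge0.
  by exists j.+1 => //=; exact: ltn_ord.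
apply: supnorm_le => // _ [i /= /andP[i1 iJ] <-].
have i'J : (i.-1 < J)%N by rewrite prednK.
by have := xu (Ordinal i'J); rewrite /= prednK.
Qed.

Lemma truncation_bool S (u : R) x : exists v : bool, truncation S u x = v%:R.
Proof. by exists (supnorm S x <= u). Qed.

End Supnorm.

Lemma continuous_sumr (R : realType) (T : topologicalType) (I : Type)
    (r : seq I) (p : pred I) (f : I -> T -> R) :
  (forall i, continuous (f i)) -> continuous (fun t => \sum_(i <- r | p i) f i t).
Proof.
move=> fc; elim: r => [|i r IH] t.
  have -> : (fun t => \sum_(i <- [::] | p i) f i t) = cst 0.
    by apply/funext => x; rewrite big_nil.
  exact: cvg_cst.
case pi : (p i); last first.
  have -> : (fun t => \sum_(j <- i :: r | p j) f j t) = (fun t => \sum_(j <- r | p j) f j t).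
    by apply/funext => x; rewrite big_cons pi.
  exact: IH.
have -> : (fun t => \sum_(j <- i :: r | p j) f j t) =
    (fun t => f i t + \sum_(j <- r | p j) f j t).
  by apply/funext => x; rewrite big_cons pi.
by apply: cvgD; [exact: fc|exact: IH].
Qed.

Section Interpolation.
Context {R : realType}.
Implicit Types (s y : nat -> R) (t u : R).

Definition clamp (z : R) : R := Num.max 0 (Num.min 1 z).

(* Piecewise linear interpolation of (s 1, y 1), ..., (s J, y J), constant on
   both sides. *)
Definition interp (J : nat) s y t : R :=
  y 1%N + \sum_(1 <= j < J) (y j.+1 - y j) * clamp ((t - s j) / (s j.+1 - s j)).

Lemma clamp_le0 z : z <= 0 -> clamp z = 0.
Proof. by move=> z0; rewrite /clamp min_r ?max_l// (le_trans z0). Qed.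

Lemma clamp_ge1 z : 1 <= z -> clamp z = 1.
Proof. by move=> z1; rewrite /clamp min_l// max_r. Qed.

Lemma clamp_id z : 0 <= z <= 1 -> clamp z = z.
Proof. by move=> /andP[z0 z1]; rewrite /clamp min_r// max_r. Qed.

Lemma continuous_clamp : continuous clamp.
Proof.
move=> z; apply: (@continuous_max R R (cst (0:R^o)) (fun z:R => Num.min 1 z : R^o)).
  exact: cvg_cst.
by apply: (@continuous_min R R (cst (1:R^o)) (fun z : R => z : R^o)); [exact: cvg_cst|exact: cvg_id].
Qed.

Lemma is_grid_lt J s i j : is_grid J s -> (i < j <= J.+1)%N -> s i < s j.
Proof.
move=> [_ _ sS] /andP[ij jJ]; elim: j ij jJ => // j IH.
rewrite ltnS leq_eqVlt => /orP[/eqP->|ij] jJ; first exact: sS.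
by apply: lt_trans (IH ij (ltnW jJ)) (sS _ jJ).
Qed.

Lemma is_grid_le J s i j : is_grid J s -> (i <= j <= J.+1)%N -> s i <= s j.
Proof.
move=> g /andP[]; rewrite leq_eqVlt => /orP[/eqP->//|ij jJ].
by apply/ltW/(is_grid_lt g); rewrite ij.
Qed.

Lemma is_grid_01 J s j : is_grid J s -> (j <= J.+1)%N -> s j \in `[0, 1].
Proof.
move=> g jJ; have [s0 s1 _] := g; rewrite in_itv/= -{1}s0 -s1.
by rewrite !(is_grid_le g)//= ?jJ ?leqnn.
Qed.

(** Only the first [m] nodes of the grid enter, which allows induction on [m]. To the left of [t]
    every [clamp] equals 1, so the increments telescope. *)
Lemma interp_right J s y t m : is_grid J s -> (0 < m <= J)%N -> s m <= t ->
  interp m s y t = y m.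
Proof.
move=> g; case: m => // m /=.
elim: m => [|m IH] mJ smt; first by rewrite /interp big_geq// addr0.
have sm : s m.+1 < s m.+2 by apply: (is_grid_lt g); rewrite ltnSn ltnW.
rewrite /interp big_nat_recr//= addrA -/(interp m.+1 s y t) IH ?(ltnW mJ)//; last first.
  exact: le_trans (ltW sm) smt.
rewrite clamp_ge1; first by ring.
by rewrite ler_pdivlMr ?subr_gt0// mul1r lerB.
Qed.

Lemma interp_mid J s y t : is_grid J s -> (0 < J)%N -> t <= s J ->
  exists j j' a, [/\ (0 < j <= J)%N /\ (0 < j' <= J)%N, 0 <= a <= 1,
    interp J s y t = (1 - a) * y j + a * y j' &
    (t <= s 1%N /\ j = 1%N /\ j' = 1%N) \/ (s j <= t <= s j' /\ j' = j.+1)].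
Proof.
move=> g; suff H m : (m < J)%N -> t <= s m.+1 -> exists j j' a,
    [/\ (0 < j <= m.+1)%N /\ (0 < j' <= m.+1)%N, 0 <= a <= 1,
    interp m.+1 s y t = (1 - a) * y j + a * y j' &
    (t <= s 1%N /\ j = 1%N /\ j' = 1%N) \/ (s j <= t <= s j' /\ j' = j.+1)].
  by case: J g H => // J g H _; exact: H.
elim: m => [|m IH] mJ tsm.
  exists 1%N, 1%N, 0; split => //; rewrite ?lexx ?ler01//; last by left.
  by rewrite /interp big_geq// addr0 subr0 mul1r mul0r addr0.
have sm : s m.+1 < s m.+2 by apply: (is_grid_lt g); rewrite ltnSn ltnW.
have sm0 : 0 < s m.+2 - s m.+1 by rewrite subr_gt0.
have [tm|/ltW mt] := leP t (s m.+1).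
  have [j [j' [a [[jm jm'] a01 E C]]]] := IH (ltnW mJ) tm.
  exists j, j', a; split => //.
    by move: jm jm' => /andP[-> /leqW->] /andP[-> /leqW->].
  rewrite /interp big_nat_recr//= addrA -/(interp m.+1 s y t) E clamp_le0 ?mulr0 ?addr0//.
  by rewrite pmulr_lle0 ?invr_gt0// subr_le0.
exists m.+1, m.+2, ((t - s m.+1) / (s m.+2 - s m.+1)).
have a01 : 0 <= (t - s m.+1) / (s m.+2 - s m.+1) <= 1.
  rewrite divr_ge0 ?subr_ge0 ?(ltW sm)//=.
  by rewrite ler_pdivrMr// mul1r lerB.
split=> //; [by rewrite /= !leqnn| |by right; rewrite mt tsm].
rewrite /interp big_nat_recr//= addrA -/(interp m.+1 s y t) clamp_id//.
rewrite (@interp_right J) ?(ltnW mJ)//.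
by ring.
Qed.

Lemma continuous_interp J s y : continuous (interp J s y).
Proof.
move=> t; rewrite /interp; apply: cvgD; first exact: cvg_cst.
apply: (continuous_sumr (f := fun j t => (y j.+1 - y j) * clamp ((t - s j) / (s j.+1 - s j)))) => j z.
apply: cvgM; first exact: cvg_cst.
apply: (@continuous_comp _ _ _ (fun t => (t - s j) / (s j.+1 - s j))).
  by apply: cvgM; [apply: cvgB; [exact: cvg_id|exact: cvg_cst]|exact: cvg_cst].
exact: continuous_clamp.
Qed.

Lemma C01_interp J s y : C01 (interp J s y).
Proof. by apply: continuous_subspaceT => t; exact: continuous_interp. Qed.

Lemma spacing_ge J s j : (j <= J)%N -> s j.+1 - s j <= spacing J s.
Proof.
move=> jJ; rewrite /spacing; have jJ' : (j < J.+1)%N by [].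
by rewrite (bigD1 (Ordinal jJ'))//= le_max lexx.
Qed.

(** Bounds on the interpolant and on its error both follow from this description. The two end
    pieces, where the interpolant is constant, are covered because the spacing includes the gaps
    next to 0 and 1. *)
Lemma interpP J s y t : is_grid J s -> (0 < J)%N -> t \in `[0, 1] ->
  exists j j' a, [/\ (0 < j <= J)%N /\ (0 < j' <= J)%N, 0 <= a <= 1,
    interp J s y t = (1 - a) * y j + a * y j' &
    `|t - s j| <= spacing J s /\ `|t - s j'| <= spacing J s].
Proof.
move=> g J0; rewrite in_itv/= => /andP[t0 t1].
have [s0 s1 _] := g.
have [tJ|/ltW Jt] := leP t (s J); last first.
  have H : `|t - s J| <= spacing J s.
    rewrite ger0_norm ?subr_ge0//; apply: le_trans (spacing_ge s (leqnn J)).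
    by rewrite lerD2r s1.
  exists J, J, 0; rewrite J0 leqnn lexx ler01; split => //.
  by rewrite (@interp_right J) ?J0//= subr0 mul1r mul0r addr0.
have [j [j' [a [[jJ jJ'] a01 -> C]]]] := interp_mid y g J0 tJ.
exists j, j', a; split=> //; case: C => [[ts [-> ->]]|[/andP[jt tj] j'E]].
  have H : `|t - s 1%N| <= spacing J s.
    rewrite distrC ger0_norm ?subr_ge0//.
    apply: le_trans (spacing_ge s (leq0n J)).
    by rewrite lerD2l lerN2 s0.
  by [].
have /(spacing_ge s) : (j <= J)%N by case/andP: jJ.
rewrite -j'E ger0_norm ?subr_ge0// ler0_norm ?subr_le0// => H; split.
  by apply: le_trans H; rewrite lerD2r.
by rewrite opprB; apply: le_trans H; rewrite lerD2l lerN2.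
Qed.

Lemma interp_norm_le J s y u t : is_grid J s -> (0 < J)%N -> t \in `[0, 1] ->
  (forall j, (0 < j <= J)%N -> `|y j| <= u) -> `|interp J s y t| <= u.
Proof.
move=> g J0 t01 yu; have [j [j' [a [[jJ jJ'] /andP[a0 a1] -> _]]]] := interpP y g J0 t01.
apply: le_trans (ler_normD _ _) _; rewrite !normrM (ger0_norm a0).
rewrite ger0_norm ?subr_ge0//; have := yu _ jJ; have := yu _ jJ'.
by move=> *; nra.
Qed.

Lemma interp_dist J s y x t c : is_grid J s -> (0 < J)%N -> t \in `[0, 1] ->
  (forall j, (0 < j <= J)%N -> `|t - s j| <= spacing J s -> `|x - y j| <= c) ->
  `|x - interp J s y t| <= c.
Proof.
move=> g J0 t01 yu; have [j [j' [a [[jJ jJ'] /andP[a0 a1] -> [dj dj']]]]] := interpP y g J0 t01.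
have -> : x - ((1 - a) * y j + a * y j') = (1 - a) * (x - y j) + a * (x - y j').
  by ring.
apply: le_trans (ler_normD _ _) _; rewrite !normrM (ger0_norm a0).
rewrite ger0_norm ?subr_ge0//; have := yu _ jJ dj; have := yu _ jJ' dj'.
by move=> *; nra.
Qed.

Lemma interpB J s y z t : interp J s y t - interp J s z t =
  interp J s (fun j => y j - z j) t.
Proof.
rewrite /interp opprD addrACA -sumrB; congr (_ + _).
by apply: eq_bigr => j _; ring.
Qed.

Lemma interp_grid J s y j : is_grid J s -> (0 < j <= J)%N -> interp J s y (s j) = y j.
Proof.
move=> g jJ; rewrite -(@interp_right J s y (s j) j)// /interp; congr (_ + _).
have [j0 jJ'] := andP jJ.
rewrite (big_cat_nat j0 jJ')/= -[RHS]addr0; congr (_ + _).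
rewrite big_nat_cond big1// => i /andP[/andP[ji iJ] _].
rewrite clamp_le0 ?mulr0//.
have si : s i < s i.+1 by apply: (is_grid_lt g); rewrite ltnSn ltnS ltnW.
rewrite pmulr_lle0 ?invr_gt0 ?subr_gt0// subr_le0.
by apply: (is_grid_le g); rewrite ji (leqW (ltnW iJ)).
Qed.
End Interpolation.

Section Chaining.
Context {R : realType}.
Implicit Types (x : R -> R) (s t th y : R) (k j : nat).

Lemma C01_eps x t e : C01 x -> t \in `[0, 1] -> 0 < e ->
  exists2 d : R, 0 < d &
    forall s, s \in `[0, 1] -> `|s - t| < d -> `|x s - x t| < e.
Proof.
move=> /subspace_continuousP xc t01 e0.
have := xc t t01 => /cvgrPdist_lt /(_ e e0).
rewrite near_withinE => /nbhs_ballP[d /= d0 H].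
exists d => // s s01 sd; rewrite distrC; apply: H => //.
by rewrite /ball/= distrC.
Qed.

Definition dyadic k j : R := j%:R / 2 ^+ k.

Definition dyadic_floor k t : R := dyadic k (Num.truncn (t * 2 ^+ k)).

Lemma exp2_gt0 k : 0 < 2 ^+ k :> R. Proof. by rewrite exprn_gt0. Qed.

Lemma dyadicS k j : dyadic k.+1 (j * 2) = dyadic k j.
Proof. by rewrite /dyadic natrM exprSr; field; rewrite gt_eqF ?exp2_gt0. Qed.

Lemma dyadic_floorP k t : 0 <= t ->
  dyadic_floor k t <= t < dyadic_floor k t + (2 ^+ k)^-1.
Proof.
move=> t0; have k0 := exp2_gt0 k.
have /truncn_itv/andP[lo hi] : 0 <= t * 2 ^+ k by rewrite mulr_ge0// ltW.
by rewrite /dyadic_floor /dyadic -{3}[_^-1]mul1r -mulrDl ler_pdivrMr// lo ltr_pdivlMr//= natr1.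
Qed.

Lemma dyadic_floor_itv k t : t \in `[0, 1] -> dyadic_floor k t \in `[0, 1].
Proof.
rewrite !in_itv/= => /andP[t0 t1]; have /andP[lo hi] := dyadic_floorP k t0.
by rewrite (le_trans lo t1) andbT /dyadic_floor /dyadic divr_ge0// ltW// exp2_gt0.
Qed.

Lemma truncn_dyadic_le k t : t \in `[0, 1] -> (Num.truncn (t * 2 ^+ k) <= 2 ^ k)%N.
Proof.
rewrite !in_itv/= => /andP[t0 t1]; have k0 := exp2_gt0 k.
have /truncn_itv/andP[lo _] : 0 <= t * 2 ^+ k by rewrite mulr_ge0// ltW.
rewrite -(ler_nat R) natrX; apply: le_trans lo _.
by rewrite ler_piMl// ltW.
Qed.

Section path.
Variables (x : R -> R) (th y : R).
Hypotheses (xc : C01 x) (th0 : 0 < th) (th1 : th < 1) (y0 : 0 <= y).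
Hypothesis xinc : forall k j, (j < 2 ^ k)%N ->
  `|x (dyadic k j.+1) - x (dyadic k j)| <= y * th ^+ k.

(** From level [k] to [k.+1] the numerator goes from [a] to [2 a] or [2 a + 1], so the two floors
    coincide or are the ends of one dyadic interval. *)
Lemma dyadic_floor_step k t : t \in `[0, 1] ->
  `|x (dyadic_floor k.+1 t) - x (dyadic_floor k t)| <= y * th ^+ k.+1.
Proof.
move=> t01; have := truncn_dyadic_le k.+1 t01.
have t0 : 0 <= t by move: t01; rewrite in_itv/= => /andP[].
rewrite /dyadic_floor -(dyadicS k); set a := Num.truncn (t * 2 ^+ k).
set b := Num.truncn _ => b2.
have bnd (z : R) : 0 <= z -> (Num.truncn z)%:R <= z < (Num.truncn z).+1%:R.
  by move=> z0; exact: truncn_itv.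
have /andP[la ha] := bnd _ (mulr_ge0 t0 (ltW (exp2_gt0 k))).
have /andP[lb hb] := bnd _ (mulr_ge0 t0 (ltW (exp2_gt0 k.+1))).
have ab : (a * 2 <= b)%N.
  rewrite -ltnS -(ltr_nat R); apply: le_lt_trans hb.
  by rewrite natrM exprSr mulrA ler_pM2r.
have ba : (b <= (a * 2).+1)%N.
  rewrite -ltnS -(ltr_nat R); apply: le_lt_trans lb _.
  by rewrite -[(a * 2).+2]/(a.+1 * 2)%N natrM exprSr mulrA ltr_pM2r.
have [->|] := eqVneq b (a * 2)%N.
  by rewrite subrr normr0 mulr_ge0// exprn_ge0// ltW.
move=> bn; have ba1 : b = (a * 2).+1.
  by apply/eqP; rewrite eqn_leq ba ltn_neqAle eq_sym bn ab.
by rewrite ba1; apply: xinc; rewrite -ba1.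
Qed.

Lemma dyadic_floor_sum k m t : t \in `[0, 1] ->
  `|x (dyadic_floor (k + m) t) - x (dyadic_floor k t)| <= y * th ^+ k / (1 - th).
Proof.
move=> t01; have d0 : 0 < 1 - th by rewrite subr_gt0.
(* The partial geometric sum is kept: the bound of the statement alone would not pass through the
   induction on [m]. *)
suff : `|x (dyadic_floor (k + m) t) - x (dyadic_floor k t)|
    <= y * th ^+ k * ((1 - th ^+ m) / (1 - th)).
  move/le_trans; apply; rewrite ler_wpM2l//.
    by rewrite mulr_ge0// exprn_ge0// ltW.
  by rewrite ler_pdivrMr// mulVf ?gt_eqF// gerBl exprn_ge0// ltW.
elim: m => [|m IH]; first by rewrite addn0 subrr normr0 expr0 subrr mul0r mulr0.
rewrite addnS -(subrKA (x (dyadic_floor (k + m) t))).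
apply: le_trans (ler_normD _ _) _.
apply: le_trans (lerD (dyadic_floor_step _ t01) IH) _.
have -> : y * th ^+ k * ((1 - th ^+ m.+1) / (1 - th)) =
   y * th ^+ (k + m) + y * th ^+ k * ((1 - th ^+ m) / (1 - th)).
  by rewrite exprD exprSr; field; rewrite gt_eqF.
by rewrite lerD2r ler_wpM2l// exprSr ler_piMr// ?(ltW th1)// ?exprn_ge0// ltW.
Qed.

(** Let [m] grow in [dyadic_floor_sum]: the dyadic floors converge to [t], where [x] is
    continuous. *)
Lemma dyadic_floor_dist k t : t \in `[0, 1] ->
  `|x t - x (dyadic_floor k t)| <= y * th ^+ k / (1 - th).
Proof.
move=> t01; apply/ler_addgt0Pr => e e0.
have [d d0 H] := C01_eps xc t01 e0.
have t0 : 0 <= t by move: t01; rewrite in_itv/= => /andP[].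
have [m md] : exists m : nat, (2 ^+ m)^-1 < d :> R.
  exists (Num.truncn d^-1).+1.
  rewrite invf_plt ?posrE ?exp2_gt0//.
  apply: (@lt_trans _ _ (Num.truncn d^-1).+1%:R); first by rewrite truncnS_gt.
  by rewrite -natrX ltr_nat ltn_expl.
have /andP[lo hi] := dyadic_floorP (k + m) t0.
have md' : `|dyadic_floor (k + m) t - t| < d.
  rewrite distrC ger0_norm ?subr_ge0// ltrBlDl.
  apply: lt_trans hi _; rewrite ltrD2l; apply: le_lt_trans md.
  by rewrite lef_pV2 ?posrE ?exp2_gt0// ler_weXn2l ?ler1n// leq_addl.
have {md'}H := H _ (dyadic_floor_itv _ t01) md'.
rewrite -(subrKA (x (dyadic_floor (k + m) t))) addrC.
apply: le_trans (ler_normD _ _) _; apply: lerD; first exact: dyadic_floor_sum.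
by rewrite distrC ltW.
Qed.

(** Kolmogorov chaining: the floors of [s] and [t] at level [k] coincide or are neighbours. The
    constant 3 counts the two tails from [dyadic_floor_dist] and the middle increment, which is
    enlarged by [1 / (1 - th)]. *)
Lemma chaining k s t : s \in `[0, 1] -> t \in `[0, 1] -> `|s - t| <= (2 ^+ k)^-1 ->
  `|x s - x t| <= 3 / (1 - th) * (y * th ^+ k).
Proof.
wlog st : s t / s <= t.
  move=> H; have [st|/ltW ts] := leP s t; first exact: H.
  by move=> s01 t01; rewrite distrC => sd; rewrite distrC; exact: H.
move=> s01 t01 d; have d0 : 0 < 1 - th by rewrite subr_gt0.
have sf := dyadic_floor_dist k s01; have tf := dyadic_floor_dist k t01.
have yk : 0 <= y * th ^+ k by rewrite mulr_ge0// exprn_ge0// ltW.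
have mid : `|x (dyadic_floor k t) - x (dyadic_floor k s)| <= y * th ^+ k.
  have := truncn_dyadic_le k t01.
  have s0 : 0 <= s by move: s01; rewrite in_itv/= => /andP[].
  have k0 := exp2_gt0 k.
  rewrite /dyadic_floor; set a := Num.truncn (s * _); set b := Num.truncn _ => b2.
  have /truncn_itv/andP[la ha] : 0 <= s * 2 ^+ k by rewrite mulr_ge0// ltW.
  have /truncn_itv/andP[lb hb] : 0 <= t * 2 ^+ k.
    by rewrite mulr_ge0// ?(le_trans s0)// ltW.
  have ab : (a <= b)%N.
    rewrite -ltnS -(ltr_nat R); apply: le_lt_trans hb; apply: le_trans la _.
    by rewrite ler_pM2r.
  have ba : (b <= a.+1)%N.
    rewrite -ltnS -(ltr_nat R); apply: le_lt_trans lb _.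
    apply: (@le_lt_trans _ _ (s * 2 ^+ k + 1)); last by rewrite -[a.+2]addn1 natrD ltrD2r.
    rewrite -lerBlDl -mulrBl -ler_pdivlMr// div1r.
    by apply: le_trans d; rewrite distrC ler_norm.
  have [->|bn] := eqVneq b a; first by rewrite subrr normr0.
  have ba1 : b = a.+1 by apply/eqP; rewrite eqn_leq ba ltn_neqAle eq_sym bn ab.
  by rewrite ba1; apply: xinc; rewrite -ba1.
have -> : x s - x t = (x s - x (dyadic_floor k s)) - (x t - x (dyadic_floor k t))
   - (x (dyadic_floor k t) - x (dyadic_floor k s)) by ring.
apply: le_trans (ler_normB _ _) _.
apply: le_trans (lerD (ler_normB _ _) (lexx _)) _.
apply: le_trans (lerD (lerD sf tf) mid) _.
have -> : 3 / (1 - th) * (y * th ^+ k) = y * th ^+ k / (1 - th) +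
  y * th ^+ k / (1 - th) + y * th ^+ k / (1 - th) by field; rewrite gt_eqF.
by rewrite lerD2l ler_pdivlMr// ler_piMr// gerBl ltW.
Qed.
End path.
End Chaining.

(** * Modulus of continuity and interpolation error from the path moment *)

Section PathMoment.
Context {R : realType}.
Implicit Types (x : R -> R) (s t th y q : R) (k j m : nat).

(* Finite in expectation for a Hoelder Gaussian process; dominates the modulus
   of continuity of x. *)
Definition path_moment m th x : \bar R :=
  ((`|x 0| ^+ m)%:E + \sum_(k <oo)
    (\sum_(j < 2 ^ k) (`|x (dyadic k j.+1) - x (dyadic k j)| / th ^+ k) ^+ m)%:E)%E.

Lemma path_moment_ge0 m th x : 0 < th -> (0 <= path_moment m th x)%E.
Proof.
move=> th0; rewrite adde_ge0 ?lee_fin ?exprn_ge0//.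
apply: nneseries_ge0 => k _ _; rewrite lee_fin; apply: sumr_ge0 => j _.
by rewrite exprn_ge0// divr_ge0// exprn_ge0// ltW.
Qed.

Lemma path_moment_bound m th x q : 0 < th -> (path_moment m th x <= q%:E)%E ->
  `|x 0| ^+ m <= q /\ forall k j, (j < 2 ^ k)%N ->
  (`|x (dyadic k j.+1) - x (dyadic k j)| / th ^+ k) ^+ m <= q.
Proof.
move=> th0; rewrite /path_moment; set S := (\sum_(_ <oo) _)%E => H.
have term_ge0 k j : 0 <= (`|x (dyadic k j.+1) - x (dyadic k j)| / th ^+ k) ^+ m.
  by rewrite exprn_ge0// divr_ge0// exprn_ge0// ltW.
have S0 : (0 <= S)%E.
  by apply: nneseries_ge0 => k _ _; rewrite lee_fin; apply: sumr_ge0.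
split; first by rewrite -lee_fin; apply: le_trans H; rewrite leeDl.
move=> k j jk; rewrite -lee_fin; apply: le_trans H.
apply: le_trans (leeDr _ _); last by rewrite lee_fin exprn_ge0.
rewrite /S (@nneseriesD1 _ _ k)//=; last first.
  by move=> i _; rewrite lee_fin; apply: sumr_ge0.
apply: (@le_trans _ _ (\sum_(j < 2 ^ k)
  (`|x (dyadic k j.+1) - x (dyadic k j)| / th ^+ k) ^+ m)%:E).
  by rewrite lee_fin (bigD1 (Ordinal jk))//= lerDl sumr_ge0.
rewrite leeDl//; apply: nneseries_ge0 => i _ _; rewrite lee_fin; exact: sumr_ge0.
Qed.

(** [y] is the [m]-th root of [q]. A bound on the sum bounds each scaled increment by [y], and
    chaining turns this into a Hoelder modulus; its level 0, compared with [x 0], bounds the whole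
    path. *)
Lemma path_moment_modulus m th x q : C01 x -> 0 < th -> th < 1 -> (0 < m)%N ->
  (path_moment m th x <= q%:E)%E ->
  exists y, [/\ 0 <= y, y ^+ m = q,
    forall t, t \in `[0, 1] -> `|x t| <= (1 + 3 / (1 - th)) * y &
    forall k s t, s \in `[0, 1] -> t \in `[0, 1] -> `|s - t| <= (2 ^+ k)^-1 ->
      `|x s - x t| <= 3 / (1 - th) * (y * th ^+ k)].
Proof.
move=> xc th0 th1 m0 /(path_moment_bound th0)[xq incq].
have q0 : 0 <= q by apply: le_trans xq; rewrite exprn_ge0.
have [y y0 yq] : exists2 y, 0 <= y & y ^+ m = q.
  exists (q `^ m%:R^-1); first exact: powR_ge0.
  by rewrite -powR_mulrn ?powR_ge0// -powRrM mulVf ?powRr1// pnatr_eq0 -lt0n.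
have mono a : 0 <= a -> a ^+ m <= q -> a <= y.
  by move=> a0; rewrite -yq ler_pXn2r.
have inc k j : (j < 2 ^ k)%N -> `|x (dyadic k j.+1) - x (dyadic k j)| <= y * th ^+ k.
  move=> /incq H; rewrite -ler_pdivrMr ?exprn_gt0//; apply: mono H.
  by rewrite divr_ge0// exprn_ge0// ltW.
exists y; split => // [t t01|k s t s01 t01 d]; last exact: chaining d.
have i0 : 0 \in `[0, 1 : R] by rewrite in_itv/= lexx ler01.
have := @chaining R x th y xc th0 th1 y0 inc 0%N t 0 t01 i0.
rewrite subr0 !expr0 invr1 mulr1 => /(_ _)/wrap[].
  by move: t01; rewrite in_itv/= => /andP[t0 t1]; rewrite ger0_norm.
move=> H; have := mono _ (normr_ge0 (x 0)) xq => x0y.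
have := ler_normD (x t - x 0) (x 0); rewrite subrK => /le_trans; apply.
by rewrite mulrDl mul1r addrC lerD.
Qed.

Lemma interp_modulus x J (s : nat -> R) k c : is_grid J s -> (0 < J)%N ->
  spacing J s <= (2 ^+ k)^-1 ->
  (forall s t, s \in `[0, 1] -> t \in `[0, 1] -> `|s - t| <= (2 ^+ k)^-1 ->
      `|x s - x t| <= c) ->
  forall t, t \in `[0, 1] -> `|x t - interp J s (x \o s) t| <= c.
Proof.
move=> g J0 sk H t t01; apply: interp_dist => // j /andP[j0 jJ] d /=.
apply: H => //; last exact: le_trans d sk.
by apply: (is_grid_01 g); rewrite leqW.
Qed.

Lemma exprD1_le m y : 0 <= y -> (1 + y) ^+ m <= 2 ^+ m * (1 + y ^+ m).
Proof.
move=> y0; have [y1|/ltW y1] := leP y 1.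
  apply: (@le_trans _ _ (2 ^+ m)); last first.
    by rewrite ler_peMr ?exprn_ge0// lerDl exprn_ge0.
  by rewrite lerXn2r ?nnegrE ?addr_ge0//; lra.
apply: (@le_trans _ _ ((2 * y) ^+ m)); last first.
  by rewrite exprMn ler_wpM2l ?exprn_ge0// lerDr.
by rewrite lerXn2r ?nnegrE ?addr_ge0 ?mulr_ge0//; lra.
Qed.

Lemma powRX_comm (a r : R) k : 0 <= a -> (a ^+ k) `^ r = (a `^ r) ^+ k.
Proof.
move=> a0; rewrite -(powR_mulrn k a0) -powRrM mulrC powRrM.
by rewrite powR_mulrn// powR_ge0.
Qed.

(** A path with moment [q] and its interpolant are bounded by [U], of order [1 + q^(1/m)], and
    differ by at most [U th^k]. The local Hoelder condition gives a squared error of order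
    [U^(2 nu + 2 alpha) th^(2 alpha k)], and [m] is large enough for the power of [U] to be at most
    linear in [q], hence integrable. *)
Lemma operator_interp_error (G0 : (R -> R) -> R -> R) (alpha nu C0 : R) m th :
  (forall x, C01 x -> C01 (G0 x)) -> 0 < alpha -> 0 < nu -> 0 <= C0 ->
  (forall u, 1 <= u -> forall x1 x2 : R -> R,
    C01 x1 -> C01 x2 -> supnorm `[0, 1] x1 <= u -> supnorm `[0, 1] x2 <= u ->
    supnorm `[0, 1] (fun t => G0 x1 t - G0 x2 t) <=
      C0 * u `^ nu * supnorm `[0, 1] (fun t => x1 t - x2 t) `^ alpha) ->
  0 < th -> th < 1 -> 2 * nu + 2 * alpha <= m%:R ->
  exists C vth, [/\ 0 <= C, 0 <= vth, vth < 1 &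
    forall x q k J (s : nat -> R) t, C01 x -> is_grid J s -> (0 < J)%N ->
    spacing J s <= (2 ^+ k)^-1 -> (path_moment m th x <= q%:E)%E ->
    t \in `[0, 1] ->
    (G0 x t - G0 (interp J s (x \o s)) t) ^+ 2 <= C * (1 + q) * vth ^+ k].
Proof.
move=> G0c al0 nu0 C00 hol th0 th1 mnu.
have m0 : (0 < m)%N by rewrite -(ltr_nat R); apply: lt_le_trans mnu; rewrite addr_gt0 ?mulr_gt0.
have d0 : 0 < 1 - th by rewrite subr_gt0.
pose D := 1 + 3 / (1 - th); have D1 : 1 <= D by rewrite lerDl divr_ge0// ltW.
have D0 : 0 < D by exact: lt_le_trans D1.
pose C := C0 ^+ 2 * (D ^+ m * 2 ^+ m); exists C, (th `^ (2 * alpha)); split.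
- by rewrite /C !mulr_ge0 ?exprn_ge0 ?(ltW D0).
- exact: powR_ge0.
- have := gt0_ltr_powR (mulr_gt0 (ltr0n R 2) al0) _ _ th1.
  by rewrite powR1; apply; rewrite nnegrE ?ler01 ?ltW.
move=> x q k J s t xc g J0 sk xq t01.
have [y [y0 yq xy xm]] := path_moment_modulus xc th0 th1 m0 xq.
have yk : 0 <= y * th ^+ k by rewrite mulr_ge0// exprn_ge0// ltW.
have ix : C01 (interp J s (x \o s)) by exact: C01_interp.
pose U := D * (1 + y).
have U1 : 1 <= U by rewrite /U; nra.
have DyU : D * y <= U by rewrite /U ler_pM2l// lerDr.
have supx : supnorm `[0, 1] x <= U.
  by apply: supnorm_le; [lra|move=> r r01; apply: le_trans DyU; exact: xy].
have supi : supnorm `[0, 1] (interp J s (x \o s)) <= U.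
  apply: supnorm_le; [lra|move=> r r01]; apply: interp_norm_le => // j /andP[j0 jJ].
  by apply: le_trans DyU; apply: xy; apply: (is_grid_01 g); rewrite leqW.
have supd : supnorm `[0, 1] (fun t => x t - interp J s (x \o s) t) <= U * th ^+ k.
  apply: supnorm_le => [|r r01]; first by rewrite mulr_ge0 ?exprn_ge0 ?(ltW th0)//; lra.
  apply: (interp_modulus g J0 sk) r01 => a b a01 b01 ab.
  apply: le_trans (xm _ _ _ a01 b01 ab) _; rewrite mulrA ler_wpM2r ?exprn_ge0 ?(ltW th0)//.
  by apply: le_trans DyU; rewrite ler_wpM2r// lerDr.
have := hol U U1 _ _ xc ix supx supi.
set S := supnorm _ _ => SU.
have GS : `|G0 x t - G0 (interp J s (x \o s)) t| <= S.
  have [c1 H1] := C01_bounded (G0c _ xc); have [c2 H2] := C01_bounded (G0c _ ix).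
  apply: (@supnorm_ub _ _ (fun t => G0 x t - G0 (interp J s (x \o s)) t) (c1 + c2)) => // r r01.
  by apply: le_trans (ler_normB _ _) _; rewrite lerD ?H1 ?H2.
have Ual : supnorm `[0, 1] (fun t => x t - interp J s (x \o s) t) `^ alpha <=
  (U * th ^+ k) `^ alpha.
  by rewrite ge0_ler_powR ?nnegrE ?supnorm_ge0// ?mulr_ge0 ?exprn_ge0 ?(ltW al0) ?(ltW th0)//; lra.
have U0 : 0 <= U by lra.
have B : `|G0 x t - G0 (interp J s (x \o s)) t| <= C0 * U `^ nu * (U * th ^+ k) `^ alpha.
  apply: le_trans GS _; apply: le_trans SU _; rewrite ler_wpM2l//.
  by rewrite mulr_ge0// powR_ge0.
rewrite -real_normK ?num_real//; apply: le_trans (_ : _ <= (C0 * U `^ nu * (U * th ^+ k) `^ alpha) ^+ 2) _.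
  by rewrite lerXn2r ?nnegrE ?mulr_ge0 ?powR_ge0.
have -> : (C0 * U `^ nu * (U * th ^+ k) `^ alpha) ^+ 2 =
   C0 ^+ 2 * U `^ (2 * nu + 2 * alpha) * (th `^ (2 * alpha)) ^+ k.
  have p2 (a r : R) : (a `^ r) ^+ 2 = a `^ (2 * r).
    by rewrite -powR_mulrn ?powR_ge0// -powRrM mulrC.
  have -> : (U * th ^+ k) `^ alpha = U `^ alpha * (th ^+ k) `^ alpha.
    by rewrite powRM// exprn_ge0// ltW.
  rewrite !exprMn !p2 powRD; last by apply/implyP => _; rewrite gt_eqF//; lra.
  have -> : (th ^+ k) `^ (2 * alpha) = (th `^ (2 * alpha)) ^+ k.
    by rewrite powRX_comm// ltW.
  by rewrite !mulrA.
have -> : C * (1 + q) = C0 ^+ 2 * (D ^+ m * (2 ^+ m * (1 + q))).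
  by rewrite /C -(mulrA (C0 ^+ 2)) -(mulrA (D ^+ m)).
rewrite ler_wpM2r ?exprn_ge0 ?powR_ge0// ler_wpM2l ?exprn_ge0//.
apply: (@le_trans _ _ (U ^+ m)); last first.
  by rewrite /U exprMn ler_wpM2l ?exprn_ge0 ?(ltW D0)// -yq exprD1_le.
by rewrite -powR_mulrn// ler_powR.
Qed.

End PathMoment.

(** * Universal approximation of operators *)

Section Bernstein.
Context {R : realType}.
Implicit Types (z : R) (N k : nat).

Definition bern N z k : R := 'C(N, k)%:R * z ^+ k * (1 - z) ^+ (N - k).

Lemma bern_ge0 N z k : 0 <= z <= 1 -> 0 <= bern N z k.
Proof.
by move=> /andP[z0 z1]; rewrite /bern !mulr_ge0// exprn_ge0// subr_ge0.
Qed.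

(** Conditioning a binomial variable with [N.+1] trials on one of them; algebraically, Pascal's
    rule. Total mass and variance follow by induction. *)
Lemma bern_sumS N z (g : nat -> R) :
  \sum_(k < N.+2) bern N.+1 z k * g k =
  \sum_(k < N.+1) bern N z k * (z * g k.+1 + (1 - z) * g k).
Proof.
have -> : \sum_(k < N.+1) bern N z k * (z * g k.+1 + (1 - z) * g k) =
  \sum_(k < N.+1) bern N z k * z * g k.+1 + \sum_(k < N.+1) bern N z k * (1 - z) * g k.
  by rewrite -big_split; apply: eq_bigr => k _ /=; ring.
rewrite big_ord_recl/=.
have -> : \sum_(i < N.+1) bern N.+1 z (bump 0 i) * g (bump 0 i) =
  \sum_(k < N.+1) bern N z k * z * g k.+1 +
  \sum_(k < N.+1) 'C(N, k.+1)%:R * z ^+ k.+1 * (1 - z) ^+ (N - k) * g k.+1.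
  rewrite -big_split; apply: eq_bigr => k _ /=.
  by rewrite /bump/= add1n /bern binS natrD subSS exprS; ring.
rewrite addrCA; congr (_ + _).
rewrite big_ord_recr/= bin_small// !mul0r addr0 [RHS]big_ord_recl/=; congr (_ + _).
  by rewrite /bern !bin0 !expr0 !subn0 exprSr; ring.
apply: eq_bigr => k _; rewrite /bump/= add1n /bern -[(N - k)%N](@subnSK k N)//.
by rewrite [(1 - z) ^+ _.+1]exprSr; ring.
Qed.

Lemma bern_sum1 N z : \sum_(k < N.+1) bern N z k = 1.
Proof.
elim: N => [|N IH].
  by rewrite big_ord_recl big_ord0 addr0 /bern bin0 !expr0 !mulr1.
have := bern_sumS N z (cst 1); under eq_bigr do rewrite mulr1.
by move=> ->; under eq_bigr do rewrite /cst !mulr1 addrC subrK mulr1.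
Qed.

Lemma bern_var N z :
  \sum_(k < N.+1) bern N z k * (k%:R - N%:R * z) ^+ 2 = N%:R * (z * (1 - z)).
Proof.
elim: N => [|N IH].
  rewrite big_ord_recl big_ord0 !mul0r addr0 /bern bin0 !expr0 !mulr1.
  by rewrite /= subr0 expr0n mulr0.
rewrite (bern_sumS N z (fun k => (k%:R - N.+1%:R * z) ^+ 2)).
under eq_bigr => k _.
  have -> : bern N z k * (z * (k.+1%:R - N.+1%:R * z) ^+ 2 +
      (1 - z) * (k%:R - N.+1%:R * z) ^+ 2) =
    bern N z k * (k%:R - N%:R * z) ^+ 2 + bern N z k * (z * (1 - z)).
    by rewrite -!natr1; ring.
  over.
by rewrite big_split/= IH -mulr_suml bern_sum1 -natr1; ring.
Qed.

Lemma bern_var_le N z : 0 <= z <= 1 -> (0 < N)%N ->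
  \sum_(k < N.+1) bern N z k * (k%:R / N%:R - z) ^+ 2 <= N%:R^-1.
Proof.
move=> /andP[z0 z1] N0; have N0' : 0 < N%:R :> R by rewrite ltr0n.
have -> : \sum_(k < N.+1) bern N z k * (k%:R / N%:R - z) ^+ 2 =
  (\sum_(k < N.+1) bern N z k * (k%:R - N%:R * z) ^+ 2) / N%:R ^+ 2.
  rewrite mulr_suml; apply: eq_bigr => k _; field; exact: lt0r_neq0.
rewrite bern_var.
have -> : N%:R * (z * (1 - z)) / N%:R ^+ 2 = (z * (1 - z)) * N%:R^-1.
  by field; rewrite gt_eqF.
by rewrite ler_piMl ?invr_ge0//; nra.
Qed.

Variable I : finType.

(** Tensor product Bernstein polynomial: the probability that independent binomial variables with
    parameters [N] and [z i] take the values [f i]. *)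
Definition mbern N (z : I -> R) (f : {ffun I -> 'I_N.+1}) : R :=
  \prod_i bern N (z i) (f i).

Lemma mbern_ge0 N (z : I -> R) f : (forall i, 0 <= z i <= 1) -> 0 <= @mbern N z f.
Proof. by move=> z01; apply: prodr_ge0 => i _; exact: bern_ge0. Qed.

Lemma mbern_sum1 N (z : I -> R) : \sum_f @mbern N z f = 1.
Proof.
rewrite -(bigA_distr_bigA (fun i (k : 'I_N.+1) => bern N (z i) k)).
by rewrite big1// => i _; exact: bern_sum1.
Qed.

Lemma mbern_le1 N (z : I -> R) f : (forall i, 0 <= z i <= 1) -> @mbern N z f <= 1.
Proof.
move=> z01; rewrite -(mbern_sum1 N z) (bigD1 f)//= lerDl.
by apply: sumr_ge0 => g _; exact: mbern_ge0.
Qed.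

Lemma mbern_var N (z : I -> R) : (forall i, 0 <= z i <= 1) -> (0 < N)%N ->
  \sum_f @mbern N z f * (\sum_i ((f i)%:R / N%:R - z i) ^+ 2) <= #|I|%:R / N%:R.
Proof.
move=> z01 N0; under eq_bigr do rewrite mulr_sumr.
rewrite exchange_big/= -mulr_natl -sum1_card natr_sum mulr1 mulr_suml.
apply: ler_sum => i _; rewrite mul1r.
apply: le_trans (bern_var_le (z01 i) N0).
rewrite le_eqVlt; apply/orP; left; apply/eqP.
(* The square is attached to coordinate [i] only, so the sum over all [f] factors into
   one-dimensional sums, of which all but the [i]-th equal 1. *)
pose F j (k : 'I_N.+1) := bern N (z j) k *
  (if j == i then (k%:R / N%:R - z i) ^+ 2 else 1).
transitivity (\sum_(f : {ffun I -> 'I_N.+1}) \prod_j F j (f j)).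
  apply: eq_bigr => f _; rewrite /F big_split/=; congr (_ * _).
  by rewrite -big_mkcond/= big_pred1_eq.
rewrite -(bigA_distr_bigA F) (bigD1 i)//= [X in _ * X]big1 ?mulr1; last first.
  move=> j ji; rewrite /F (negbTE ji); under eq_bigr do rewrite mulr1.
  exact: bern_sum1.
by rewrite /F eqxx.
Qed.

End Bernstein.

(** Chebyshev's argument: nodes with [d k <= del] contribute at most [e], and on the others 1 is at
    most [d k / del]. *)
Lemma weighted_approx (R : realType) (K : finType) (p d g : K -> R) (a e M V del : R) :
  (forall k, 0 <= p k) -> \sum_k p k = 1 -> \sum_k p k * d k <= V ->
  0 < del -> 0 <= e -> 0 <= M -> (forall k, 0 <= d k) ->
  (forall k, d k <= del -> `|a - g k| <= e) -> (forall k, `|a - g k| <= M) ->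
  `|a - \sum_k p k * g k| <= e + M * V / del.
Proof.
move=> p0 p1 pV del0 e0 M0 d0 Hn Hf.
have -> : a - \sum_k p k * g k = \sum_k p k * (a - g k).
  by under [RHS]eq_bigr do rewrite mulrBr; rewrite sumrB -mulr_suml p1 mul1r.
apply: le_trans (ler_norm_sum _ _ _) _.
apply: (@le_trans _ _ (\sum_k (p k * e + M / del * (p k * d k)))).
  apply: ler_sum => k _; rewrite normrM (ger0_norm (p0 k)) mulrCA -mulrDr ler_wpM2l//.
  have [dk|dk] := leP (d k) del.
    by apply: le_trans (Hn _ dk) _; rewrite lerDl mulr_ge0// divr_ge0// ltW.
  by apply: le_trans (Hf k) _; rewrite ler_wpDl// mulrAC ler_pdivlMr// ler_wpM2l// ltW.
rewrite big_split/= -mulr_suml p1 mul1r lerD2l -mulr_sumr [M * V / _]mulrAC ler_wpM2l//.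
by rewrite divr_ge0// ltW.
Qed.

(** * Exponential sums, ridge sums and networks *)

Section UniversalApproximation.
Context {R : realType}.
Variables (sigma : R -> R) (J : nat) (u : R).
Hypotheses (sigma_TW : tauber_wiener sigma) (u0 : 0 < u).
Implicit Types (y : nat -> R) (f : (nat -> R) -> R).

Definition box y := forall j, (0 < j <= J)%N -> `|y j| <= u.

Definition dot (m : 'I_J -> R) y : R := \sum_j m j * y j.+1.

(** Exponentials of linear forms are ridge functions and, unlike monomials in the coordinates,
    remain so under products. This algebra therefore carries polynomial approximation over to ridge
    functions. *)
Definition exp_sum (l : seq (R * ('I_J -> R))) y : R :=
  \sum_(a <- l) a.1 * expR (dot a.2 y).

Definition is_exp_sum f := exists l, forall y, f y = exp_sum l y.

Definition ridge_sum (l : seq (R * ('I_J -> R) * R)) y : R :=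
  \sum_(a <- l) a.1.1 * sigma (dot a.1.2 y + a.2).

Definition ridge_approx f := forall e : R, 0 < e ->
  exists l, forall y, box y -> `|f y - ridge_sum l y| <= e.

Lemma exp_sum_cst c : is_exp_sum (fun=> c).
Proof.
exists [:: (c, fun=> 0)] => y; rewrite /exp_sum big_seq1/= /dot big1 ?expR0 ?mulr1//.
by move=> i _; rewrite mul0r.
Qed.

Lemma exp_sum_var (i : 'I_J) : is_exp_sum (fun y => expR (y i.+1)).
Proof.
exists [:: (1, fun j => (j == i)%:R)] => y; rewrite /exp_sum big_seq1/= mul1r /dot.
rewrite (bigD1 i)//= eqxx mul1r big1 ?addr0// => j /negbTE->.
by rewrite mul0r.
Qed.

Lemma exp_sumD f g : is_exp_sum f -> is_exp_sum g -> is_exp_sum (fun y => f y + g y).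
Proof.
by move=> [l fl] [k gk]; exists (l ++ k) => y; rewrite fl gk /exp_sum big_cat.
Qed.

Lemma exp_sumM f g : is_exp_sum f -> is_exp_sum g -> is_exp_sum (fun y => f y * g y).
Proof.
move=> [l fl] [k gk].
exists [seq (a.1 * b.1, fun j => a.2 j + b.2 j) | a <- l, b <- k] => y.
rewrite fl gk /exp_sum big_allpairs_dep/= mulr_suml; apply: eq_bigr => a _.
rewrite mulr_sumr; apply: eq_bigr => b _.
have -> : dot (fun j => a.2 j + b.2 j) y = dot a.2 y + dot b.2 y.
  by rewrite /dot -big_split/=; apply: eq_bigr => j _; rewrite mulrDl.
by rewrite expRD; ring.
Qed.

Lemma exp_sumX f n : is_exp_sum f -> is_exp_sum (fun y => f y ^+ n).
Proof.
move=> fe; elim: n => [|n IH]; first exact: exp_sum_cst.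
have -> : (fun y => f y ^+ n.+1) = (fun y => f y * f y ^+ n).
  by apply/funext => y; rewrite exprS.
exact: exp_sumM.
Qed.

Lemma exp_sum_prod (I : Type) (r : seq I) (F : I -> (nat -> R) -> R) :
  (forall i, is_exp_sum (F i)) -> is_exp_sum (fun y => \prod_(i <- r) F i y).
Proof.
move=> Fe; elim: r => [|i r IH].
  by case: (exp_sum_cst 1) => l ll; exists l => y; rewrite big_nil.
have -> : (fun y => \prod_(j <- i :: r) F j y) = (fun y => F i y * \prod_(j <- r) F j y).
  by apply/funext => y; rewrite big_cons.
exact: exp_sumM.
Qed.

Lemma ridge_approxD f g : ridge_approx f -> ridge_approx g ->
  ridge_approx (fun y => f y + g y).
Proof.
move=> fr gr e e0; have e2 : 0 < e / 2 by rewrite divr_gt0.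
have [l Hl] := fr _ e2; have [k Hk] := gr _ e2; exists (l ++ k) => y yb.
rewrite /ridge_sum big_cat/= opprD addrACA; apply: le_trans (ler_normD _ _) _.
by rewrite [e]splitr lerD// ?Hl ?Hk.
Qed.

Lemma ridge_approxZ c f : ridge_approx f -> ridge_approx (fun y => c * f y).
Proof.
move=> fr e e0; have c1 : 0 < `|c| + 1 by rewrite ltr_wpDl.
have e2 : 0 < e / (`|c| + 1) by rewrite divr_gt0.
have [l Hl] := fr _ e2; exists [seq (c * a.1.1, a.1.2, a.2) | a <- l] => y yb.
rewrite /ridge_sum big_map/=.
under eq_bigr do rewrite -mulrA.
rewrite -mulr_sumr -mulrBr normrM; apply: le_trans (ler_wpM2l (normr_ge0 _) (Hl y yb)) _.
by rewrite mulrCA ler_piMr// ?(ltW e0)// ler_pdivrMr// mul1r lerDl.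
Qed.

Lemma dot_le (m : 'I_J -> R) y : box y -> `|dot m y| <= (\sum_j `|m j|) * u.
Proof.
move=> yb; apply: le_trans (ler_norm_sum _ _ _) _; rewrite mulr_suml.
apply: ler_sum => j _; rewrite normrM ler_wpM2l//; apply: yb.
by rewrite /= ltn_ord.
Qed.

Lemma ridge_approx_exp (m : 'I_J -> R) : ridge_approx (fun y => expR (dot m y)).
Proof.
(* On the box the linear form stays in [[- A, A]], where the one-variable exponential is
   approximated; the added 1 keeps this interval nondegenerate. *)
move=> e e0; pose A := (\sum_j `|m j|) * u + 1.
have A0 : 0 < A.
  by rewrite ltr_wpDl// mulr_ge0// ?(ltW u0)//; apply: sumr_ge0.
have AA : - A < A by rewrite gtrN.
have ec : {within `[- A, A], continuous (@expR R)}.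
  by apply: continuous_subspaceT => x; exact: continuous_expR.
have [n [c [lam [th H]]]] := sigma_TW AA ec e0.
exists [seq (c i, fun j => lam i * m j, th i) | i <- enum 'I_n] => y yb.
rewrite /ridge_sum big_map big_enum/=.
under eq_bigr => i _.
  have -> : dot (fun j => lam i * m j) y = lam i * dot m y.
    by rewrite /dot mulr_sumr; apply: eq_bigr => j _; rewrite mulrA.
  over.
apply/ltW/H; rewrite in_itv/= -ler_norml; apply: le_trans (dot_le m yb) _.
by rewrite lerDl.
Qed.

Lemma exp_sum_ridge f : is_exp_sum f -> ridge_approx f.
Proof.
move=> [l fl]; have -> : f = exp_sum l by apply/funext.
elim: l {fl} => [|a l IH] e e0.
  by exists [::] => y _; rewrite /exp_sum /ridge_sum !big_nil subrr normr0 ltW.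
have [k Hk] := ridge_approxD (ridge_approxZ a.1 (ridge_approx_exp a.2)) IH e0.
by exists k => y yb; rewrite /exp_sum big_cons; exact: Hk.
Qed.

(* One hidden unit: output weight, input weights, input bias, and the weight
   and bias of the factor depending on the location. *)
Definition unit_params : Type := R * ('I_J -> R) * R * R * R.

Definition net_sum (l : seq unit_params) y t : R :=
  \sum_(a <- l) a.1.1.1.1 * sigma (dot a.1.1.1.2 y + a.1.1.2) * sigma (a.1.2 * t + a.2).

Definition net_approx (F : (nat -> R) -> R -> R) := forall e : R, 0 < e ->
  exists l, forall y t, box y -> t \in `[0, 1] -> `|F y t - net_sum l y t| <= e.

Lemma net_approxD F G : net_approx F -> net_approx G ->
  net_approx (fun y t => F y t + G y t).
Proof.
move=> fr gr e e0; have e2 : 0 < e / 2 by rewrite divr_gt0.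
have [l Hl] := fr _ e2; have [k Hk] := gr _ e2; exists (l ++ k) => y t yb t01.
rewrite /net_sum big_cat/= opprD addrACA; apply: le_trans (ler_normD _ _) _.
by rewrite [e]splitr lerD// ?Hl ?Hk.
Qed.

Lemma net_approx_sum (I : Type) (r : seq I) (F : I -> (nat -> R) -> R -> R) :
  (forall i, net_approx (F i)) -> net_approx (fun y t => \sum_(i <- r) F i y t).
Proof.
move=> Fe; elim: r => [|i r IH] e e0.
  by exists [::] => y t _ _; rewrite /net_sum !big_nil subrr normr0 ltW.
have [k Hk] := net_approxD (Fe i) IH e0.
by exists k => y t yb t01; rewrite big_cons; exact: Hk.
Qed.

(** The product of a ridge sum in the path and a sum in the location expands into one hidden unit
    per pair of terms. *)
Lemma net_approxM f (g : R -> R) : ridge_approx f -> C01 g ->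
  (forall y, box y -> `|f y| <= 1) -> net_approx (fun y t => f y * g t).
Proof.
move=> fr gc f1 e e0.
have [c gb] := C01_bounded gc.
have c0 : 0 <= c by apply: le_trans (gb 0 _); rewrite // in_itv/= lexx ler01.
(* Accuracy at most 1 keeps the ridge sum bounded by 2, as [f] is bounded by 1; [c + 1] avoids a
   zero denominator. *)
have e1 : 0 < Num.min 1 (e / 2 / (c + 1)).
  by rewrite lt_min ltr01 !divr_gt0// ltr_wpDl.
have [l Hl] := fr _ e1; have e4 : 0 < e / 4 by rewrite divr_gt0.
have [n [b [lam [th H]]]] := sigma_TW ltr01 gc e4.
exists [seq (a.1.1 * b i, a.1.2, a.2, lam i, th i) | a <- l, i <- enum 'I_n] => y t yb t01.
have -> : net_sum [seq (a.1.1 * b i, a.1.2, a.2, lam i, th i) | a <- l, i <- enum 'I_n] y t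
   = ridge_sum l y * \sum_(i < n) b i * sigma (lam i * t + th i).
  rewrite /net_sum big_allpairs_dep/= /ridge_sum mulr_suml; apply: eq_bigr => a _.
  by rewrite big_enum/= mulr_sumr; apply: eq_bigr => i _; ring.
have {}H := H t t01; have {}Hl := Hl y yb; have {}gb := gb t t01; have {}f1 := f1 y yb.
move: Hl; rewrite le_min => /andP[Hl1 Hl2].
set G := \sum_(i < n) _ in H *; set F := ridge_sum l y in Hl1 Hl2 *.
have F2 : `|F| <= 2.
  have := ler_normB (f y) (f y - F); rewrite opprB addrCA subrr addr0 => /le_trans; apply; lra.
have -> : f y * g t - F * G = (f y - F) * g t + F * (g t - G) by ring.
apply: le_trans (ler_normD _ _) _; rewrite !normrM [e]splitr lerD//.
  apply: (@le_trans _ _ (e / 2 / (c + 1) * (c + 1))).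
    by apply: ler_pM => //; apply: le_trans gb _; rewrite lerDl.
  by rewrite divfK// gt_eqF// ltr_wpDl.
apply: (@le_trans _ _ (2 * (e / 4))); last by lra.
by apply: ler_pM => //; exact: ltW.
Qed.

End UniversalApproximation.

Section OperatorApprox.
Context {R : realType}.
Variables (sigma : R -> R) (J : nat) (s : nat -> R) (u : R).
Variables (G0 : (R -> R) -> R -> R) (alpha nu C0 : R).
Hypotheses (sigma_TW : tauber_wiener sigma) (u1 : 1 <= u) (g : is_grid J s) (J0 : (0 < J)%N).
Hypotheses (G0c : forall x, C01 x -> C01 (G0 x)) (al0 : 0 < alpha) (C00 : 0 <= C0).
Hypothesis hol : forall u, 1 <= u -> forall x1 x2 : R -> R,
    C01 x1 -> C01 x2 -> supnorm `[0, 1] x1 <= u -> supnorm `[0, 1] x2 <= u ->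
    supnorm `[0, 1] (fun t => G0 x1 t - G0 x2 t) <=
      C0 * u `^ nu * supnorm `[0, 1] (fun t => x1 t - x2 t) `^ alpha.

Let u0 : 0 < u. Proof. exact: lt_le_trans u1. Qed.

(** Interpolation does not increase the sup norm, so through it the operator becomes a Hoelder
    function of finitely many node values, uniformly in the location. *)
Lemma operator_holder_box (y y' : nat -> R) (c t : R) : box J u y -> box J u y' -> 0 <= c ->
  (forall j, (0 < j <= J)%N -> `|y j - y' j| <= c) -> t \in `[0, 1] ->
  `|G0 (interp J s y) t - G0 (interp J s y') t| <= C0 * u `^ nu * c `^ alpha.
Proof.
move=> yb yb' c0 yc t01; have iy := @C01_interp R J s y; have iy' := @C01_interp R J s y'.
have sup z : box J u z -> supnorm `[0, 1] (interp J s z) <= u.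
  by move=> zb; apply: supnorm_le => [|r r01]; [exact: ltW|exact: interp_norm_le].
have sd : supnorm `[0, 1] (fun t => interp J s y t - interp J s y' t) <= c.
  by apply: supnorm_le => // r r01; rewrite interpB; exact: interp_norm_le.
have := hol u1 iy iy' (sup _ yb) (sup _ yb').
set S := supnorm _ _ => SU.
have GS : `|G0 (interp J s y) t - G0 (interp J s y') t| <= S.
  have [c1 H1] := C01_bounded (G0c iy); have [c2 H2] := C01_bounded (G0c iy').
  apply: (@supnorm_ub _ _ (fun t => G0 (interp J s y) t - G0 (interp J s y') t) (c1 + c2)) => // r r01.
  by apply: le_trans (ler_normB _ _) _; rewrite lerD ?H1 ?H2.
apply: le_trans GS _; apply: le_trans SU _; rewrite ler_wpM2l//.
  by rewrite mulr_ge0// powR_ge0.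
by rewrite ge0_ler_powR ?nnegrE ?supnorm_ge0// ltW.
Qed.

Let E := expR u - expR (- u).

Let E0 : 0 < E. Proof. by rewrite subr_gt0 ltr_expR gtrN. Qed.

(** Exponential change of variable taking [[- u, u]] onto [[0, 1]]: a polynomial in these
    coordinates is an exponential sum in the original ones. [node_val] inverts it at [k / N]. *)
Let ex_var (y : nat -> R) (i : 'I_J) : R := (expR (y i.+1) - expR (- u)) / E.

Lemma ex_var01 y i : box J u y -> 0 <= ex_var y i <= 1.
Proof.
move=> yb; have : `|y i.+1| <= u by apply: yb; rewrite /= ltn_ord.
rewrite ler_norml => /andP[lo hi].
by rewrite divr_ge0 ?(ltW E0) ?subr_ge0 ?ler_expR//= ler_pdivrMr// mul1r lerD2r ler_expR.
Qed.

Let node_val N (k : nat) : R := ln (expR (- u) + k%:R / N%:R * E).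

Lemma node_valK N k : (k <= N)%N -> (0 < N)%N ->
  expR (node_val N k) = expR (- u) + k%:R / N%:R * E.
Proof.
move=> kN N0; rewrite /node_val lnK// posrE ltr_wpDr ?expR_gt0//.
by rewrite mulr_ge0 ?divr_ge0// ltW.
Qed.

Lemma node_val_le N k : (k <= N)%N -> (0 < N)%N -> `|node_val N k| <= u.
Proof.
move=> kN N0; have N0' : 0 < N%:R :> R by rewrite ltr0n.
rewrite ler_norml -(ler_expR (- u)) -(ler_expR _ u) node_valK//.
rewrite lerDl mulr_ge0 ?divr_ge0 ?(ltW E0)//=.
by rewrite addrC -lerBrDr ler_piMl ?(ltW E0)// ler_pdivrMr// mul1r ler_nat.
Qed.

(** To the right of [- u] the derivative of [expR] is at least [expR (- u)], so its inverse is
    Lipschitz there with constant [expR u]. *)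
Lemma expR_dist (a b : R) : - u <= a -> - u <= b -> `|a - b| <= expR u * `|expR a - expR b|.
Proof.
wlog ba : a b / b <= a.
  move=> H ua ub; have [/H->//|/ltW ab] := leP b a.
  by rewrite distrC [X in _ * X]distrC; apply: H.
move=> ua ub; rewrite !ger0_norm ?subr_ge0 ?ler_expR//.
have -> : expR a - expR b = expR b * (expR (a - b) - 1).
  by rewrite mulrBr -expRD mulr1 (_ : b + (a - b) = a)//; ring.
rewrite mulrA -expRD; apply: (@le_trans _ _ (expR (a - b) - 1)).
  by rewrite lerBrDl expR_ge1Dx.
rewrite ler_peMl// ?subr_ge0 -?expR0 ler_expR; first by rewrite subr_ge0.
by rewrite -lerBlDl sub0r.
Qed.

(** Nodes are numbered from 1, hence [j.-1]; outside the index range the value defaults to 0. *)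
Let node N (k : {ffun 'I_J -> 'I_N.+1}) (j : nat) : R :=
  oapp (fun i : 'I_J => node_val N (k i)) 0 (insub j.-1).

Lemma nodeS N (k : {ffun 'I_J -> 'I_N.+1}) (i : 'I_J) : node k i.+1 = node_val N (k i).
Proof. by rewrite /node/= valK. Qed.

Lemma box_ord (p : nat -> Prop) : (forall i : 'I_J, p i.+1) ->
  forall j, (0 < j <= J)%N -> p j.
Proof. by move=> H [//|j] /= jJ; exact: (H (Ordinal jJ)). Qed.

Lemma node_box N (k : {ffun 'I_J -> 'I_N.+1}) : (0 < N)%N -> box J u (node k).
Proof.
by move=> N0; apply: box_ord => i; rewrite nodeS node_val_le// -ltnS.
Qed.

Lemma node_dist N (k : {ffun 'I_J -> 'I_N.+1}) y (i : 'I_J) : (0 < N)%N -> box J u y ->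
  `|y i.+1 - node k i.+1| <= expR u * E * `|(k i)%:R / N%:R - ex_var y i|.
Proof.
move=> N0 yb; have kN : (k i <= N)%N by rewrite -ltnS.
have yi : `|y i.+1| <= u by apply: yb; rewrite /= ltn_ord.
have ni := node_val_le kN N0.
rewrite nodeS; apply: le_trans (expR_dist _ _) _.
- by move: yi; rewrite ler_norml => /andP[].
- by move: ni; rewrite ler_norml => /andP[].
rewrite -mulrA ler_wpM2l ?expR_ge0// node_valK// -{2}(ger0_norm (ltW E0)) -normrM.
rewrite distrC; have -> : E * ((k i)%:R / N%:R - ex_var y i) =
    expR (- u) + (k i)%:R / N%:R * E - expR (y i.+1); last by [].
  by rewrite mulrBr /ex_var [E * (_ / E)]mulrC divfK ?gt_eqF//; ring.
Qed.

Lemma is_exp_sum_mbern N (k : {ffun 'I_J -> 'I_N.+1}) : is_exp_sum J (fun y => mbern (ex_var y) k : R).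
Proof.
apply: exp_sum_prod => i; rewrite /bern.
have ve : is_exp_sum J (fun y => ex_var y i).
  have := exp_sumM (exp_sumD (exp_sum_var i) (exp_sum_cst J (- expR (- u)))) (exp_sum_cst J E^-1).
  exact.
apply: exp_sumM; first apply: exp_sumM; first exact: exp_sum_cst.
  exact: exp_sumX.
apply: exp_sumX.
have := exp_sumD (exp_sum_cst J 1) (exp_sumM (exp_sum_cst J (-1)) ve).
set f := (fun _ => _); set f' := (fun _ => _).
by have -> : f = f' by apply/funext => y; rewrite /f /f' mulN1r.
Qed.

(** Bernstein approximation in the exponential coordinates. The coefficients are the values of the
    operator at the nodes, continuous functions of [t]; each term is thus an exponential sum times
    an element of C[0,1], and [net_approxM] applies. *)
Lemma operator_approx : net_approx sigma J u (fun y t => G0 (interp J s y) t).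
Proof.
move=> e e0; pose A := C0 * u `^ nu.
have A0 : 0 <= A by rewrite mulr_ge0// powR_ge0.
(* A displacement [om] of the node values changes the operator by at most [e / 4]; [eta] is the
   matching displacement in the exponential coordinates, and [N] brings the contribution of the
   farther nodes, where the oscillation is at most [M], below [e / 4]. *)
pose om := (e / 4 / (A + 1)) `^ alpha^-1.
have A1 : 0 < A + 1 by rewrite ltr_wpDl.
have om0 : 0 < om by rewrite powR_gt0// !divr_gt0.
have omal : om `^ alpha = e / 4 / (A + 1).
  by rewrite -powRrM mulVf ?gt_eqF// powRr1// ltW// !divr_gt0.
have uE0 : 0 < expR u * E by rewrite mulr_gt0 ?expR_gt0.
pose eta := om / (expR u * E); have eta0 : 0 < eta by rewrite divr_gt0.
pose M := A * (2 * u) `^ alpha; have M0 : 0 <= M by rewrite mulr_ge0// powR_ge0.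
pose N := (Num.truncn (M * J%:R / eta ^+ 2 / (e / 4))).+1.
have N0 : 0 < N%:R :> R by rewrite ltr0n.
have MN : M * (J%:R / N%:R) / eta ^+ 2 <= e / 4.
  rewrite mulrA mulrAC ler_pdivrMr// -ler_pdivrMl ?divr_gt0// mulrC.
  by apply/ltW; rewrite /N truncnS_gt.
have bern_err y t : box J u y -> t \in `[0, 1] ->
  `|G0 (interp J s y) t - \sum_(k : {ffun 'I_J -> 'I_N.+1})
     mbern (ex_var y) k * G0 (interp J s (node k)) t| <= e / 2.
  move=> yb t01; have z01 i := ex_var01 i yb.
  have -> : e / 2 = e / 4 + e / 4 by field.
  apply: le_trans (@weighted_approx _ _ _ (fun k : {ffun 'I_J -> 'I_N.+1} =>
      \sum_i ((k i)%:R / N%:R - ex_var y i) ^+ 2) _ _ (e / 4) M (J%:R / N%:R) (eta ^+ 2) _ _ _ _ _ _ _ _ _) _ => //.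
  - by move=> k; exact: mbern_ge0.
  - exact: mbern_sum1.
  - by have := @mbern_var _ _ N _ z01; rewrite card_ord; exact.
  - by rewrite exprn_gt0.
  - by rewrite divr_ge0// ltW.
  - by move=> k; apply: sumr_ge0 => i _; exact: sqr_ge0.
  - move=> k dk; have nb := node_box k (ltn0Sn _).
    apply: le_trans (operator_holder_box yb nb (ltW om0) _ t01) _.
      apply: box_ord => i; apply: le_trans (node_dist k i (ltn0Sn _) yb) _.
      rewrite -ler_pdivlMl// [_^-1 * om]mulrC -/eta -ler_sqr ?nnegrE ?(ltW eta0)// real_normK ?num_real//.
      apply: le_trans dk; rewrite (bigD1 i)//= lerDl; apply: sumr_ge0 => j _; exact: sqr_ge0.
    rewrite omal -/A mulrA ler_pdivrMr// mulrC ler_wpM2l ?lerDl//.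
    by rewrite divr_ge0// ltW.
  - move=> k; have nb := node_box k (ltn0Sn _).
    apply: operator_holder_box => //; first by rewrite mulr_ge0// ltW.
    move=> j jJ; apply: le_trans (ler_normB _ _) _; rewrite mulr_natl mulr2n.
    by rewrite lerD// ?yb ?nb.
  - by rewrite lerD2l.
have H : net_approx sigma J u (fun y t => \sum_(k : {ffun 'I_J -> 'I_N.+1})
     mbern (ex_var y) k * G0 (interp J s (node k)) t).
  apply: net_approx_sum => k; apply: net_approxM => //.
  - by apply: exp_sum_ridge => //; exact: is_exp_sum_mbern.
  - by apply: G0c; exact: C01_interp.
  - move=> y yb; have z01 i := ex_var01 i yb.
    by rewrite ger0_norm ?mbern_ge0// mbern_le1.
have e2 : 0 < e / 2 by rewrite divr_gt0.
have [l Hl] := H _ e2; exists l => y t yb t01.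
rewrite -(subrKA (\sum_(k : {ffun 'I_J -> 'I_N.+1}) mbern (ex_var y) k * G0 (interp J s (node k)) t)).
by apply: le_trans (ler_normD _ _) _; rewrite [e]splitr lerD ?bern_err ?Hl.
Qed.

End OperatorApprox.

(** * Approximating networks inside the sieve *)

Section NetworkOfList.
Context {R : realType}.
Variables (sigma : R -> R) (J0 : nat) (s0 : nat -> R).

Definition unit0 : unit_params (R := R) J0 := (0, fun=> 0, 0, 0, 0).

(** A sum, so that one number also bounds the input weights that [network_of_list] adds up at a
    common grid point. *)
Definition unit_size (a : unit_params (R := R) J0) : R :=
  `|a.1.1.1.1| + (\sum_j `|a.1.1.1.2 j|) + `|a.1.1.2| + `|a.1.2| + `|a.2|.

Definition list_size (l : seq (unit_params (R := R) J0)) : R := \sum_(a <- l) unit_size a.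

Lemma unit_size_ge0 a : 0 <= unit_size a.
Proof. by rewrite /unit_size !addr_ge0// sumr_ge0. Qed.

Lemma unit_size_nth l k : unit_size (nth unit0 l k) <= list_size l.
Proof.
rewrite /list_size; elim: l k => [|a l IH] k.
  by rewrite nth_nil big_nil /unit_size/= !normr0 big1 ?addr0.
rewrite big_cons; case: k => [|k] /=.
  by rewrite lerDl sumr_ge0// => i _; exact: unit_size_ge0.
by apply: le_trans (IH k) _; rewrite lerDr unit_size_ge0.
Qed.

Lemma unit_size_bounds a :
  [/\ `|a.1.1.1.1| <= unit_size a, \sum_j `|a.1.1.1.2 j| <= unit_size a,
      `|a.1.1.2| <= unit_size a, `|a.1.2| <= unit_size a & `|a.2| <= unit_size a].
Proof.
have S0 : 0 <= \sum_j `|a.1.1.1.2 j| by apply: sumr_ge0.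
have h1 := normr_ge0 a.1.1.1.1; have h2 := normr_ge0 a.1.1.2.
have h3 := normr_ge0 a.1.2; have h4 := normr_ge0 a.2.
by rewrite /unit_size; split; lra.
Qed.

(** Unit [k] of the list becomes inner unit 0 of block [k]; all other output weights are 0, and
    blocks beyond the list are filled with [unit0]. Weights on the coarse grid move to the same
    points of the fine grid, so at most [J0] inputs are active whatever the size of the fine
    grid. *)
Lemma network_of_list (l : seq (unit_params J0)) (u : R) (J p q : nat) (s : nat -> R) (b r : R) :
  (forall j0 : 'I_J0, exists j : 'I_J, s j.+1 = s0 j0.+1) ->
  (size l <= p)%N -> (0 < q)%N -> list_size l <= b -> J0%:R <= r ->
  exists (c theta : 'I_p -> 'I_q -> R) (xi : 'I_p -> 'I_q -> 'I_J -> R) (w zeta : 'I_p -> R),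
  [/\ forall x t, network sigma u s c theta xi w zeta x t =
        truncation (grid_set J s) u x * net_sum sigma l (x \o s0) t,
      forall k i, `|c k i| <= b /\ `|theta k i| <= b,
      forall k i j, `|xi k i j| <= b,
      forall k, `|w k| <= b /\ `|zeta k| <= b &
      forall k i, #|[set j | xi k i j != 0]|%:R <= r].
Proof.
move=> sub lp q0 lb J0r; have [iota iotaE] := choice sub.
have lb' k : unit_size (nth unit0 l k) <= b by apply: le_trans (unit_size_nth l k) lb.
pose a k := nth unit0 l k.
exists (fun k i => if i == 0%N :> nat then (a k).1.1.1.1 else 0), (fun k _ => (a k).1.1.2),
  (fun k _ j => \sum_(j0 | iota j0 == j) (a k).1.1.1.2 j0), (fun k => (a k).1.2), (fun k => (a k).2).
split.
- move=> x t; rewrite /network; congr (_ * _).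
  pose F k := (a k).1.1.1.1 * sigma (dot (a k).1.1.1.2 (x \o s0) + (a k).1.1.2)
     * sigma ((a k).1.2 * t + (a k).2).
  transitivity (\sum_(k < p) F k).
    case: q q0 => // q _; apply: eq_bigr => k _.
    rewrite big_ord_recl [X in _ + X]big1 ?addr0/=; last by move=> i _; rewrite !mul0r.
    rewrite /F; congr (_ * sigma (_ + _) * _).
    under eq_bigr do rewrite mulr_suml.
    rewrite /dot [RHS](partition_big iota xpredT)//=; apply: eq_bigr => j _.
    by apply: eq_bigr => j0 /eqP <-; rewrite iotaE.
  rewrite /net_sum (big_nth unit0) -(big_mkord xpredT F).
  rewrite (big_cat_nat (leq0n _) lp)/= -[RHS]addr0; congr (_ + _).
  rewrite big_nat_cond big1// => k.
  by move=> /andP[/andP[lk _] _]; rewrite /F /a nth_default//= !mul0r.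
- move=> k i; have [h1 h2 h3 h4 h5] := unit_size_bounds (a k).
  split; last exact: le_trans h3 (lb' k).
  case: ifP => _; first exact: le_trans h1 (lb' k).
  by rewrite normr0; apply: le_trans (lb' k); exact: unit_size_ge0.
- move=> k i j; have [h1 h2 h3 h4 h5] := unit_size_bounds (a k).
  apply: le_trans (lb' k); apply: le_trans h2; apply: le_trans (ler_norm_sum _ _ _) _.
  rewrite [leRHS](bigID (fun j0 => iota j0 == j))/= lerDl; exact: sumr_ge0.
- move=> k; have [h1 h2 h3 h4 h5] := unit_size_bounds (a k).
  by split; [exact: le_trans h4 (lb' k)|exact: le_trans h5 (lb' k)].
- move=> k i; apply: le_trans J0r; rewrite ler_nat.
  rewrite -[leqRHS]card_ord; apply: leq_trans (leq_imset_card iota 'I_J0).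
  apply: subset_leq_card; apply/fintype.subsetP => j.
  rewrite inE/= => xi0; apply/imsetP.
  have [[j0 /eqP <-]|H] := pselect (exists j0, iota j0 == j); first by exists j0.
  case/negP : xi0; rewrite big1// => j0 ij; case: H; by exists j0.
Qed.

End NetworkOfList.

Section SieveApprox.
Context {R : realType}.
Variables (sigma : R -> R) (u B : R).
Variables (G0 : (R -> R) -> R -> R) (alpha nu C0 : R).
Hypotheses (sigma_TW : tauber_wiener sigma) (u1 : 1 <= u) (C0B : C0 <= B).
Hypotheses (G0c : forall x, C01 x -> C01 (G0 x)) (al0 : 0 < alpha) (nu0 : 0 < nu).
Hypothesis hol : forall u, 1 <= u -> forall x1 x2 : R -> R,
    C01 x1 -> C01 x2 -> supnorm `[0, 1] x1 <= u -> supnorm `[0, 1] x2 <= u ->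
    supnorm `[0, 1] (fun t => G0 x1 t - G0 x2 t) <=
      C0 * u `^ nu * supnorm `[0, 1] (fun t => x1 t - x2 t) `^ alpha.
Hypothesis growth : forall x, C01 x ->
    supnorm `[0, 1] (G0 x) <= C0 * Num.max 1 (supnorm `[0, 1] x `^ nu).

Lemma growth_ge0 : 0 <= C0.
Proof.
have c0 : C01 (cst 0 : R -> R) by apply: continuous_subspaceT => t; exact: cvg_cst.
have := le_trans (supnorm_ge0 _ _) (growth c0).
by rewrite pmulr_lge0// lt_max ltr01.
Qed.

Let u0 : 0 < u. Proof. exact: lt_le_trans u1. Qed.

Lemma operator_bound x t : C01 x -> supnorm `[0, 1] x <= u -> t \in `[0, 1] ->
  `|G0 x t| <= C0 * u `^ nu.
Proof.
move=> xc xu t01; apply: le_trans (C01_supnorm (G0c xc) t01) _.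
apply: le_trans (growth xc) _; rewrite ler_wpM2l ?growth_ge0//.
rewrite ge_max ge0_ler_powR ?nnegrE ?supnorm_ge0 ?(ltW nu0) ?(ltW u0)// andbT.
by rewrite -(@powRr0 _ u) ler_powR// ltW.
Qed.

Lemma truncation1_box J (s : nat -> R) x : truncation (grid_set J s) u x = 1 ->
  box J u (x \o s).
Proof.
rewrite truncationE ?(ltW u0)// => /eqP.
rewrite pnatr_eq1 eqb1 => /forallP xu [//|j] /= jJ; exact: (xu (Ordinal jJ)).
Qed.

Lemma truncation01 S x : truncation S u x = 0 \/ truncation S u x = 1.
Proof. by have [[] ->] := truncation_bool S u x; [right|left]. Qed.

(** [p0] and [b0] depend on the coarse grid and not on the fine one: the same finite network serves
    every larger class whose grid contains the coarse one. *)
Lemma sieve_operator_approx J0 (s0 : nat -> R) (delta : R) : is_grid J0 s0 -> (0 < J0)%N ->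
  0 < delta -> exists (p0 : nat) (b0 : R), forall J p q (s : nat -> R) (b r : R),
  is_grid J s ->
  grid_set J0 s0 `<=` grid_set J s -> (p0 <= p)%N -> (0 < q)%N -> b0 <= b -> J0%:R <= r ->
  exists2 G, sieve sigma B nu u b r J p q s G &
    forall x t, truncation (grid_set J s) u x = 1 -> t \in `[0, 1] ->
    `|G x t - G0 (interp J0 s0 (x \o s0)) t| <= delta.
Proof.
move=> g J00 delta0; have C00 := growth_ge0.
pose K0 := C0 * u `^ nu; have K00 : 0 <= K0 by rewrite mulr_ge0// powR_ge0.
pose d := delta / 2; have d0 : 0 < d by rewrite divr_gt0.
have Kd : 0 < K0 + d by rewrite ltr_wpDl.
have [l Hl] := operator_approx sigma_TW u1 g J00 G0c al0 C00 hol d0.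
(* An approximation within [d] may exceed the bound [K0] by [d]. Shrinking the output weights by [a]
   restores the norm constraint of the sieve and costs at most another [d]. *)
pose a := K0 / (K0 + d).
have a01 : 0 <= a <= 1.
  by rewrite divr_ge0 ?(ltW Kd)//= ler_pdivrMr// mul1r lerDl ltW.
pose scale (v : unit_params (R := R) J0) : unit_params (R := R) J0 :=
  (a * v.1.1.1.1, v.1.1.1.2, v.1.1.2, v.1.2, v.2).
pose l' := map scale l.
have l'E y t : net_sum sigma l' y t = a * net_sum sigma l y t.
  by rewrite /net_sum big_map mulr_sumr; apply: eq_bigr => v _ /=; rewrite !mulrA.
have G0K y t : box J0 u y -> t \in `[0, 1] -> `|G0 (interp J0 s0 y) t| <= K0.
  move=> yb t01; apply: operator_bound => //; first exact: C01_interp.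
  by apply: supnorm_le => [|r r01]; [exact: ltW|exact: interp_norm_le].
have netK y t : box J0 u y -> t \in `[0, 1] -> `|net_sum sigma l' y t| <= K0.
  move=> yb t01; rewrite l'E normrM; case/andP: a01 => a0 _; rewrite (ger0_norm a0).
  apply: (@le_trans _ _ (a * (K0 + d))); last by rewrite divfK// gt_eqF.
  rewrite ler_wpM2l//; have h1 := Hl y t yb t01; have h2 := G0K y t yb t01.
  have := ler_normB (G0 (interp J0 s0 y) t) (G0 (interp J0 s0 y) t - net_sum sigma l y t).
  by rewrite subKr => /le_trans; apply; rewrite lerD.
have net_err y t : box J0 u y -> t \in `[0, 1] ->
    `|net_sum sigma l' y t - G0 (interp J0 s0 y) t| <= delta.
  move=> yb t01; rewrite l'E; have h1 := Hl y t yb t01; have h2 := G0K y t yb t01.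
  have -> : a * net_sum sigma l y t - G0 (interp J0 s0 y) t =
    - (a * (G0 (interp J0 s0 y) t - net_sum sigma l y t)) - (1 - a) * G0 (interp J0 s0 y) t.
    by ring.
  apply: le_trans (ler_normB _ _) _; rewrite normrN (normrM a) (normrM (1 - a)).
  case/andP: a01 => a0 a1; rewrite (ger0_norm a0) (@ger0_norm _ (1 - a)) ?subr_ge0//.
  rewrite [delta]splitr -/d; apply: lerD; first by apply: le_trans h1; rewrite -[leRHS]mul1r ler_wpM2r.
  apply: (@le_trans _ _ ((1 - a) * K0)); first by rewrite ler_wpM2l// subr_ge0.
  have -> : (1 - a) * K0 = a * d by rewrite /a; field; rewrite gt_eqF.
  by rewrite ler_piMl// ltW.
exists (size l'), (list_size l') => J p q s b r gs sub lp q0 lb J0r.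
have sub' (j0 : 'I_J0) : exists j : 'I_J, s j.+1 = s0 j0.+1.
  have [j /= /andP[j1 jJ] sj] : grid_set J s (s0 j0.+1).
    by apply: sub; exists j0.+1 => //=; exact: ltn_ord.
  have j'J : (j.-1 < J)%N by rewrite prednK.
  by exists (Ordinal j'J); rewrite /= prednK.
have [c [th [xi [w [ze [E h1 h2 h3 h4]]]]]] := network_of_list sigma (l := l') u sub' lp q0 lb J0r.
have box0 x : truncation (grid_set J s) u x = 1 -> box J0 u (x \o s0).
  move=> /truncation1_box xu [//|j] /= jJ0; have [j' <-] := sub' (Ordinal jJ0).
  by apply: xu; rewrite /= ltn_ord.
exists (network sigma u s c th xi w ze); last first.
  by move=> x t xu t01; rewrite E xu mul1r; apply: net_err => //; exact: box0.
split; last by exists c, th, xi, w, ze; split.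
apply: ge_ereal_sup => _ [x [t [xc xu t01 ->]]]; rewrite lee_fin E.
apply: (@le_trans _ _ K0); last by rewrite ler_wpM2r ?powR_ge0.
have [->|xt] := truncation01 (grid_set J s) x; first by rewrite mul0r normr0.
by rewrite xt mul1r; apply: netK => //; exact: box0.
Qed.

End SieveApprox.

(** * Independence and laws of paths *)

Section Independence.
Context d (T : measurableType d) (R : realType) (P : probability T R).
Implicit Types F G : set (set T).

Lemma g_sigma_sub G : G `<=` measurable -> <<s G >> `<=` (measurable : set (set T)).
Proof.
by move=> GT; apply: smallest_sub => //; exact: sigma_algebra_measurable.
Qed.

Lemma measurable_fun_sub d' (U : measurableType d') G (f : T -> U) :
  G `<=` measurable ->
  measurable_fun setT (f : g_sigma_algebraType G -> U) -> measurable_fun setT f.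
Proof.
by move=> GT mf _ A mA; apply: (g_sigma_sub GT); exact: (mf measurableT A mA).
Qed.

Lemma measurable_id_sub G : G `<=` measurable ->
  measurable_fun setT (idfun : T -> g_sigma_algebraType G).
Proof. by move=> GT; apply: (measurable_fun_sub GT) => _ A mA; rewrite setTI. Qed.

Section fubini.
Variables (F G : set (set T)).
Hypotheses (FT : F `<=` measurable) (GT : G `<=` measurable).
Hypothesis FG : indep P <<s F >> <<s G >>.

Local Notation TF := (g_sigma_algebraType F).
Local Notation TG := (g_sigma_algebraType G).

Let idF : T -> TF := idfun.
Let idG : T -> TG := idfun.
HB.instance Definition _ := isMeasurableFun.Build _ _ T TF idF (measurable_id_sub FT).
HB.instance Definition _ := isMeasurableFun.Build _ _ T TG idG (measurable_id_sub GT).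
Let diag (w : T) : TF * TG := (w, w).

Let mdiag : measurable_fun setT diag.
Proof. by apply: measurable_fun_pair; [exact: measurable_id_sub|exact: measurable_id_sub]. Qed.

HB.instance Definition _ := isMeasurableFun.Build _ _ T (TF * TG)%type diag mdiag.

(** By independence the diagonal map pushes [P] to the product of its restrictions to the two
    sigma-algebras, since the two measures agree on rectangles. A function of two independent blocks
    can thus be integrated with one block frozen. *)
Lemma indep_fubini (h : TF * TG -> \bar R) : measurable_fun setT h ->
  (forall z, (0 <= h z)%E) ->
  (\int[P]_w h (w, w) = \int[P]_w \int[P]_w' h (w, w'))%E.
Proof.
move=> mh h0.
pose PF : probability TF R := distribution P idF.
pose PG : probability TG R := distribution P idG.
pose PD : probability (TF * TG)%type R := distribution P diag.
transitivity (\int[PD]_z h z)%E.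
  by rewrite /PD/= ge0_integral_pushforward//; exact: mdiag.
transitivity (\int[PF \x PG]_z h z)%E.
  apply: eq_measure_integral => A mA _; apply/esym.
  by apply: product_measure_unique => // C D mC mD; exact: FG.
rewrite fubini_tonelli1// /fubini_F.
rewrite /PF/= ge0_integral_pushforward//=; last 2 first.
- exact: measurable_fun_fubini_tonelli_F.
- by move=> x _; apply: integral_ge0.
apply: eq_integral => w _ /=.
rewrite /PG ge0_integral_pushforward//.
by apply: (measurableT_comp mh); exact: measurable_pair1.
Qed.
End fubini.

Lemma indep_expectationM F G (f g : T -> R) : F `<=` measurable -> G `<=` measurable ->
  indep P <<s F >> <<s G >> ->
  measurable_fun setT (f : g_sigma_algebraType F -> R) ->
  measurable_fun setT (g : g_sigma_algebraType G -> R) ->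
  (forall w, 0 <= f w) -> (forall w, 0 <= g w) ->
  (\int[P]_w (f w * g w)%:E = (\int[P]_w (f w)%:E) * \int[P]_w (g w)%:E)%E.
Proof.
move=> FT GT FG mf mg f0 g0.
pose h (z : g_sigma_algebraType F * g_sigma_algebraType G) := (f z.1 * g z.2)%:E.
have mh : measurable_fun setT h.
  apply/measurable_EFinP; apply: measurable_funM.
    by apply: (measurableT_comp mf); exact: measurable_fst.
  by apply: (measurableT_comp mg); exact: measurable_snd.
have h0 z : (0 <= h z)%E by rewrite lee_fin mulr_ge0.
rewrite (indep_fubini FT GT FG mh h0) /h/=.
have mg' := measurable_fun_sub GT mg; have mf' := measurable_fun_sub FT mf.
under eq_integral => w _.
  under eq_integral do rewrite EFinM.
  rewrite ge0_integralZl_EFin//; last 2 first.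
  - by move=> x _; rewrite lee_fin.
  - exact/measurable_EFinP.
  over.
rewrite ge0_integralZr//.
- exact/measurable_EFinP.
- by move=> w _; rewrite lee_fin.
- by apply: integral_ge0 => w _; rewrite lee_fin.
Qed.

Section mutual.
Variables (K : eqType) (F : K -> set (set T)).
Hypothesis Fmeas : forall k, F k `<=` measurable.
Hypothesis Fsig : forall k, sigma_algebra setT (F k).
Hypothesis Find : mutual_indep P F.

Let FT k : F k setT.
Proof. by have [F0 FC _] := Fsig k; rewrite -(setD0 setT); exact: FC. Qed.

Let FI k A B : F k A -> F k B -> F k (A `&` B).
Proof.
move=> FA FB; have [F0 FC FU] := Fsig k.
rewrite -(setCK (A `&` B)) setCI -bigcup2E -!setTD; apply: (FC).
by apply: FU => -[|[|n]] //=; exact: FC.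
Qed.

(** For a fixed event of the extra sigma-algebra, the restriction of [P] to it and the multiple of
    [P] by its probability are finite measures. They agree on the finite intersections [C], a
    pi-system generating the joint sigma-algebra of the others. *)
Lemma mutual_indep_cons k0 (D : seq K) : uniq (k0 :: D) ->
  indep P <<s \bigcup_(k in [set` D]) F k >> <<s F k0 >>.
Proof.
move=> /= /andP[k0D uD] A B; rewrite (sigma_algebra_id (Fsig k0)) => FA FB.
pose C := [set A | exists2 E : K -> set T, (forall k, k \in D -> F k (E k)) &
  A = \bigcap_(k in [set` D]) E k].
have CT : C setT.
  by exists (fun=> setT) => //; apply/esym; exact: bigcapT.
have CI : setI_closed C.
  move=> _ _ [E FE ->] [E' FE' ->]; exists (fun k => E k `&` E' k).
    by move=> k kD; apply: FI; [exact: FE|exact: FE'].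
  by rewrite bigcapI.
have Cm : C `<=` measurable.
  move=> _ [E FE ->]; apply: fin_bigcap_measurable => [|k kD]; first exact: finite_seq.
  by apply: (@Fmeas k); exact: FE.
have mB : measurable B := Fmeas FB.
have FC : <<s \bigcup_(k in [set` D]) F k >> `<=` <<s C >>.
  apply: smallest_sub; first exact: smallest_sigma_algebra.
  move=> E [k /= kD FE]; apply: sub_sigma_algebra.
  exists (fun k' => if k' == k then E else setT).
    by move=> k' _; case: eqP => [->|].
  apply/seteqP; split=> [w Ew k' _|w /(_ k kD)]; last by rewrite eqxx.
  by case: eqP.
pose b := fine (P B); have b0 : 0 <= b by rewrite fine_ge0.
have Pb : P B = b%:E by rewrite /b fineK// fin_num_measure.
rewrite -[P (A `&` B)]/(mrestr P mB A).
rewrite (@g_sigma_algebra_measure_unique _ _ _ C Cm (fun=> setT) (fun=> CT) _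
  (mrestr P mB) (mscale (NngNum b0) P) CI)//; first by rewrite /mscale/= Pb muleC.
- by rewrite bigcup_const.
- move=> _ [E FE ->]; transitivity (P (\bigcap_(k in [set` D]) E k) * P B)%E; last first.
    by rewrite Pb muleC.
  rewrite /mrestr.
  pose E' k := if k == k0 then B else E k.
  have E'E k : k \in D -> E' k = E k.
    by rewrite /E'; case: eqP => // -> k0D'; rewrite k0D' in k0D.
  have := Find (D := k0 :: D) (A := E').
  rewrite /= k0D uD => /(_ isT) /(_ _)/wrap[].
    move=> k; rewrite inE /E'; case: eqP => [->//|_ /= kD]; exact: FE.
  rewrite big_cons {2}/E' eqxx.
  have := Find uD FE; rewrite -(eq_big_seq _ (fun k kD => congr1 P (E'E k kD))) => <- H.
  rewrite muleC -H; congr (P _); apply/seteqP; split => [w [Ew Bw] k|w Ew].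
    by rewrite /= inE /E'; case: eqP => // _ /= kD; exact: Ew.
  split; last by have := Ew k0; rewrite /= inE eqxx /E' eqxx; apply.
  by move=> k kD; rewrite -E'E//; apply: Ew; rewrite /= inE kD orbT.
- by move=> _; apply: (@le_lt_trans _ _ 1%:E); [exact: probability_le1 (measurableI _ _ measurableT mB)|exact: ltry].
- exact: FC.
Qed.

Lemma mutual_indep_prod (D : seq K) (f : K -> T -> R) : uniq D ->
  (forall k B, k \in D -> measurable B -> F k (f k @^-1` B)) ->
  (forall k w, 0 <= f k w) ->
  (\int[P]_w (\prod_(k <- D) f k w)%:E = \prod_(k <- D) \int[P]_w (f k w)%:E)%E.
Proof.
move=> + + f0; elim: D => [|k0 D IH] uD fF.
  under eq_integral do rewrite big_nil.
  rewrite big_nil; transitivity (1%:E * P setT)%E; first exact: integral_cst.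
  by rewrite probability_setT mule1.
under eq_integral do rewrite big_cons mulrC.
rewrite big_cons -IH; last 2 first.
- by case/andP: uD.
- by move=> k B kD; apply: fF; rewrite inE kD orbT.
rewrite muleC; apply: (indep_expectationM _ _ (mutual_indep_cons uD)).
- by move=> A [k _]; exact: Fmeas.
- exact: Fmeas.
- apply: measurable_prod => k kD _ B mB; rewrite setTI; apply: sub_sigma_algebra.
  by exists k => //; apply: fF => //; rewrite inE kD orbT.
- by move=> _ B mB; rewrite setTI; apply: sub_sigma_algebra; apply: fF => //; rewrite inE eqxx.
- by move=> w; apply: prodr_ge0.
- by [].
Qed.
End mutual.
End Independence.

(** * Path space and finite-dimensional laws *)

Section PathPairs.
Context {R : realType}.

Definition path_space : Type := ((R -> R) * (R -> R))%type.

HB.instance Definition _ := Pointed.on path_space.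

(** The sets on which [same_law] compares two pairs of processes. They are stable under
    intersection, so agreement on them determines the law of the pair. *)
Definition cylinders : set (set path_space) :=
  [set C | exists (m : nat) (t : 'I_m -> R) (A B : 'I_m -> set R),
    [/\ forall k, t k \in `[0, 1],
        forall k, measurable (A k) /\ measurable (B k) &
        C = \bigcap_(k in setT) [set z | A k (z.1 (t k)) /\ B k (z.2 (t k))]]].

Definition paths := g_sigma_algebraType cylinders.

Lemma measurable_coord1 t : t \in `[0, 1] ->
  measurable_fun setT (fun z : paths => z.1 t).
Proof.
move=> t01 _ A mA; rewrite setTI; apply: sub_sigma_algebra.
exists 1%N, (fun=> t), (fun=> A), (fun=> setT); split=> //.
by apply/seteqP; split => [z Az k _|z /(_ ord0 I)[]].
Qed.

Lemma measurable_coord2 t : t \in `[0, 1] ->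
  measurable_fun setT (fun z : paths => z.2 t).
Proof.
move=> t01 _ A mA; rewrite setTI; apply: sub_sigma_algebra.
exists 1%N, (fun=> t), (fun=> setT), (fun=> A); split=> //.
by apply/seteqP; split => [z Az k _|z /(_ ord0 I)[]].
Qed.

Lemma cylindersI : setI_closed cylinders.
Proof.
move=> _ _ [m [t [A [B [t01 mAB ->]]]]] [m' [t' [A' [B' [t01' mAB' ->]]]]].
pose sp T (f : 'I_m -> T) (f' : 'I_m' -> T) (k : 'I_(m + m')) :=
  match fintype.split k with inl i => f i | inr i => f' i end.
exists (m + m')%N, (sp _ t t'), (sp _ A A'), (sp _ B B'); split.
- by move=> k; rewrite /sp; case: fintype.split.
- by move=> k; rewrite /sp; case: fintype.split.
apply/seteqP; split => [z [zA zA'] k _|z zAA'].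
  by rewrite /= /sp; case: fintype.split => i; [exact: zA|exact: zA'].
split => k _.
  by have /= := zAA' (lshift m' k) I; rewrite /sp (unsplitK (inl k)).
by have /= := zAA' (rshift m k) I; rewrite /sp (unsplitK (inr k)).
Qed.

Lemma cylindersT : cylinders setT.
Proof.
exists 0%N, (fun=> 0), (fun=> setT), (fun=> setT); split; [by case|by case|].
by apply/esym/bigcapT => -[].
Qed.

Context d (T : measurableType d) (P : probability T R).
Implicit Types X Y : R -> T -> R.

Definition path_pair X Y (w : T) : paths := (X ^~ w, Y ^~ w).

(** Measurability already holds for the sigma-algebra generated by the two processes, the form in
    which independence is stated. *)
Lemma measurable_path_pair_events X Y :
  measurable_fun setT (path_pair X Y : g_sigma_algebraType (pair_events X Y) -> paths).
Proof.
apply: (@measurability _ _ (g_sigma_algebraType (pair_events X Y)) paths setT _ cylinders erefl) => _ [_ [m [t [A [B [t01 mAB ->]]]]] <-].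
rewrite setTI preimage_bigcap; apply: fin_bigcap_measurable => // k _.
have [mA mB] := mAB k.
have -> : path_pair X Y @^-1` [set z | A k (z.1 (t k)) /\ B k (z.2 (t k))] =
  (X (t k) @^-1` A k) `&` (Y (t k) @^-1` B k) by [].
apply: measurableI; apply: sub_sigma_algebra; [left|right].
  by exists (t k); [exact: t01|exists (A k) => //; rewrite setTI].
by exists (t k); [exact: t01|exists (B k) => //; rewrite setTI].
Qed.

Definition measurable_process X := forall t, t \in `[0, 1] -> measurable_fun setT (X t).

Lemma process_events_measurable X : measurable_process X ->
  process_events X `<=` measurable.
Proof. by move=> mX A [t /= t01 [B mB <-]]; exact: mX. Qed.

Lemma pair_events_measurable X Y : measurable_process X -> measurable_process Y ->
  pair_events X Y `<=` measurable.
Proof.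
by move=> mX mY A [] ; [exact: process_events_measurable|exact: process_events_measurable].
Qed.

Lemma measurable_path_pair X Y : measurable_process X -> measurable_process Y ->
  measurable_fun setT (path_pair X Y).
Proof.
move=> mX mY; apply: (@measurable_fun_sub _ T _ paths (pair_events X Y)).
  exact: pair_events_measurable.
exact: measurable_path_pair_events.
Qed.

Lemma same_law_integral X Y X' Y' (f : paths -> \bar R) :
  measurable_process X -> measurable_process Y ->
  measurable_process X' -> measurable_process Y' ->
  same_law P X Y X' Y' -> measurable_fun setT f -> (forall z, (0 <= f z)%E) ->
  (\int[P]_w f (path_pair X Y w) = \int[P]_w f (path_pair X' Y' w))%E.
Proof.
move=> mX mY mX' mY' XY mf f0.
have mp := measurable_path_pair mX mY; have mp' := measurable_path_pair mX' mY'.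
transitivity (\int[pushforward P (path_pair X Y)]_z f z)%E.
  by rewrite ge0_integral_pushforward.
transitivity (\int[pushforward P (path_pair X' Y')]_z f z)%E; last first.
  by rewrite ge0_integral_pushforward.
pose Q := [the measure _ _ of pushforward P (path_pair X Y)].
pose Q' := [the measure _ _ of pushforward P (path_pair X' Y')].
apply: (@eq_measure_integral _ _ _ _ (Q' mp') (Q mp)) => A mA _.
apply: (@g_sigma_algebra_measure_unique _ R paths cylinders _ (fun=> setT) _ _ (Q mp) (Q' mp') cylindersI) => //.
- by move=> C cC; exact: sub_sigma_algebra.
- by move=> _; exact: cylindersT.
- by rewrite bigcup_const.
- move=> _ [m [t [C [D [t01 mCD ->]]]]]; exact: (XY m t C D).
- by move=> _; rewrite /Q/= /pushforward preimage_setT probability_setT ltry.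
Qed.

Lemma iid_paths_prod_le (Xs Ys : nat -> R -> T -> R) X Y (f : paths -> R) n (c : R) :
  (forall i, measurable_process (Xs i)) -> (forall i, measurable_process (Ys i)) ->
  measurable_process X -> measurable_process Y ->
  (forall i, same_law P (Xs i) (Ys i) X Y) ->
  mutual_indep P (fun i => <<s pair_events (Xs i) (Ys i) >>) ->
  measurable_fun setT f -> (forall z, 0 <= f z) ->
  (\int[P]_w (f (path_pair X Y w))%:E <= c%:E)%E ->
  (\int[P]_w (\prod_(i < n) f (path_pair (Xs i) (Ys i) w))%:E <= (c ^+ n)%:E)%E.
Proof.
move=> mXs mYs mX mY XY ind mf f0 fc.
under eq_integral do rewrite -(big_mkord xpredT (fun i => f (path_pair (Xs i) (Ys i) _))).
rewrite (@mutual_indep_prod _ T R P _ (fun i => <<s pair_events (Xs i) (Ys i) >>))//.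
- have E0 : (0 <= \int[P]_w (f (path_pair X Y w))%:E)%E.
    by apply: integral_ge0 => w _; rewrite lee_fin.
  rewrite (eq_bigr (fun=> (\int[P]_w (f (path_pair X Y w))%:E)%E)); last first.
    move=> i _; apply: (same_law_integral (f := EFin \o f)) => //.
      by apply/measurable_EFinP.
  rewrite big_mkord; elim: n => [|n IH]; first by rewrite big_ord0 expr0.
  by rewrite big_ord_recr/= exprSr EFinM lee_pmul// prode_ge0.
- by move=> i; apply: g_sigma_sub; exact: pair_events_measurable.
- exact: iota_uniq.
- move=> i B _ mB.
  have := measurableT_comp mf (@measurable_path_pair_events (Xs i) (Ys i)).
  by move=> /(_ measurableT B mB); rewrite setTI.
Qed.

End PathPairs.

(** * Gaussian moments *)

Section NormalIntegral.
Context {R : realType}.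
Notation mu := (@lebesgue_measure R).
Implicit Types (s l c : R).

(** The law is given on sets by integrating the density; almost everywhere uniqueness of the
    Radon-Nikodym derivative extends this to integrals of functions. *)
Lemma integral_normal_prob s (f : R -> \bar R) : measurable_fun setT f ->
  (forall x, 0 <= f x)%E ->
  (\int[normal_prob 0 s]_x f x = \int[mu]_x (f x * (normal_pdf 0 s x)%:E))%E.
Proof.
move=> mf f0; pose nu := normal_prob (0 : R) s.
have dom : nu `<< mu := normal_prob_dominates 0 s.
rewrite -(Radon_Nikodym_SigmaFinite.change_of_variables dom f0 measurableT mf).
have mg := measurable_int _ (Radon_Nikodym_SigmaFinite.f_integrable dom).
apply: ae_eq_integral => //.
- by apply: emeasurable_funM.
- apply: emeasurable_funM => //; apply/measurable_EFinP; exact: measurable_normal_pdf.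
- apply: ae_eqe_mul2l; apply: integral_ae_eq => //.
  + exact: Radon_Nikodym_SigmaFinite.f_integrable.
  + by apply/measurable_EFinP; exact: measurable_normal_pdf.
  + by move=> E _ mE; rewrite -Radon_Nikodym_SigmaFinite.f_integral.
Qed.

Lemma normal_prob_mgf s l : s != 0 ->
  (\int[normal_prob 0 s]_x (expR (l * x))%:E = (expR (l ^+ 2 * s ^+ 2 / 2))%:E)%E.
Proof.
move=> s0; rewrite integral_normal_prob; last 2 first.
- apply/measurable_EFinP; apply: measurableT_comp; first exact: measurable_expR.
  exact: measurable_funM.
- by move=> x; rewrite lee_fin expR_ge0.
(* Completing the square: the exponential tilt moves the mean to [l * s ^+ 2]. *)
transitivity (\int[mu]_x ((expR (l ^+ 2 * s ^+ 2 / 2))%:E * (normal_pdf (l * s ^+ 2) s x)%:E))%E.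
  apply: eq_integral => x _; rewrite -!EFinM; congr (_%:E).
  rewrite !normal_pdfE// /normal_fun mulrCA [RHS]mulrCA -!expRD; congr (_ * expR _).
  by field.
rewrite ge0_integralZl_EFin ?expR_ge0//; last 2 first.
- by move=> x _; rewrite lee_fin normal_pdf_ge0.
- by apply/measurable_EFinP; exact: measurable_normal_pdf.
by rewrite integral_normal_pdf mule1.
Qed.

(** The length [s] times the peak of the density is [1 / sqrt (2 pi)], at most 1/2 since
    [pi >= 2]. *)
Lemma normal_prob_itv_le s c : 0 < s ->
  (normal_prob 0 s `[(c - s / 2)%R, (c + s / 2)%R]%classic <= (2^-1)%:E)%E.
Proof.
move=> s0; have sn0 : s != 0 by rewrite gt_eqF.
have cc : c - s / 2 < c + s / 2 by rewrite ltrD2l gtrN// divr_gt0.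
rewrite /normal_prob.
apply: (@le_trans _ _ (\int[mu]_(x in `[(c - s / 2)%R, (c + s / 2)%R]) (normal_peak s)%:E)%E).
  apply: ge0_le_integral => //.
  - by move=> x _; rewrite lee_fin normal_pdf_ge0.
  - by apply/measurable_EFinP; apply: measurable_funTS; exact: measurable_normal_pdf.
  - by move=> x _; rewrite lee_fin normal_pdf_ub.
rewrite integral_cst//= lebesgue_measure_itv/= lte_fin cc -EFinB -EFinM lee_fin.
have -> : c + s / 2 - (c - s / 2) = s by field.
rewrite /normal_peak -ler_pdivlMr// -invfM lef_pV2 ?posrE ?mulr_gt0//; last first.
  by rewrite sqrtr_gt0 mulrn_wgt0// mulr_gt0 ?pi_gt0// exprn_gt0.
rewrite -[leLHS](@ger0_norm _ (2 * s)) ?mulr_ge0 ?(ltW s0)// -sqrtr_sqr ler_wsqrtr//.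
have := pi_ge2 R; rewrite exprMn mulrC -mulrnAr ler_pM2l ?exprn_gt0// -mulr_natr; lra.
Qed.

Context d (T : measurableType d) (P : probability T R).

(** The last clause recovers [s] from a second moment up to a factor, without computing Gaussian
    moments: at least half of the mass lies at distance [s / 2] or more from any [c]. The center is
    free because a variance is taken around an expectation that is left unevaluated. *)
Lemma centered_gaussian_mgf (Z : T -> R) : centered_gaussian P Z ->
  exists s, [/\ 0 <= s,
    forall l, (\int[P]_w (expR (l * Z w))%:E = (expR (l ^+ 2 * s ^+ 2 / 2))%:E)%E &
    forall c, ((s ^+ 2 / 8)%:E <= \int[P]_w ((Z w - c) ^+ 2)%:E)%E].
Proof.
(* The parameter of the law may be negative; the density depends on its square. *)
move=> [mZ [s Zs]]; exists `|s|; split; first by [].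
  move=> l; rewrite real_normK ?num_real//.
  pose Z' : T -> measurableTypeR R := Z.
  have mZ' : measurable_fun setT Z' by exact: mZ.
  have me : measurable_fun setT (fun x : measurableTypeR R => (expR (l * x))%:E).
    apply/measurable_EFinP; apply: measurableT_comp; first exact: measurable_expR.
    exact: measurable_funM.
  transitivity (\int[pushforward P Z']_x (expR (l * x))%:E)%E.
    by rewrite ge0_integral_pushforward// => x _; rewrite lee_fin expR_ge0.
  have [s0|s0] := eqVneq s 0.
    transitivity (\int[\d_(0%R : measurableTypeR R)]_x (expR (l * x))%:E)%E.
      apply: eq_measure_integral => A mA _; rewrite [LHS](Zs A mA).
      by rewrite /centered_gaussian_law s0 eqxx.
    by rewrite integral_dirac// diracT mul1e mulr0 s0 expr0n/= mulr0 mul0r.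
  transitivity (\int[normal_prob 0%R s]_x (expR (l * x))%:E)%E; last exact: normal_prob_mgf.
  apply: eq_measure_integral => A mA _; rewrite [LHS](Zs A mA).
  by rewrite /centered_gaussian_law (negbTE s0).
move=> c; rewrite real_normK ?num_real//.
have mZc : measurable_fun setT (fun w => ((Z w - c) ^+ 2)%:E).
  by apply/measurable_EFinP; apply: measurable_funX; exact: measurable_funB.
have [s0|s0] := eqVneq s 0.
  rewrite s0 expr0n/= mul0r; apply: integral_ge0 => w _; rewrite lee_fin; exact: sqr_ge0.
pose a := `|s|; have a0 : 0 < a by rewrite normr_gt0.
have a2 : s ^+ 2 = a ^+ 2 by rewrite real_normK ?num_real.
pose A : set R := `[c - a / 2, c + a / 2]%classic.
have mA : measurable A by exact: measurable_itv.
have PA : (P (Z @^-1` A) <= (2^-1)%:E)%E.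
  rewrite Zs// /centered_gaussian_law (negbTE s0).
  apply: le_trans (normal_prob_itv_le c a0); rewrite /normal_prob le_eqVlt; apply/orP; left.
  apply/eqP; apply: eq_integral => x _; congr (_%:E).
  by rewrite !normal_pdfE// /normal_peak /normal_fun ?a2// gt_eqF.
have mZA : measurable (Z @^-1` A) by rewrite -[X in measurable X]setTI; exact: mZ.
have PAc : ((2^-1)%:E <= P (~` (Z @^-1` A)))%E.
  rewrite probability_setC// -[X in (X <= _)%E](_ : (1 - 2^-1)%:E = (2^-1)%:E); last first.
    by congr (_%:E); field.
  by rewrite EFinB; apply: leeB.
apply: (@le_trans _ _ (\int[P]_(w in ~` (Z @^-1` A)) (a ^+ 2 / 4)%:E)%E).
  rewrite a2 integral_cst; last exact: measurableC.
  apply: (@le_trans _ _ ((a ^+ 2 / 4)%:E * (2^-1)%:E)%E).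
    by rewrite -EFinM lee_fin le_eqVlt; apply/orP; left; apply/eqP; field.
  by rewrite lee_wpmul2l// lee_fin divr_ge0 ?exprn_ge0 ?(ltW a0).
apply: (@le_trans _ _ (\int[P]_(w in ~` (Z @^-1` A)) ((Z w - c) ^+ 2)%:E)%E); last first.
  apply: ge0_subset_integral => //; first exact: measurableC.
  by move=> w _; rewrite lee_fin sqr_ge0.
apply: ge0_le_integral => //.
- exact: measurableC.
- by move=> w _; rewrite lee_fin divr_ge0// exprn_ge0// ltW.
- exact: measurable_funTS.
- move=> w; rewrite /A /= in_itv/= lee_fin => /negP; rewrite negb_and -!ltNge => H.
  have -> : a ^+ 2 / 4 = (a / 2) ^+ 2 by field.
  rewrite -[leRHS]real_normK ?num_real// lerXn2r ?nnegrE ?divr_ge0 ?(ltW a0)//.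
  case/orP: H => H; [rewrite distrC|]; apply: le_trans (ler_norm _); lra.
Qed.

End NormalIntegral.

Section PathMomentExpectation.
Context {R : realType} d (T : measurableType d) (P : probability T R).

Lemma dyadic_itv k j : (j <= 2 ^ k)%N -> (dyadic k j : R) \in `[0, 1].
Proof.
move=> jk; have k0 := exp2_gt0 (R := R) k; rewrite in_itv/= /dyadic.
by rewrite divr_ge0 ?(ltW k0)//= ler_pdivrMr// mul1r -natrX ler_nat.
Qed.

Lemma measurable_path_moment m (th : R) : 0 < th ->
  measurable_fun setT (fun z : paths => path_moment m th z.1).
Proof.
move=> th0; apply: emeasurable_funD.
  apply/measurable_EFinP; apply: measurable_funX; apply: measurableT_comp => //.
  by apply: measurable_coord1; rewrite in_itv/= lexx ler01.
apply: ge0_emeasurable_sum => [k z _ _|k _].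
  by rewrite lee_fin; apply: sumr_ge0 => j _; rewrite exprn_ge0// divr_ge0// exprn_ge0// ltW.
apply/measurable_EFinP; apply: measurable_sum => j.
apply: measurable_funX; apply: measurable_funM => //; apply: measurableT_comp => //.
apply: measurable_funB; apply: measurable_coord1; apply: dyadic_itv; last exact: ltnW.
exact: ltn_ord.
Qed.

Lemma powX_le_exp (m : nat) (y : R) : (0 < m)%N -> 0 <= y -> y ^+ m <= m%:R ^+ m * expR y.
Proof.
move=> m0 y0; have m0' : 0 < m%:R :> R by rewrite ltr0n.
have -> : y = m%:R * (y / m%:R) by rewrite mulrC divfK// gt_eqF.
have [-> ->] : (m%:R * (y / m%:R)) ^+ m = m%:R ^+ m * (y / m%:R) ^+ m /\
   expR (m%:R * (y / m%:R)) = expR (y / m%:R) ^+ m.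
  by rewrite exprMn -expRM_natl mulr_natl.
rewrite ler_wpM2l ?exprn_ge0// lerXn2r ?nnegrE ?divr_ge0 ?expR_ge0//.
by apply: le_trans (expR_ge1Dx _); rewrite lerDr.
Qed.

(** Apply [powX_le_exp] to [|Z| / t] and bound [exp (|Z| / t)] by [exp (Z / t) + exp (- Z / t)];
    since [s <= t], each summand has mean at most [exp (1/2)]. *)
Lemma mgf_abs_moment (Z : T -> R) (s t : R) m : measurable_fun setT Z -> (0 < m)%N ->
  (forall l, (\int[P]_w (expR (l * Z w))%:E = (expR (l ^+ 2 * s ^+ 2 / 2))%:E)%E) ->
  0 <= s -> s <= t -> 0 < t ->
  (\int[P]_w (`|Z w| ^+ m)%:E <= ((m%:R * t) ^+ m * (2 * expR (2^-1)))%:E)%E.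
Proof.
move=> mZ m0 mgf s0 st t0.
have me l : measurable_fun setT (fun w => (expR (l * Z w))%:E).
  by apply/measurable_EFinP; apply: measurableT_comp; [exact: measurable_expR|exact: measurable_funM].
have mgf1 l : `|l| = t^-1 -> (\int[P]_w (expR (l * Z w))%:E <= (expR (2^-1))%:E)%E.
  move=> lt; rewrite mgf lee_fin ler_expR ler_pdivrMr// mulVf// -[l ^+ 2]real_normK ?num_real//.
  by rewrite lt exprVn mulrC ler_pdivrMr ?exprn_gt0// mul1r lerXn2r ?nnegrE// ltW.
have K0 : 0 <= (m%:R * t) ^+ m by rewrite exprn_ge0// mulr_ge0// ltW.
apply: (@le_trans _ _ (\int[P]_w (((m%:R * t) ^+ m)%:E *
    ((expR (t^-1 * Z w))%:E + (expR (- t^-1 * Z w))%:E)))%E).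
  apply: ge0_le_integral => //.
  - by apply/measurable_EFinP; apply: measurable_funX; exact: measurableT_comp.
  - by apply: emeasurable_funM => //; apply: emeasurable_funD.
  - move=> w _; rewrite -EFinD -EFinM lee_fin.
    have -> : `|Z w| = t * (`|Z w| / t) by rewrite mulrC divfK// gt_eqF.
    rewrite !exprMn [m%:R ^+ m * _]mulrC -mulrA ler_wpM2l ?exprn_ge0 ?(ltW t0)//.
    rewrite -exprMn; apply: le_trans (powX_le_exp m0 _) _; first by rewrite divr_ge0// ltW.
    rewrite ler_wpM2l ?exprn_ge0//.
    have [Z0|Z0] := leP 0 (Z w).
      by rewrite ger0_norm// mulrC lerDl expR_ge0.
    by rewrite ltr0_norm// mulrC mulNr mulrN lerDr expR_ge0.
rewrite ge0_integralZl_EFin//; last 2 first.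
- by move=> w _; rewrite -EFinD lee_fin addr_ge0// expR_ge0.
- exact: emeasurable_funD.
rewrite EFinM lee_wpmul2l ?lee_fin// ge0_integralD//.
rewrite mulr_natl mulr2n EFinD; apply: leeD; apply: mgf1.
  by rewrite ger0_norm// invr_ge0 ltW.
by rewrite normrN ger0_norm// invr_ge0 ltW.
Qed.

Lemma gaussian_process_coord (X : R -> T -> R) t : gaussian_process P X -> t \in `[0, 1] ->
  centered_gaussian P (X t).
Proof.
move=> gX t01; have := gX 1%N (fun=> t) (fun=> 1) (fun=> t01).
by under eq_fun do rewrite big_ord1 mul1r.
Qed.

Lemma gaussian_process_measurable (X : R -> T -> R) : gaussian_process P X ->
  measurable_process X.
Proof. by move=> gX t t01; have [] := gaussian_process_coord gX t01. Qed.

Lemma gaussian_process_incr (X : R -> T -> R) s t : gaussian_process P X ->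
  s \in `[0, 1] -> t \in `[0, 1] -> centered_gaussian P (fun w => X s w - X t w).
Proof.
move=> gX s01 t01.
have := gX 2%N (fun i => if i == 0%N :> nat then s else t)
  (fun i => if i == 0%N :> nat then 1 else -1).
move=> /(_ _)/wrap[]; first by move=> i; case: ifP.
by under eq_fun do rewrite big_ord_recl big_ord1 /= mul1r mulN1r.
Qed.

Lemma poweR_half_le (x : \bar R) (c : R) : (0 <= x)%E -> (x `^ 2^-1 <= c%:E)%E ->
  (x <= (c ^+ 2)%:E)%E.
Proof.
case: x => [x| |] //; rewrite ?lee_fin.
  move=> x0 xc.
  have -> : x = (x `^ 2^-1) ^+ 2.
    by rewrite -powR_mulrn ?powR_ge0// -powRrM mulVf// powRr1.
  by rewrite lerXn2r ?nnegrE ?powR_ge0// (le_trans _ xc)// powR_ge0.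
by rewrite poweRyr ?invr_neq0// leye_eq.
Qed.

Variables (X : R -> T -> R) (lam beta : R).
Hypotheses (gX : gaussian_process P X) (lam0 : 0 < lam) (beta0 : 0 < beta).
Hypothesis hX : forall s t : R, s \in `[0, 1] -> t \in `[0, 1] ->
    ('E_P[fun w => ((X s w - X t w) ^+ 2)%R] `^ 2^-1
       <= (lam * `|s - t| `^ beta)%:E)%E.

(** The second moment clause gives [sig^2 <= 8 (lam c)^2 <= (3 lam c)^2], hence the factor 3. *)
Lemma incr_moment s t m (c : R) : s \in `[0, 1] -> t \in `[0, 1] -> (0 < m)%N ->
  `|s - t| `^ beta <= c -> 0 < c ->
  (\int[P]_w (`|X s w - X t w| ^+ m)%:E <=
    ((m%:R * (3 * lam * c)) ^+ m * (2 * expR (2^-1)))%:E)%E.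
Proof.
move=> s01 t01 m0 sc c0; have gi := gaussian_process_incr gX s01 t01.
have [mi _] := gi; have [sig [sig0 mgf var]] := centered_gaussian_mgf gi.
apply: (mgf_abs_moment mi m0 mgf sig0); last by rewrite !mulr_gt0.
have := hX s01 t01; rewrite unlock => /poweR_half_le H.
have : (0 <= \int[P]_w ((X s w - X t w) ^+ 2)%:E)%E.
  by apply: integral_ge0 => w _; rewrite lee_fin sqr_ge0.
move=> {}/H H; have := var 0; under eq_integral do rewrite subr0.
move=> /le_trans/(_ H); rewrite lee_fin => {}H.
rewrite -ler_sqr ?nnegrE ?mulr_ge0 ?(ltW lam0) ?(ltW c0)//.
apply: (@le_trans _ _ (8 * (lam * c) ^+ 2)).
  rewrite -ler_pdivrMl// mulrC; apply: le_trans H _.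
  by rewrite lerXn2r ?nnegrE ?mulr_ge0 ?powR_ge0 ?(ltW lam0) ?(ltW c0)// ler_wpM2l// ltW.
have -> : (3 * lam * c) ^+ 2 = 9 * (lam * c) ^+ 2 by ring.
by have := sqr_ge0 (lam * c); lra.
Qed.

(** Half of the Hoelder exponent: increments at level [k] have size of order [moment_base^(2 k)] and
    are normalized by [moment_base^k]; the remaining power pays for the number of dyadic points. *)
Definition moment_base : R := 2 `^ (- (beta / 2)).

Lemma moment_base_gt0 : 0 < moment_base. Proof. exact: powR_gt0. Qed.

Lemma moment_base_lt1 : moment_base < 1.
Proof.
have b0 : 0 < beta / 2 by rewrite divr_gt0.
rewrite /moment_base powRN invf_lt1 ?powR_gt0//.
have := @gt0_ltr_powR R _ b0 1 2 _ _ (ltr1n R 2).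
by rewrite powR1; apply; rewrite nnegrE.
Qed.

(** Level [k] has [2^k] increments, each of normalized moment at most [A th^(m k)]. The condition on
    [m] gives [th^m <= 1/4], so level [k] contributes at most [A / 2^k]. *)
Lemma path_moment_expectation m : 4 <= beta * m%:R ->
  exists C : R, (\int[P]_w path_moment m moment_base (X ^~ w) <= C%:E)%E.
Proof.
move=> bm; have th0 := moment_base_gt0; set th := moment_base in th0 *.
have m0 : (0 < m)%N.
  by rewrite lt0n; apply/eqP => m0; move: bm; rewrite m0 mulr0 lern0.
have mX := gaussian_process_measurable gX.
pose K := 2 * expR (2^-1) : R; have K0 : 0 <= K by rewrite mulr_ge0// expR_ge0.
pose A := (m%:R * (3 * lam)) ^+ m * K.
have A0 : 0 <= A by rewrite mulr_ge0// exprn_ge0// !mulr_ge0// ltW.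
have i0 : (0 : R) \in `[0, 1] by rewrite in_itv/= lexx ler01.
have gX0 := gaussian_process_coord gX i0.
have [s0 [s00 mgf0 _]] := centered_gaussian_mgf gX0.
have mX0 := mX _ i0.
exists ((m%:R * (s0 + 1)) ^+ m * K + 2 * A).
have mi k (j : nat) : (j < 2 ^ k)%N ->
    measurable_fun setT (fun w => X (dyadic k j.+1) w - X (dyadic k j) w).
  by move=> jk; apply: measurable_funB; apply: mX; apply: dyadic_itv => //; exact: ltnW.
have mk k (j : 'I_(2 ^ k)) : measurable_fun setT
    (fun w => (`|X (dyadic k j.+1) w - X (dyadic k j) w| / th ^+ k) ^+ m).
  apply: measurable_funX; apply: measurable_funM => //; apply: measurableT_comp => //.
  exact: mi.
have t0 k (j : nat) w : 0 <= (`|X (dyadic k j.+1) w - X (dyadic k j) w| / th ^+ k) ^+ m.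
  by rewrite exprn_ge0// divr_ge0// exprn_ge0// ltW.
rewrite /path_moment ge0_integralD//; last 3 first.
- by apply/measurable_EFinP; apply: measurable_funX; exact: measurableT_comp.
- by move=> w _; apply: nneseries_ge0 => k _ _; rewrite lee_fin; apply: sumr_ge0.
- apply: ge0_emeasurable_sum => [k w _ _|k _]; first by rewrite lee_fin; apply: sumr_ge0.
  by apply/measurable_EFinP; apply: measurable_sum.
rewrite EFinD; apply: leeD.
  by apply: (mgf_abs_moment mX0 m0 mgf0 s00); rewrite ?lerDl// ltr_wpDl.
rewrite integral_nneseries//; last 2 first.
- by move=> k; apply/measurable_EFinP; apply: measurable_sum.
- by move=> k w _; rewrite lee_fin; apply: sumr_ge0.
have term k : (\int[P]_w (\sum_(j < 2 ^ k)
    (`|X (dyadic k j.+1) w - X (dyadic k j) w| / th ^+ k) ^+ m)%:E <= (A / 2 ^+ k)%:E)%E.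
  under eq_integral do rewrite -sumEFin.
  rewrite ge0_integral_sum//; last 2 first.
  - by move=> j; apply/measurable_EFinP.
  - by move=> j w _; rewrite lee_fin.
  apply: (@le_trans _ _ (\sum_(j < 2 ^ k) (A * (th ^+ m) ^+ k)%:E)%E).
    apply: lee_sum => j _.
    under eq_integral do rewrite exprMn mulrC EFinM.
    rewrite ge0_integralZl_EFin//; last 2 first.
    - apply/measurable_EFinP; apply: measurable_funX; apply: measurableT_comp => //.
      exact: mi.
    - by rewrite exprn_ge0// invr_ge0 exprn_ge0// ltW.
    have dj : `|dyadic k j.+1 - dyadic k j : R| `^ beta <= (th ^+ k) ^+ 2.
      have -> : dyadic k j.+1 - dyadic k j = 2 `^ (- k%:R) :> R.
        rewrite /dyadic -mulrBl -natrB// subSn// subnn mul1r.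
        by rewrite powRN powR_mulrn.
      rewrite ger0_norm ?powR_ge0// -powRrM.
      rewrite -exprM -(powR_mulrn _ (ltW th0)) /th /moment_base -powRrM ler_powR ?ler1n//.
      rewrite natrM le_eqVlt; apply/orP; left; apply/eqP; by field.
    have tk0 : 0 < (th ^+ k) ^+ 2 by rewrite !exprn_gt0.
    have := incr_moment (dyadic_itv (ltn_ord j)) (dyadic_itv (ltnW (ltn_ord j))) m0 dj tk0.
    have c0 : (0 <= ((th ^+ k)^-1 ^+ m)%:E)%E.
      by rewrite lee_fin exprn_ge0// invr_ge0 exprn_ge0// ltW.
    move=> /(lee_wpmul2l c0) /le_trans; apply; rewrite -EFinM lee_fin /A.
    rewrite le_eqVlt; apply/orP; left; apply/eqP.
    have thk : th ^+ k != 0 by rewrite gt_eqF// exprn_gt0.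
    have -> : (th ^+ m) ^+ k = (th ^+ k) ^+ m by rewrite -!exprM mulnC.
    rewrite -/K; set y := th ^+ k in thk *.
    have -> : m%:R * (3 * lam * y ^+ 2) = (m%:R * (3 * lam)) * (y * y).
      by rewrite expr2; ring.
    rewrite [(_ * (y * y)) ^+ m]exprMn [(y * y) ^+ m]exprMn exprVn; field.
    by rewrite expf_neq0.
  rewrite sumEFin lee_fin sumr_const card_ord -(mulr_natr (A * _)) natrX -(mulrA A).
  apply: ler_wpM2l => //.
  have th4 : th ^+ m <= 4^-1.
    rewrite -(powR_mulrn _ (ltW th0)) /th /moment_base -powRrM.
    have -> : 4^-1 = 2 `^ (- 2%:R) :> R.
      by rewrite powRN powR_mulrn//; congr (_^-1); ring.
    rewrite ler_powR ?ler1n//; lra.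
  rewrite -exprMn -exprVn lerXn2r ?nnegrE ?mulr_ge0 ?exprn_ge0 ?(ltW th0) ?invr_ge0//; lra.
apply: (@le_trans _ _ (\sum_(k <oo) (A / 2 ^+ k)%:E)%E).
  apply: lee_nneseries => [k _|k _]; last exact: term.
  by move=> _; apply: integral_ge0 => w _; rewrite lee_fin; apply: sumr_ge0.
apply: lime_le; first by apply: is_cvg_nneseries => k _ _; rewrite lee_fin divr_ge0// exprn_ge0.
apply: nearW => n; rewrite sumEFin lee_fin -mulr_sumr mulrC ler_wpM2r//.
have -> : \sum_(0 <= i < n) (2 ^+ i)^-1 = 2 * (1 - (2^-1) ^+ n) :> R.
  elim: n => [|n IH]; first by rewrite big_geq// expr0 subrr mulr0.
  by rewrite big_nat_recr//= IH exprS exprVn; field; rewrite expf_neq0.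
by rewrite ler_piMr// gerBl exprn_ge0// invr_ge0.
Qed.

End PathMomentExpectation.

(** * Entropy of the sieve *)

Section SieveBounds.
Context {R : realType}.
Variables (sigma : R -> R) (k : R).
Hypotheses (k0 : 0 <= k) (sigma_k : forall x y, `|sigma x - sigma y| <= k * `|x - y|).
Variables (u b r : R) (J p q : nat) (s : nat -> R).
Hypotheses (u1 : 1 <= u) (b1 : 1 <= b) (r1 : 1 <= r).

(** The quantity sigma_{b (r u + 1)} of the rate conditions. It dominates every activation in the
    network: at most [r] weights of size [b] meet inputs of size [u], plus a bias. *)
Definition act_bound : R := supnorm [set z | `|z| <= b * (r * u + 1)] sigma.

Let u0 : 0 < u. Proof. exact: lt_le_trans u1. Qed.
Let b0 : 0 < b. Proof. exact: lt_le_trans b1. Qed.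
Let r0 : 0 < r. Proof. exact: lt_le_trans r1. Qed.

Lemma act_bound_ge0 : 0 <= act_bound. Proof. exact: supnorm_ge0. Qed.

Lemma act_bound_ub z : `|z| <= b * (r * u + 1) -> `|sigma z| <= act_bound.
Proof.
apply: (@supnorm_ub _ _ sigma (`|sigma 0| + k * (b * (r * u + 1)))) => y /= yb.
rewrite -[sigma y](subrK (sigma 0)) addrC; apply: le_trans (ler_normD _ _) _.
rewrite lerD2l; apply: le_trans (sigma_k _ _) _; rewrite subr0 ler_wpM2l//.
Qed.

Implicit Types (c theta : 'I_p -> 'I_q -> R) (xi : 'I_p -> 'I_q -> 'I_J -> R)
  (w zeta : 'I_p -> R) (x : R -> R).

Lemma hidden_arg_le (xi : 'I_J -> R) (th : R) x : (forall j, `|xi j| <= b) -> `|th| <= b ->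
  #|[set j | xi j != 0]|%:R <= r -> (forall j : 'I_J, `|x (s j.+1)| <= u) ->
  `|\sum_(j < J) xi j * x (s j.+1) + th| <= b * (r * u + 1).
Proof.
move=> xib thb xir xu; apply: le_trans (ler_normD _ _) _; rewrite mulrDr mulr1 lerD//.
apply: le_trans (ler_norm_sum _ _ _) _.
rewrite (bigID (fun j => xi j != 0))/= [X in _ + X]big1 ?addr0; last first.
  by move=> j; rewrite negbK => /eqP ->; rewrite mul0r normr0.
apply: (@le_trans _ _ (\sum_(j < J | xi j != 0) (b * u))).
  by apply: ler_sum => j _; rewrite normrM ler_pM.
rewrite sumr_const -mulr_natl mulrCA ler_wpM2l ?(ltW b0)// ler_wpM2r ?(ltW u0)//.
apply: le_trans xir; rewrite ler_nat; apply: subset_leq_card.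
by apply/fintype.subsetP => j; rewrite !inE.
Qed.

Lemma outer_arg_le (w z t : R) : `|w| <= b -> `|z| <= b -> t \in `[0, 1] ->
  `|w * t + z| <= b * (r * u + 1).
Proof.
rewrite in_itv/= => wb zb /andP[t0 t1]; apply: le_trans (ler_normD _ _) _.
rewrite mulrDr mulr1 lerD// normrM (ger0_norm t0).
apply: (@le_trans _ _ (b * 1)); first by apply: ler_pM.
by rewrite ler_wpM2l ?(ltW b0)// mulr_ege1.
Qed.

Record admissible c theta xi w zeta : Prop := {
  adm_c : forall l i, `|c l i| <= b;
  adm_theta : forall l i, `|theta l i| <= b;
  adm_xi : forall l i j, `|xi l i j| <= b;
  adm_w : forall l, `|w l| <= b;
  adm_zeta : forall l, `|zeta l| <= b;
  adm_sparse : forall l i, #|[set j | xi l i j != 0]|%:R <= r }.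

(** Only the last factor depends on the location: output weight at most [b], hidden activation at
    most [act_bound], slope at most [k b]. *)
Lemma network_lip c theta xi w zeta x t t' : admissible c theta xi w zeta ->
  t \in `[0, 1] -> t' \in `[0, 1] ->
  `|network sigma u s c theta xi w zeta x t - network sigma u s c theta xi w zeta x t'| <=
  p%:R * q%:R * b ^+ 2 * act_bound * k * `|t - t'|.
Proof.
move=> [hc hth hxi hw hz hr] t01 t01'; have A0 := act_bound_ge0.
have R0 : 0 <= p%:R * q%:R * b ^+ 2 * act_bound * k * `|t - t'|.
  by rewrite !mulr_ge0// ?exprn_ge0// ltW.
rewrite /network; have [->|Ex] := truncation01 u (grid_set J s) x.
  by rewrite !mul0r subrr normr0.
have xu : forall j : 'I_J, `|x (s j.+1)| <= u.
  by move=> j; have := truncation1_box u1 Ex (j := j.+1); apply; rewrite /= ltn_ord.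
rewrite Ex !mul1r -sumrB; apply: le_trans (ler_norm_sum _ _ _) _.
apply: (@le_trans _ _ (\sum_(l < p) \sum_(i < q) (b ^+ 2 * act_bound * k * `|t - t'|))).
  apply: ler_sum => l _; rewrite -sumrB; apply: le_trans (ler_norm_sum _ _ _) _.
  apply: ler_sum => i _; rewrite -mulrBr !normrM.
  have h1 := hc l i; have h2 := act_bound_ub (hidden_arg_le (hxi l i) (hth l i) (hr l i) xu).
  have h3 : `|sigma (w l * t + zeta l) - sigma (w l * t' + zeta l)| <= k * (b * `|t - t'|).
    apply: le_trans (sigma_k _ _) _; rewrite ler_wpM2l//.
    by rewrite opprD addrACA subrr addr0 -mulrBr normrM ler_wpM2r.
  apply: le_trans (ler_pM _ _ (ler_pM _ _ h1 h2) h3) _ => //.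
  by rewrite le_eqVlt; apply/orP; left; apply/eqP; ring.
rewrite !sumr_const !card_ord -mulrnA -[leLHS]mulr_natl natrM.
by rewrite le_eqVlt; apply/orP; left; apply/eqP; ring.
Qed.

(** The factors of each product are changed one at a time. All [J] inputs are allowed to move, since
    this constant enters the entropy only through a logarithm. Both networks carry the same
    truncation, so its jump is harmless. *)
Lemma network_close c theta xi w zeta c' theta' xi' w' zeta' x t eta :
  admissible c theta xi w zeta -> admissible c' theta' xi' w' zeta' -> 0 <= eta ->
  (forall l i, `|c l i - c' l i| <= eta /\ `|theta l i - theta' l i| <= eta) ->
  (forall l i j, `|xi l i j - xi' l i j| <= eta) ->
  (forall l, `|w l - w' l| <= eta /\ `|zeta l - zeta' l| <= eta) ->
  t \in `[0, 1] ->
  `|network sigma u s c theta xi w zeta x t - network sigma u s c' theta' xi' w' zeta' x t| <=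
  p%:R * q%:R * (eta * (act_bound * (act_bound + b * k * (J%:R * u + 3)))).
Proof.
move=> [hc hth hxi hw hz hr] [hc' hth' hxi' hw' hz' hr'] eta0 dc dxi dw t01.
have A0 := act_bound_ge0; set A := act_bound in A0 *.
have R0 : 0 <= p%:R * q%:R * (eta * (A * (A + b * k * (J%:R * u + 3)))).
  by rewrite !mulr_ge0// addr_ge0// ?mulr_ge0// ?addr_ge0// ?mulr_ge0// ltW.
rewrite /network; have [->|Ex] := truncation01 u (grid_set J s) x.
  by rewrite !mul0r subrr normr0.
have xu : forall j : 'I_J, `|x (s j.+1)| <= u.
  by move=> j; have := truncation1_box u1 Ex (j := j.+1); apply; rewrite /= ltn_ord.
rewrite Ex !mul1r -sumrB; apply: le_trans (ler_norm_sum _ _ _) _.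
apply: (@le_trans _ _ (\sum_(l < p) \sum_(i < q) (eta * (A * (A + b * k * (J%:R * u + 3)))))); last first.
  rewrite !sumr_const !card_ord -mulrnA -[leLHS]mulr_natl natrM.
  by rewrite le_eqVlt; apply/orP; left; apply/eqP; ring.
apply: ler_sum => l _; rewrite -sumrB; apply: le_trans (ler_norm_sum _ _ _) _.
apply: ler_sum => i _.
set a1 := \sum_(j < J) xi l i j * _ + _; set a1' := \sum_(j < J) xi' l i j * _ + _.
set a2 := w l * t + _; set a2' := w' l * t + _.
have s1 : `|sigma a1| <= A := act_bound_ub (hidden_arg_le (hxi l i) (hth l i) (hr l i) xu).
have s1' : `|sigma a1'| <= A := act_bound_ub (hidden_arg_le (hxi' l i) (hth' l i) (hr' l i) xu).
have s2 : `|sigma a2| <= A := act_bound_ub (outer_arg_le (hw l) (hz l) t01).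
have s2' : `|sigma a2'| <= A := act_bound_ub (outer_arg_le (hw' l) (hz' l) t01).
have d1 : `|sigma a1 - sigma a1'| <= k * (eta * (J%:R * u + 1)).
  apply: le_trans (sigma_k _ _) _; rewrite ler_wpM2l//.
  rewrite /a1 /a1' opprD addrACA -sumrB; apply: le_trans (ler_normD _ _) _.
  rewrite mulrDr mulr1 lerD//; last by have [] := dc l i.
  apply: le_trans (ler_norm_sum _ _ _) _.
  apply: (@le_trans _ _ (\sum_(j < J) (eta * u))).
    by apply: ler_sum => j _; rewrite -mulrBl normrM ler_pM.
  by rewrite sumr_const card_ord -(mulr_natl (eta * u)) mulrCA.
have d2 : `|sigma a2 - sigma a2'| <= k * (eta * 2).
  apply: le_trans (sigma_k _ _) _; rewrite ler_wpM2l//.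
  rewrite /a2 /a2' opprD addrACA -mulrBl; apply: le_trans (ler_normD _ _) _.
  have [dw1 dw2] := dw l; move: t01; rewrite in_itv/= => /andP[t0 t1].
  rewrite mulr_natr mulr2n lerD// normrM (ger0_norm t0).
  by rewrite -[leRHS]mulr1 ler_pM.
have -> : c l i * sigma a1 * sigma a2 - c' l i * sigma a1' * sigma a2' =
  (c l i - c' l i) * sigma a1 * sigma a2 + c' l i * (sigma a1 - sigma a1') * sigma a2
  + c' l i * sigma a1' * (sigma a2 - sigma a2') by ring.
have [dc1 _] := dc l i.
have -> : eta * (A * (A + b * k * (J%:R * u + 3))) =
  eta * A * A + b * (k * (eta * (J%:R * u + 1))) * A + b * A * (k * (eta * 2)) by ring.
apply: le_trans (ler_normD _ _) _; apply: lerD; last first.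
  rewrite !normrM; apply: ler_pM => //; exact: ler_pM.
apply: le_trans (ler_normD _ _) _.
by apply: lerD; rewrite !normrM; apply: ler_pM => //; exact: ler_pM.
Qed.

Variables (B nu : R).
Notation sv := (sieve sigma B nu u b r J p q s).

Lemma sieve_admissible G : sv G -> exists c theta xi w zeta,
  admissible c theta xi w zeta /\ G = network sigma u s c theta xi w zeta.
Proof.
move=> [_ [c [th [xi [w [ze [-> h1 h2 h3 h4]]]]]]].
exists c, th, xi, w, ze; split=> //; split=> // [l i|l i|l|l].
- by have [] := h1 l i.
- by have [] := h1 l i.
- by have [] := h3 l.
- by have [] := h3 l.
Qed.

Lemma sieve_truncated G x t : sv G -> truncation (grid_set J s) u x = 0 -> G x t = 0.
Proof. by move=> /sieve_admissible [c [th [xi [w [ze [_ ->]]]]]] E; rewrite /network E mul0r. Qed.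

Lemma network_ext c theta xi w zeta x x' t : (forall j : 'I_J, x (s j.+1) = x' (s j.+1)) ->
  network sigma u s c theta xi w zeta x t = network sigma u s c theta xi w zeta x' t.
Proof.
move=> xx'; rewrite /network; congr (_ * _).
  rewrite !truncationE ?(ltW u0)//; congr (_ _); congr (_ : nat); congr nat_of_bool.
  by apply: eq_forallb => j; rewrite xx'.
apply: eq_bigr => l _; apply: eq_bigr => i _; congr (_ * sigma (_ + _) * _).
by apply: eq_bigr => j _; rewrite xx'.
Qed.

(** The constraint on [opnorm] concerns continuous paths bounded by [u] on all of [0,1], whereas
    truncation controls grid values only. A network reads nothing but these values, so [x] may be
    replaced by its interpolant, which is bounded by [u] everywhere. *)
Lemma sieve_bound G x t : is_grid J s -> (0 < J)%N -> 0 <= B -> sv G -> t \in `[0, 1] ->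
  `|G x t| <= B * u `^ nu.
Proof.
move=> g J0 B0 svG t01; have K0 : 0 <= B * u `^ nu by rewrite mulr_ge0// powR_ge0.
have [E|E] := truncation01 u (grid_set J s) x.
  by rewrite (sieve_truncated t svG E) normr0.
have [opG _] := svG; have [c [th [xi [w [ze [_ GE]]]]]] := sieve_admissible svG.
have -> : G x t = G (interp J s (x \o s)) t.
  rewrite GE; apply: network_ext => j; rewrite interp_grid//; exact: ltn_ord.
rewrite -lee_fin; apply: le_trans opG; apply: ereal_sup_ubound.
exists (interp J s (x \o s)), t; split => //; first exact: C01_interp.
apply: supnorm_le => [|v v01]; first exact: ltW.
by apply: interp_norm_le => //; exact: truncation1_box E.
Qed.

Lemma sieve_lip G x t t' : sv G -> t \in `[0, 1] -> t' \in `[0, 1] ->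
  `|G x t - G x t'| <= p%:R * q%:R * b ^+ 2 * act_bound * k * `|t - t'|.
Proof.
by move=> /sieve_admissible [c [th [xi [w [ze [adm ->]]]]]]; exact: network_lip.
Qed.

End SieveBounds.

(** * Quantization and the finite net *)

Section Quantization.
Context {R : realType}.
Variables (b eta : R) (M : nat).
Hypotheses (eta0 : 0 < eta) (bM : 2 * b / eta < M.+1%:R).

Definition quant (z : R) : 'I_M.+1 := inord (Num.truncn ((z + b) / eta)).

(** The lower bound on [M] keeps [inord] away from its default value, so equal codes mean the same
    cell of length [eta]. *)
Lemma quant_close z z' : `|z| <= b -> `|z'| <= b -> quant z = quant z' ->
  `|z - z'| <= eta.
Proof.
have key y : `|y| <= b -> (nat_of_ord (quant y))%:R <= (y + b) / eta < (nat_of_ord (quant y)).+1%:R.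
  rewrite ler_norml => /andP[lo hi].
  have yb0 : 0 <= (y + b) / eta by rewrite divr_ge0 ?(ltW eta0)//; lra.
  rewrite /quant inordK; first exact: truncn_itv.
  rewrite -(ltr_nat R); apply: le_lt_trans bM.
  apply: (@le_trans _ _ ((y + b) / eta)); first by have /andP[] := truncn_itv yb0.
  by rewrite ler_pM2r ?invr_gt0//; lra.
move=> /key/andP[l1 h1] /key/andP[l2 h2] zz; rewrite zz in l1 h1.
move: l1 h1 l2 h2; rewrite -!natr1 => l1 h1 l2 h2.
have -> : z - z' = eta * ((z + b) / eta - (z' + b) / eta) by field; rewrite gt_eqF.
rewrite normrM (gtr0_norm eta0) ler_piMr ?(ltW eta0)// ler_norml; apply/andP; split; lra.
Qed.

Variables (J n : nat).

(** Positions and quantized values of the nonzero weights, in order of enumeration, padded with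
    [None] to length [n]. With [n] about [r], the number of codes grows like [(J M)^r] rather than
    [M^J]: this is where sparsity lowers the entropy. *)
Definition sparse_code (xi : 'I_J -> R) : {ffun 'I_n -> option ('I_J * 'I_M.+1)} :=
  [ffun a : 'I_n => omap (fun j => (j, quant (xi j))) (onth (enum [pred j | xi j != 0]) a)].

(** A support of at most [n] elements can be read off the code, so weights with equal codes vanish
    at the same places. *)
Lemma sparse_code_sub (xi xi' : 'I_J -> R) j : (#|[pred j | xi j != 0%R]| <= n)%N ->
  sparse_code xi = sparse_code xi' -> xi j != 0 ->
  xi' j != 0 /\ quant (xi j) = quant (xi' j).
Proof.
move=> xn cc xj; set e := enum [pred j | xi j != 0].
have je : j \in e by rewrite mem_enum.
have [i ei] := onthP je.
have In : (i < n)%N by apply: leq_trans xn; rewrite cardE -/e -onthTE ei.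
have := congr1 (fun f : {ffun _ -> _} => f (Ordinal In)) cc.
rewrite /sparse_code !ffunE /= -/e ei /=.
case E : (onth _ _) => [j'|]//= [jj' qq]; rewrite -jj' in qq E; split=> //.
suff : j \in enum [pred j | xi' j != 0] by rewrite mem_enum.
by apply/onthP; exists i.
Qed.

Lemma sparse_code_close (xi xi' : 'I_J -> R) j : (forall j, `|xi j| <= b) ->
  (forall j, `|xi' j| <= b) -> (#|[pred j | xi j != 0%R]| <= n)%N ->
  (#|[pred j | xi' j != 0%R]| <= n)%N ->
  sparse_code xi = sparse_code xi' -> `|xi j - xi' j| <= eta.
Proof.
move=> xb xb' xn xn' cc; have [xj|xj] := eqVneq (xi j) 0.
  have [xj'|xj'] := eqVneq (xi' j) 0; first by rewrite xj xj' subrr normr0 ltW.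
  by have [] := sparse_code_sub xn' (esym cc) xj'; rewrite xj eqxx.
by have [_ qq] := sparse_code_sub xn cc xj; exact: quant_close.
Qed.

End Quantization.

Section Cover.
Context {R : realType}.
Variables (sigma : R -> R) (k : R).
Hypotheses (k0 : 0 <= k) (sigma_k : forall x y, `|sigma x - sigma y| <= k * `|x - y|).
Variables (u b r B nu eta : R) (J p q M : nat) (s : nat -> R).
Hypotheses (u1 : 1 <= u) (b1 : 1 <= b) (r1 : 1 <= r) (J0 : (0 < J)%N) (q0 : (0 < q)%N).
Hypotheses (eta0 : 0 < eta) (bM : 2 * b / eta < M.+1%:R).
Notation sv := (sieve sigma B nu u b r J p q s).
Notation A := (act_bound sigma u b r).

Let n := Num.truncn r.
Local Notation code := ({ffun 'I_p * 'I_q -> 'I_M.+1 * 'I_M.+1 * {ffun 'I_n -> option ('I_J * 'I_M.+1)}}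
   * {ffun 'I_p -> 'I_M.+1 * 'I_M.+1})%type.

Lemma leq_exp2r_weak m m' e : (m <= m')%N -> (m ^ e <= m' ^ e)%N.
Proof. by case: e => [|e] // mm'; rewrite leq_exp2r. Qed.

(** Each pair of indices costs two scalars and [n] sparse entries, each outer index two more
    scalars, and every such item has at most [Z] values. The exponent [(2 + n) p q + 2 p] is at most
    [5 p q n] because [n] and [q] are positive. *)
Lemma card_code : (#|{: code}| <= (2 * J * M.+1) ^ (5 * p * q * n))%N.
Proof.
have n1 : (0 < n)%N by rewrite /n truncn_gt0.
set Z := (2 * J * M.+1)%N.
have Z0 : (0 < Z)%N by rewrite /Z !muln_gt0 J0.
have MZ : (M.+1 <= Z)%N by rewrite /Z leq_pmull// muln_gt0 J0.
have JZ : ((J * M.+1).+1 <= Z)%N.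
  by rewrite /Z -mulnA mul2n -addnn -addn1 leq_add2l muln_gt0 J0.
have MZ2 : (M.+1 * M.+1 <= Z ^ 2)%N by rewrite -mulnn leq_mul.
rewrite !(card_prod, card_ffun, card_option, card_ord).
apply: (@leq_trans ((Z ^ 2 * Z ^ n) ^ (p * q) * (Z ^ 2) ^ p)%N).
  apply: leq_mul; last exact: leq_exp2r_weak.
  by apply: leq_exp2r_weak; apply: leq_mul => //; exact: leq_exp2r_weak.
rewrite -expnD -!expnM -expnD leq_pexp2l//.
have h1 : (p <= p * q * n)%N by rewrite -mulnA leq_pmulr// muln_gt0 q0.
have h2 : (p * q <= p * q * n)%N by rewrite leq_pmulr.
have -> : (5 * p * q * n = 5 * (p * q * n))%N by rewrite -!mulnA.
rewrite mulnDl (mulnC n).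
by move: h1 h2; move: (p * q * n)%N (p * q)%N => y z; clear; lia.
Qed.

Definition code_of (c theta : 'I_p -> 'I_q -> R) (xi : 'I_p -> 'I_q -> 'I_J -> R)
    (w zeta : 'I_p -> R) : code :=
  ([ffun li => (quant b eta M (c li.1 li.2), quant b eta M (theta li.1 li.2),
     sparse_code b eta M n (xi li.1 li.2))],
   [ffun l => (quant b eta M (w l), quant b eta M (zeta l))]).

(** Centers are members of the sieve with a given code, not networks with rounded parameters:
    rounding could violate the constraint on [opnorm]. Codes of no member receive the arbitrary
    member [G0]. *)
Lemma sieve_cover : (exists G, sv G) ->
  exists (Gc : code -> (R -> R) -> R -> R), (forall a, sv (Gc a)) /\
    forall G, sv G -> exists a, forall x t, t \in `[0, 1] ->
      `|G x t - Gc a x t| <= p%:R * q%:R * (eta * (A * (A + b * k * (J%:R * u + 3)))).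
Proof.
move=> [G0 svG0].
pose coded G a := sv G /\ exists c theta xi w zeta,
  [/\ admissible b r c theta xi w zeta, G = network sigma u s c theta xi w zeta
    & code_of c theta xi w zeta = a].
have /choice[Gc GcP] : forall a, exists G, sv G /\ ((exists G', coded G' a) -> coded G a).
  move=> a; have [[G' G'a]|H] := pselect (exists G', coded G' a).
    by exists G'; split=> //; have [] := G'a.
  by exists G0; split=> // H'; exfalso; exact: H.
exists Gc; split=> [a|G svG]; first by have [] := GcP a.
have [c [th [xi [w [ze [adm GE]]]]]] := sieve_admissible svG.
exists (code_of c th xi w ze) => x t t01.
have [_ /(_ _)/wrap[]] := GcP (code_of c th xi w ze).
  by exists G; split=> //; exists c, th, xi, w, ze.
move=> [_ [c' [th' [xi' [w' [ze' [adm' GE' cc]]]]]]].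
rewrite GE' GE; move: cc => [cc1 cc2].
have e1 l i : quant b eta M (c' l i) = quant b eta M (c l i) /\
   quant b eta M (th' l i) = quant b eta M (th l i) /\
   sparse_code b eta M n (xi' l i) = sparse_code b eta M n (xi l i).
  by have := congr1 (fun f : {ffun _ -> _} => f (l, i)) cc1; rewrite !ffunE/= => -[].
have e2 l : quant b eta M (w' l) = quant b eta M (w l) /\
   quant b eta M (ze' l) = quant b eta M (ze l).
  by have := congr1 (fun f : {ffun _ -> _} => f l) cc2; rewrite !ffunE/= => -[].
have [hc hth hxi hw hz hr] := adm; have [hc' hth' hxi' hw' hz' hr'] := adm'.
have sp (m : nat) : m%:R <= r -> (m <= n)%N.
  move=> mr; rewrite -ltnS -(ltr_nat R); apply: le_lt_trans mr _.
  by rewrite truncnS_gt.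
have card_pred (y : 'I_J -> R) : #|[set j | y j != 0]| = #|[pred j | y j != 0]|.
  by apply: eq_card => j; apply/idP/idP; rewrite !inE.
apply: network_close => //; first exact: ltW.
- move=> l i; have [q1 [q2 q3]] := e1 l i.
  by split; apply: (quant_close eta0 bM) => //; exact: esym.
- move=> l i j; have [q1 [q2 q3]] := e1 l i.
  have cn : (#|[pred j | xi l i j != 0%R]| <= n)%N by apply: sp; rewrite -card_pred.
  have cn' : (#|[pred j | xi' l i j != 0%R]| <= n)%N by apply: sp; rewrite -card_pred.
  exact: (sparse_code_close eta0 bM j (hxi l i) (hxi' l i) cn cn' (esym q3)).
- by move=> l; have [q1 q2] := e2 l; split; apply: (quant_close eta0 bM) => //; exact: esym.
Qed.

End Cover.

(** * Quadrature, lower integrals and exponential bounds *)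

Section Quadrature.
Context {R : realType}.
Notation mu := (@lebesgue_measure R).
Variables (L : nat) (t : nat -> R).
Hypotheses (g : is_grid L t) (L2 : (1 < L)%N).

(** Right end of the [l]-th quadrature cell: cells meet at the midpoints between nodes, the first
    and last being extended to 0 and 1. The quadrature weights are their lengths. *)
Definition cell_end (l : nat) : R :=
  if l == 0%N then 0 else if l == L then 1 else (t l + t l.+1) / 2.

Lemma quad_weight_cell l : (0 < l <= L)%N ->
  quad_weight L t l = cell_end l - cell_end l.-1.
Proof.
case: l => // l /= lL; rewrite /quad_weight /cell_end /=.
case: l lL => [|l] lL /=; first by rewrite (ltn_eqF L2) subr0.
have [lLE|lLn] := eqVneq l.+2 L.
  by rewrite -lLE /= ltn_eqF.
by rewrite ltn_eqF//; field.
Qed.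

Lemma sum_quad_weight : \sum_(1 <= l < L.+1) quad_weight L t l = 1.
Proof.
rewrite big_add1/= (eq_big_nat _ _ (F2 := fun l => cell_end l.+1 - cell_end l)); last first.
  by move=> l /andP[_ lL]; rewrite quad_weight_cell.
rewrite telescope_sumr// /cell_end eqxx subr0.
by case: L L2 => // l _; rewrite eqxx.
Qed.

Lemma cell_end_mono l : (l < L)%N -> cell_end l <= cell_end l.+1.
Proof.
move=> lL; rewrite /cell_end/=; have [t0 t1 tS] := g.
have tl i : (i <= L)%N -> t i < t i.+1 by exact: tS.
case: l lL => [|l] lL /=.
  rewrite ltn_eqF//; have := tl 0%N (leq0n _); have := tl 1%N (ltnW L2); lra.
rewrite ltn_eqF//; have := tl l.+1 (ltnW lL).
have tL1 i : (i <= L.+1)%N -> t i <= 1.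
  by move=> iL; have := is_grid_01 g iL; rewrite in_itv/= => /andP[].
case: ifP => [|_].
  move=> _; have := tL1 l.+1 (leqW (ltnW lL)); have := tL1 l.+2 (leqW lL); lra.
have := tl l.+2 lL; lra.
Qed.

Lemma quad_weight_ge0 l : (0 < l <= L)%N -> 0 <= quad_weight L t l.
Proof.
move=> lL; rewrite quad_weight_cell// subr_ge0.
by case: l lL => // l /= lL; exact: cell_end_mono.
Qed.

Lemma quad_weight_le1 l : (0 < l <= L)%N -> quad_weight L t l <= 1.
Proof.
move=> lL; rewrite -sum_quad_weight (big_cat_nat (n := l))//=; last 2 first.
- by case/andP: lL.
- by case/andP: lL => _ /leqW.
rewrite [X in _ + X]big_ltn; last by case/andP: lL.
rewrite addrCA lerDl addr_ge0//.
  rewrite big_nat_cond; apply: sumr_ge0 => i /andP[/andP[i1 il] _].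
  by apply: quad_weight_ge0; rewrite i1 (leq_trans (ltnW il))//; case/andP: lL.
rewrite big_nat_cond; apply: sumr_ge0 => i /andP[/andP[i1 il] _].
by apply: quad_weight_ge0; rewrite (leq_trans _ i1).
Qed.

Lemma cell_cover v : v \in `[0, 1] -> exists l, [/\ (0 < l <= L)%N,
  cell_end l.-1 <= v <= cell_end l & `|v - t l| <= spacing L t].
Proof.
rewrite in_itv/= => /andP[v0 v1]; have [t0 t1 tS] := g.
have [l [lL lo hi]] : exists l, [/\ (0 < l <= L)%N, cell_end l.-1 <= v & v <= cell_end l].
  suff H m : (0 < m <= L)%N -> v <= cell_end m ->
      exists l, [/\ (0 < l <= L)%N, cell_end l.-1 <= v & v <= cell_end l].
    by apply: (H L); rewrite ?leqnn ?(ltnW L2)// /cell_end eqxx (gtn_eqF (ltnW L2)).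
  elim: m => // m IH /andP[_ mL] vm.
  have [mv|/ltW vm'] := leP (cell_end m) v; first by exists m.+1; split=> //=; rewrite mL.
  case: m IH mL vm vm' => [|m] IH mL vm vm'.
    by exists 1%N; split => //=; rewrite ltnW.
  by apply: IH => //; rewrite /= ltnW.
have /andP[l0 lL'] := lL.
exists l; split=> //; first by rewrite lo hi.
have sp1 := spacing_ge t (leq_trans (leq_pred l) lL'); have sp2 := spacing_ge t lL'.
rewrite prednK// in sp1.
have h1 := tS _ (leq_trans (leq_pred l) lL'); have h2 := tS _ lL'.
rewrite prednK// in h1.
rewrite ler_norml; apply/andP; split.
  move: lo; rewrite /cell_end.
  have [l1|l1] := eqVneq l.-1 0%N; first by move=> _; move: sp1; rewrite l1 t0; lra.
  have -> : (l.-1 == L) = false by rewrite ltn_eqF// prednK.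
  rewrite prednK//; lra.
move: hi; rewrite /cell_end gtn_eqF//.
have [lE|_] := eqVneq l L; last by lra.
by move=> _; move: sp2; rewrite lE t1; lra.
Qed.

(** Only an upper bound is wanted, so the closed cells may overlap at their ends; on each the
    integrand is at most its value at the node plus [e]. *)
Lemma quadrature_le (f : R -> R) (e : R) : 0 <= e -> (forall v, 0 <= f v) ->
  measurable_fun (`[0, 1]%classic : set R) f ->
  (forall l v, (0 < l <= L)%N -> v \in `[0, 1] -> `|v - t l| <= spacing L t ->
     f v <= f (t l) + e) ->
  (\int[mu]_(v in `[0%R, 1%R]) (f v)%:E <=
    (\sum_(1 <= l < L.+1) quad_weight L t l * f (t l) + e)%:E)%E.
Proof.
move=> e0 f0 mf fe.
pose cell l : set R := `[cell_end l.-1, cell_end l]%classic.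
apply: (@le_trans _ _ (\int[mu]_(v in `[0%R, 1%R])
   (\sum_(1 <= l < L.+1) ((f (t l) + e)%:E * (\1_(cell l) v)%:E)))%E).
  apply: ge0_le_integral => //.
  - by move=> v _; rewrite lee_fin.
  - by apply/measurable_EFinP.
  - apply: emeasurable_sum => l; apply: emeasurable_funM => //.
    by apply/measurable_EFinP; apply: measurable_funTS; apply: measurable_indic; exact: measurable_itv.
  - move=> v /= v01; have [l [lL cl vl]] := cell_cover v01.
    have lr : l \in index_iota 1 L.+1 by rewrite mem_index_iota.
    rewrite (big_rem l)//= indicE mem_set ?mule1; last by rewrite /cell/= in_itv.
    apply: (@le_trans _ _ (f (t l) + e)%:E); first by rewrite lee_fin fe.
    by rewrite leeDl// sume_ge0// => i _; rewrite mule_ge0// lee_fin ?addr_ge0.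
rewrite ge0_integral_sum//; last 2 first.
- move=> l; apply: emeasurable_funM => //.
  by apply/measurable_EFinP; apply: measurable_funTS; apply: measurable_indic; exact: measurable_itv.
- by move=> l v _; rewrite mule_ge0// lee_fin ?addr_ge0.
apply: (@le_trans _ _ (\sum_(1 <= l < L.+1) (quad_weight L t l * (f (t l) + e))%:E)%E).
  rewrite big_nat_cond [leRHS]big_nat_cond; apply: lee_sum => l /andP[/andP[l0 lL] _].
  have lL' : (0 < l <= L)%N by rewrite l0.
  rewrite ge0_integralZl_EFin//; last 2 first.
  - by apply/measurable_EFinP; apply: measurable_funTS; apply: measurable_indic; exact: measurable_itv.
  - by rewrite addr_ge0.
  have mcell : measurable (cell l) by exact: measurable_itv.
  rewrite integral_indic//= [quad_weight _ _ _ * _]mulrC EFinM lee_wpmul2l ?lee_fin ?addr_ge0//.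
  apply: (@le_trans _ _ (mu (cell l))).
    by rewrite le_measure ?inE//; exact: measurableI.
  rewrite quad_weight_cell// /cell lebesgue_measure_itv/= lte_fin.
  case: ifP => // _; rewrite lee_fin subr_ge0.
  by have := @cell_end_mono l.-1; rewrite prednK//; apply.
rewrite sumEFin lee_fin; under eq_bigr do rewrite mulrDr.
by rewrite big_split/= -mulr_suml sum_quad_weight mul1r.
Qed.

End Quadrature.

Section LowerFubini.
Import HBNNSimple.
Context d1 d2 (T1 : measurableType d1) (T2 : measurableType d2) (R : realType).
Variables (P1 : probability T1 R) (P2 : probability T2 R).

(* The integral of a nonnegative function that need not be measurable is the
   supremum of the integrals of the simple functions below it. *)
Lemma lower_integral_le d (T : measurableType d) (P : {measure set T -> \bar R})
    (f : T -> \bar R) (c : \bar R) : (forall z, 0 <= f z)%E ->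
  (forall phi : {nnsfun T >-> R}, (forall z, (phi z)%:E <= f z)%E ->
     (\int[P]_z (phi z)%:E <= c)%E) ->
  (\int[P]_z f z <= c)%E.
Proof.
move=> f0 H; rewrite ge0_integralTE//; apply: ge_ereal_sup => _ [phi /= phif <-].
by rewrite -integralT_nnsfun; exact: H.
Qed.

Lemma integral_mono d (T : measurableType d) (P : {measure set T -> \bar R})
    (f g : T -> \bar R) : (forall z, 0 <= f z)%E -> (forall z, f z <= g z)%E ->
  (\int[P]_z f z <= \int[P]_z g z)%E.
Proof.
move=> f0 fg; have g0 z : (0 <= g z)%E by apply: le_trans (fg z).
apply: lower_integral_le => // phi phif.
rewrite (ge0_integralTE _ g0) integralT_nnsfun; apply: ereal_sup_ubound.
by exists phi => //= z; apply: le_trans (fg z).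
Qed.

(** Tonelli's theorem is available for each simple function below [F], and its sections lie below
    those of [F]; taking the supremum keeps the inequality. *)
Lemma lower_fubini (F : T1 * T2 -> \bar R) (psi : T1 -> \bar R) : (forall z, 0 <= F z)%E ->
  (forall w, \int[P2]_w' F (w, w') <= psi w)%E ->
  (\int[P1 \x P2]_z F z <= \int[P1]_w psi w)%E.
Proof.
move=> F0 H; rewrite ge0_integralTE//; apply: ge_ereal_sup => _ [phi /= phif <-].
rewrite -integralT_nnsfun fubini_tonelli1//=; last 2 first.
- by apply/measurable_EFinP.
- by move=> z; rewrite lee_fin.
apply: integral_mono => [w|w].
  by apply: integral_ge0 => w' _; rewrite lee_fin.
by apply: le_trans (H w); apply: integral_mono => w'; [rewrite lee_fin|exact: phif].
Qed.

End LowerFubini.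

Section ExpBounds.
Context {R : realType}.
Implicit Types (x y z : R).

(** Compare [expR] with its tangent at the weighted mean [m]. *)
Lemma expR_jensen (I : Type) (r : seq I) (p : pred I) (w z : I -> R) :
  (forall i, p i -> 0 <= w i) -> \sum_(i <- r | p i) w i = 1 ->
  expR (\sum_(i <- r | p i) w i * z i) <= \sum_(i <- r | p i) w i * expR (z i).
Proof.
move=> w0 w1; set m := \sum_(i <- r | p i) w i * z i.
have -> : expR m = \sum_(i <- r | p i) w i * (expR m * (1 + (z i - m))).
  under eq_bigr => i _ do rewrite mulrCA.
  rewrite -mulr_sumr; under eq_bigr do rewrite mulrDr mulrBr mulr1.
  by rewrite big_split/= sumrB -mulr_suml w1 -/m mul1r subrr addr0 mulr1.
apply: ler_sum => i pi; rewrite ler_wpM2l ?w0//.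
have -> : expR (z i) = expR m * expR (z i - m) by rewrite -expRD addrC subrK.
by rewrite ler_wpM2l ?expR_ge0// expR_ge1Dx.
Qed.

(** Multiply by [1 - y] and use [expR y <= 1 / (1 - y)]. *)
Lemma expR_le_quad y : y <= 2^-1 -> expR y <= 1 + y + 2 * y ^+ 2.
Proof.
move=> y2; have h := expR_ge1Dx (- y); have e0 := expR_gt0 y.
have d0 : 0 < 1 - y by lra.
have ey : expR y * (1 - y) <= 1.
  apply: (@le_trans _ _ (expR y * expR (- y))); first by rewrite ler_wpM2l// ltW.
  by rewrite -expRD subrr expR0.
rewrite -(ler_pM2r d0); apply: le_trans ey _.
have -> : (1 + y + 2 * y ^+ 2) * (1 - y) = 1 + y ^+ 2 * (1 - 2 * y) by ring.
by rewrite lerDl mulr_ge0 ?sqr_ge0//; lra.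
Qed.

(** A soft maximum, from [z <= expR z]: the right side no longer depends on [i], and a suitable [c]
    makes the sum small in mean. *)
Lemma le_expR_shift (K : finType) (a : K -> R) (c : R) (i : K) :
  a i <= c + \sum_j expR (a j - c).
Proof.
rewrite -lerBlDl; apply: (@le_trans _ _ (expR (a i - c))).
  by apply: le_trans (expR_ge1Dx _); rewrite lerDr.
by rewrite (bigD1 i)//= lerDl; apply: sumr_ge0 => j _; exact: expR_ge0.
Qed.

End ExpBounds.

(** * Measurability *)

Section Measurability.
Context {R : realType}.
Variables (sigma : R -> R) (k : R).
Hypothesis (sigma_k : forall x y, `|sigma x - sigma y| <= k * `|x - y|).

Lemma measurable_activation : measurable_fun setT sigma.
Proof.
apply: continuous_measurable_fun => x; apply/cvgrPdist_lt => e e0.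
have [kn|kp] := leP k 0.
  near=> y; apply: le_lt_trans (sigma_k _ _) _.
  by apply: le_lt_trans e0; rewrite mulr_le0_ge0.
have xy : \forall y \near x, `|x - y| < e / k by exact: nbhsx_ballx x _ (divr_gt0 e0 kp).
near=> y; apply: le_lt_trans (sigma_k _ _) _; rewrite mulrC -ltr_pdivlMr//.
by near: y.
Unshelve. all: by end_near.
Qed.

Lemma measurable_net_sum J (l : seq (unit_params (R := R) J)) s t : is_grid J s ->
  measurable_fun setT (fun z : paths => net_sum sigma l (z.1 \o s) t).
Proof.
move=> g; rewrite /net_sum; apply: measurable_sum => a.
apply: measurable_funM; last exact: measurable_cst.
apply: measurable_funM; first exact: measurable_cst.
apply: (measurableT_comp measurable_activation); apply: measurable_funD; last exact: measurable_cst.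
apply: measurable_sum => j; apply: measurable_funM; first exact: measurable_cst.
by apply: (measurable_coord1 (t := s j.+1)); apply: (is_grid_01 g); rewrite ltnS ltnW.
Qed.

Lemma measurable_truncation J (s : nat -> R) u : 0 <= u -> is_grid J s ->
  measurable_fun setT (fun z : paths => truncation (grid_set J s) u z.1).
Proof.
move=> u0 g; have -> : (fun z : paths => truncation (grid_set J s) u z.1) =
  (fun z : paths => \prod_(j <- index_enum 'I_J) \1_(`[- u, u]%classic) (z.1 (s j.+1)) : R).
  apply/funext => z; rewrite truncationE//.
  have [/forallP H|/forallPn[j H]] := boolP [forall j : 'I_J, `|z.1 (s j.+1)| <= u].
    rewrite big1// => j _; rewrite indicE mem_set//=; have := H j.
    by rewrite ler_norml in_itv.
  apply/esym; rewrite (bigD1 j)//= indicE memNset ?mul0r//=.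
  by rewrite in_itv/= -ler_norml; apply/negP.
have mI : measurable_fun setT (\1_(`[- u, u]%classic) : R -> R) by exact: measurable_indic.
apply: measurable_prod => j _; apply: (measurableT_comp mI).
by apply: (measurable_coord1 (t := s j.+1)); apply: (is_grid_01 g); rewrite ltnS ltnW.
Qed.

Lemma measurable_sieve B nu u b r J p q s G t : 0 <= u -> is_grid J s ->
  sieve sigma B nu u b r J p q s G -> measurable_fun setT (fun z : paths => G z.1 t).
Proof.
move=> u0 g [_ [c [theta [xi [w [zeta [-> _ _ _ _]]]]]]]; rewrite /network.
apply: measurable_funM; first exact: measurable_truncation.
apply: measurable_sum => l; apply: measurable_sum => i.
apply: measurable_funM; last exact: measurable_cst.
apply: measurable_funM; first exact: measurable_cst.
apply: (measurableT_comp measurable_activation); apply: measurable_funD; last exact: measurable_cst.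
apply: measurable_sum => j; apply: measurable_funM; first exact: measurable_cst.
by apply: (measurable_coord1 (t := s j.+1)); apply: (is_grid_01 g); rewrite ltnS ltnW.
Qed.

End Measurability.

Lemma near_infty_ge (f : nat -> nat) m : f n @[n --> \oo] --> \oo ->
  \forall n \near \oo, (m <= f n)%N.
Proof. by move=> H; exact: (H _ (nbhs_infty_ge m)). Qed.

Section OperatorMeasurability.
Context {R : realType}.

Lemma C01_uniform (x : R -> R) (e : R) : C01 x -> 0 < e ->
  exists2 d : R, 0 < d & forall s t, s \in `[0, 1] -> t \in `[0, 1] ->
    `|s - t| < d -> `|x s - x t| < e.
Proof.
move=> xc e0; have /compact_near_coveringP := @segment_compact R 0 1.
move=> /(_ R (0^'+) (fun d a => forall b, b \in `[0, 1] -> a \in `[0, 1] ->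
  `|a - b| < d -> `|x a - x b| < e) _) H.
have [] := H _.
  move=> a a01; have [d d0 xd] := C01_eps xc a01 (divr_gt0 e0 (ltr0n _ 2)).
  have d2 : 0 < d / 2 by rewrite divr_gt0.
  have na : \forall a' \near a, `|a - a'| < d / 2 by exact: nbhsx_ballx a _ d2.
  near=> a' d' => b b01 a'01 ab.
  have da : `|a' - a| < d / 2.
    by rewrite distrC; near: a'.
  have dd : d' < d / 2 by near: d'; apply: nbhs_right_lt.
  have -> : x a' - x b = (x a' - x a) - (x b - x a) by ring.
  apply: le_lt_trans (ler_normB _ _) _; rewrite [e]splitr.
  have dd2 : d / 2 < d by rewrite ltr_pdivrMr// mulr2n mulrDr mulr1 ltrDl.
  have xa : `|x a' - x a| < e / 2 by apply: xd => //; exact: lt_trans da dd2.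
  apply: ltrD => //; apply: xd => //.
  have -> : b - a = (b - a') + (a' - a) by ring.
  apply: le_lt_trans (ler_normD _ _) _; rewrite [d]splitr.
  by apply: ltrD => //; rewrite distrC; exact: lt_trans ab dd.
move=> d /= d0 xd; exists (d / 2); first by rewrite divr_gt0.
move=> s t s01 t01 st; apply: (xd (d / 2)) => //=; rewrite ?divr_gt0//.
by rewrite sub0r normrN gtr0_norm ?divr_gt0//; lra.
Unshelve. all: by end_near.
Qed.


Variables (sigma : R -> R) (k : R).
Hypothesis (sigma_k : forall x y, `|sigma x - sigma y| <= k * `|x - y|).
Variables (G0 : (R -> R) -> R -> R) (alpha nu C0 : R).
Hypotheses (sigma_TW : tauber_wiener sigma).
Hypotheses (G0c : forall x, C01 x -> C01 (G0 x)) (al0 : 0 < alpha) (C00 : 0 <= C0).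
Hypothesis hol : forall u, 1 <= u -> forall x1 x2 : R -> R,
    C01 x1 -> C01 x2 -> supnorm `[0, 1] x1 <= u -> supnorm `[0, 1] x2 <= u ->
    supnorm `[0, 1] (fun t => G0 x1 t - G0 x2 t) <=
      C0 * u `^ nu * supnorm `[0, 1] (fun t => x1 t - x2 t) `^ alpha.
Variables (J : nat -> nat) (s : nat -> nat -> R).
Hypotheses (s_grid : forall n, is_grid (J n) (s n)).
Hypotheses (J_infty : J n @[n --> \oo] --> \oo).
Hypotheses (s_spacing : spacing (J n) (s n) @[n --> \oo] --> (0 : R)).

Lemma operator_interp_cvg x t e : C01 x -> t \in `[0, 1] -> 0 < e ->
  \forall n \near \oo, `|G0 x t - G0 (interp (J n) (s n) (x \o s n)) t| <= e.
Proof.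
move=> xc t01 e0; pose u : R := 1 + supnorm `[0, 1] x.
have u1 : 1 <= u by rewrite lerDl supnorm_ge0.
have A0 : 0 <= C0 * u `^ nu by rewrite mulr_ge0// powR_ge0.
have A1 : 0 < C0 * u `^ nu + 1 by rewrite ltr_wpDl.
have [c c0 Hc] : exists2 c : R, 0 < c & C0 * u `^ nu * c `^ alpha <= e.
  exists ((e / (C0 * u `^ nu + 1)) `^ alpha^-1); first by rewrite powR_gt0// divr_gt0.
  rewrite -powRrM mulVf ?gt_eqF// powRr1; last exact: divr_ge0 (ltW e0) (ltW A1).
  by rewrite mulrA ler_pdivrMr// mulrC ler_pM2l// lerDl.
have [d d0 xd] := C01_uniform xc c0.
have Jn : \forall n \near \oo, (0 < J n)%N by exact: (near_infty_ge 1 J_infty).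
have sd : \forall n \near \oo, spacing (J n) (s n) < d.
  by apply: (cvgr_lt 0 s_spacing); exact: d0.
near=> n; have J0 : (0 < J n)%N by near: n.
have snd : spacing (J n) (s n) < d by near: n.
set y := interp _ _ _; have yc : C01 y by exact: C01_interp.
have grid01 j : (0 < j <= J n)%N -> s n j \in `[0, 1].
  by move=> /andP[_ jJ]; apply: (is_grid_01 (s_grid n)); rewrite ltnW.
have xle z : z \in `[0, 1] -> `|x z| <= u.
  by move=> z01; apply: le_trans (C01_supnorm xc z01) _; rewrite lerDr.
have u0 : 0 <= u by exact: le_trans u1.
have /(_ u1 x y) H := @hol u.
have Gc : C01 (fun t => G0 x t - G0 y t).
  by move=> z; apply: continuousB; [exact: G0c|exact: G0c].
apply: le_trans (C01_supnorm Gc t01) _.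
apply: le_trans (H _ _ _ _) _ => //.
- exact: supnorm_le.
- apply: supnorm_le => // z z01; apply: interp_norm_le => // j jJ.
  by apply: xle; exact: grid01.
apply: le_trans Hc; rewrite ler_wpM2l//; apply: ge0_ler_powR; rewrite ?nnegrE ?supnorm_ge0 ?(ltW al0) ?(ltW c0)//.
apply: supnorm_le => [|z z01]; first exact: ltW.
apply: interp_dist => // j jJ zj; apply/ltW/xd => //; first exact: grid01.
exact: le_lt_trans snd.
Unshelve. all: by end_near.
Qed.

Lemma measurable_operator : exists Gt : R -> (R -> R) -> R,
  (forall t, t \in `[0, 1] -> measurable_fun setT (fun z : paths => Gt t z.1)) /\
  forall x t, C01 x -> t \in `[0, 1] -> G0 x t = Gt t x.
Proof.
(* Box and accuracy both improve with [n]: every continuous path lies in the box from some [n]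
   on. *)
have H n : {l : seq (unit_params (R := R) (J n)) | (0 < J n)%N -> forall y t,
    box (J n) n.+1%:R y -> t \in `[0, 1] ->
    `|G0 (interp (J n) (s n) y) t - net_sum sigma l y t| <= n.+1%:R^-1}.
  apply/cid; have [J0|J0] := ltnP 0 (J n); last by exists nil.
  have u1 : (1 : R) <= n.+1%:R by rewrite ler1n.
  have [l Hl] := @operator_approx R sigma (J n) (s n) n.+1%:R G0 alpha nu C0 sigma_TW u1
    (s_grid n) J0 G0c al0 C00 hol n.+1%:R^-1 (ltac:(by rewrite invr_gt0 ltr0n)).
  by exists l => _ y t; exact: Hl.
pose net n (x : R -> R) t := net_sum sigma (sval (H n)) (x \o s n) t.
exists (fun t x => fine (limn_esup (fun n => (net n x t)%:E))); split.
  move=> t t01; apply: (measurableT_comp (f := fine)); first exact: fine_measurable.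
  apply: measurable_fun_limn_esup => n; apply/measurable_EFinP.
  exact: (measurable_net_sum sigma_k _ _ (s_grid n)).
move=> x t xc t01; have nx : (net n x t)%:E @[n --> \oo] --> (G0 x t)%:E.
  apply: cvg_EFin; first by near=> n.
  apply/cvgrPdist_le => e e0.
  have e2 : 0 < e / 2 by rewrite divr_gt0.
  have Jn : \forall n \near \oo, (0 < J n)%N by exact: (near_infty_ge 1 J_infty).
  have Hn := operator_interp_cvg xc t01 e2.
  have nu' : \forall n \near \oo, supnorm `[0, 1] x <= n.+1%:R.
    near=> n; apply: le_trans (_ : n%:R <= _); last by rewrite ler_nat.
    by near: n; exact: nbhs_infty_ger.
  have ne : \forall n \near \oo, n.+1%:R^-1 <= e / 2.
    near=> n; rewrite invf_ple ?posrE//; apply: le_trans (_ : n%:R <= _); last by rewrite ler_nat.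
    by near: n; exact: nbhs_infty_ger.
  near=> n; rewrite /=; have := svalP (H n); rewrite /net.
  have J0 : (0 < J n)%N by near: n.
  have Gn : `|G0 x t - G0 (interp (J n) (s n) (x \o s n)) t| <= e / 2 by near: n.
  move: Gn => /[swap] /(_ J0 (x \o s n) t).
  set a := net_sum _ _ _ _; set c := G0 (interp _ _ _) _ => ca Gn.
  have -> : G0 x t - a = (G0 x t - c) + (c - a) by ring.
  apply: le_trans (ler_normD _ _) _; rewrite [e]splitr; apply: lerD => //.
  apply: le_trans (ca _ t01) _; last by near: n.
  move=> j /andP[_ jJ]; apply: le_trans (C01_supnorm xc _) _; last by near: n.
  by apply: (is_grid_01 (s_grid n)); rewrite ltnW.
rewrite is_cvg_limn_esupE; last by apply/cvg_ex; eexists; exact: nx.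
by rewrite (cvg_lim _ nx).
Unshelve. all: by end_near.
Qed.

End OperatorMeasurability.

(** * Deviations *)

Section MeanBounds.
Context d (T : measurableType d) (R : realType) (P : probability T R).
Implicit Types (f g Z : T -> R).

Definition mean_le f (c : R) : Prop :=
  [/\ measurable_fun setT f, forall w, 0 <= f w & (\int[P]_w (f w)%:E <= c%:E)%E].

Lemma mean_le_cst c : 0 <= c -> mean_le (fun=> c) c.
Proof.
move=> c0; split=> //.
by rewrite integral_cst// [X in (_ * X)%E]probability_setT mule1.
Qed.

Lemma mean_leD f g a b : mean_le f a -> mean_le g b -> mean_le (fun w => f w + g w) (a + b).
Proof.
move=> [mf f0 fa] [mg g0 gb]; split; first exact: measurable_funD.
  by move=> w; rewrite addr_ge0.
under eq_integral do rewrite EFinD.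
rewrite ge0_integralD//; first by rewrite EFinD leeD.
- by move=> w _; rewrite lee_fin.
- exact/measurable_EFinP.
- by move=> w _; rewrite lee_fin.
- exact/measurable_EFinP.
Qed.

Lemma mean_leZ f a k : 0 <= k -> mean_le f a -> mean_le (fun w => k * f w) (k * a).
Proof.
move=> k0 [mf f0 fa]; split; first by apply: measurable_funM => //; exact: measurable_cst.
  by move=> w; rewrite mulr_ge0.
under eq_integral do rewrite EFinM.
rewrite ge0_integralZl//; last by move=> w _; rewrite lee_fin.
  by rewrite EFinM; apply: lee_wpmul2l; rewrite ?lee_fin.
exact/measurable_EFinP.
Qed.

Lemma mean_le_sum (I : Type) (r : seq I) (p : pred I) (f : I -> T -> R) (c : I -> R) :
  (forall i, p i -> mean_le (f i) (c i)) ->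
  mean_le (fun w => \sum_(i <- r | p i) f i w) (\sum_(i <- r | p i) c i).
Proof.
move=> fc; elim: r => [|i r IH].
  rewrite big_nil; rewrite (_ : (fun=> _) = fun=> 0); last by apply/funext => w; rewrite big_nil.
  exact: mean_le_cst.
rewrite big_cons; have [pi|pi] := boolP (p i).
  rewrite (_ : (fun=> _) = fun w => f i w + \sum_(j <- r | p j) f j w).
    by apply: mean_leD => //; exact: fc.
  by apply/funext => w; rewrite big_cons pi.
rewrite (_ : (fun=> _) = fun w => \sum_(j <- r | p j) f j w)//.
by apply/funext => w; rewrite big_cons (negbTE pi).
Qed.

Lemma mean_le_trans f a b : a <= b -> mean_le f a -> mean_le f b.
Proof. by move=> ab [mf f0 fa]; split=> //; apply: le_trans fa _; rewrite lee_fin. Qed.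

Lemma mean_le_mono f g a : measurable_fun setT f -> (forall w, 0 <= f w) ->
  (forall w, f w <= g w) -> mean_le g a -> mean_le f a.
Proof.
move=> mf f0 fg [_ _ ga]; split=> //; apply: le_trans ga.
by apply: integral_mono => w; rewrite lee_fin.
Qed.

(** The parameter of the law satisfies [s^2 <= 8 v], whence the constant 4. *)
Lemma gaussian_mgf_le Z (c v : R) : centered_gaussian P Z ->
  (\int[P]_w ((Z w - c) ^+ 2)%:E <= v%:E)%E ->
  forall l, mean_le (fun w => expR (l * Z w)) (expR (4 * l ^+ 2 * v)).
Proof.
move=> gZ Zv l; have [mZ _] := gZ; have [s [s0 mgf /(_ c) sc]] := centered_gaussian_mgf gZ.
split; last 2 first.
- by move=> w; exact: expR_ge0.
- rewrite mgf lee_fin ler_expR; have : s ^+ 2 / 8 <= v by rewrite -lee_fin (le_trans sc).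
  have : 0 <= l ^+ 2 by exact: sqr_ge0.
  by move=> *; nra.
by apply: measurableT_comp => //; apply: measurable_funM.
Qed.

Lemma gaussian_abs_le Z (c v : R) : centered_gaussian P Z ->
  (\int[P]_w ((Z w - c) ^+ 2)%:E <= v%:E)%E ->
  mean_le (fun w => `|Z w|) (2 * expR (4 * v)).
Proof.
move=> gZ Zv; have [mZ _] := gZ.
have := mean_leD (gaussian_mgf_le gZ Zv 1) (gaussian_mgf_le gZ Zv (-1)).
have -> : expR (4 * 1 ^+ 2 * v) + expR (4 * (- 1) ^+ 2 * v) = 2 * expR (4 * v).
  have -> : 4 * (-1) ^+ 2 * v = 4 * v by ring.
  by rewrite expr1n mulr1; ring.
move=> H; apply: (mean_le_mono _ _ _ H) => [||w].
- exact: measurableT_comp.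
- by move=> w; exact: normr_ge0.
rewrite mul1r mulN1r ler_norml; have := expR_ge1Dx (Z w); have := expR_ge1Dx (- Z w).
have := expR_ge0 (Z w); have := expR_ge0 (- Z w).
by move=> *; apply/andP; split; lra.
Qed.

(** [tau * (r - h)] never exceeds 1/2, so [expR_le_quad] applies; its linear term has mean 0 and its
    quadratic term is at most [2 tau^2 M^2]. *)
Lemma mgf_bounded (h : T -> R) (M r tau : R) : measurable_fun setT h ->
  (forall w, 0 <= h w <= M) -> 0 <= tau -> tau * M <= 2^-1 ->
  (\int[P]_w (h w)%:E = r%:E)%E ->
  mean_le (fun w => expR (tau * (r - h w))) (expR (2 * tau ^+ 2 * M ^+ 2)).
Proof.
move=> mh hM tau0 tauM hr.
have r0 : 0 <= r.
  rewrite -lee_fin -hr; apply: integral_ge0 => w _; rewrite lee_fin.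
  by case/andP: (hM w).
have rM : r <= M.
  rewrite -lee_fin -hr; have [//|_ _] := @mean_le_cst M.
    by case/andP: (hM point) => h0; exact: le_trans.
  apply: le_trans; apply: integral_mono => w; rewrite lee_fin; by case/andP: (hM w).
pose g : R := 1 + tau * r + 2 * tau ^+ 2 * M ^+ 2.
have mg : measurable_fun setT (fun w => tau * (r - h w)).
  apply: measurable_funM; first exact: measurable_cst.
  by apply: measurable_funB => //; exact: measurable_cst.
have mE : measurable_fun setT (fun w => expR (tau * (r - h w))) by exact: measurableT_comp.
split => //.
(* Moving [tau * h] to the left keeps both sides nonnegative, so that monotonicity suffices; its
   mean is cancelled against [tau * r] afterwards. *)
have key : (\int[P]_w (expR (tau * (r - h w)) + tau * h w)%:E <= g%:E)%E.
  have [|_ _] := @mean_le_cst g.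
    by have := mulr_ge0 tau0 r0; have := mulr_ge0 (sqr_ge0 tau) (sqr_ge0 M); rewrite /g; lra.
  apply: le_trans; apply: integral_mono => w; rewrite lee_fin; case/andP: (hM w) => h0 h1.
    by rewrite addr_ge0 ?expR_ge0 ?mulr_ge0.
  have y2 : tau * (r - h w) <= 2^-1.
    by apply: le_trans tauM; rewrite ler_wpM2l//; lra.
  have := expR_le_quad y2; rewrite /g.
  have : (r - h w) ^+ 2 <= M ^+ 2.
    rewrite -subr_ge0 subr_sqr mulr_ge0//; lra.
  have : 0 <= tau ^+ 2 by exact: sqr_ge0.
  rewrite exprMn; set A := (r - h w) ^+ 2; set B := tau ^+ 2; set C := M ^+ 2 => B0 AC.
  have : B * A <= B * C by rewrite ler_wpM2l.
  by move=> *; lra.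
move: key; under eq_integral do rewrite EFinD.
rewrite ge0_integralD//; first last.
- by apply/measurable_EFinP; apply: measurable_funM => //; exact: measurable_cst.
- by move=> w _; rewrite lee_fin mulr_ge0//; case/andP: (hM w).
- exact/measurable_EFinP.
under [X in (_ + X <= _)%E]eq_integral do rewrite EFinM.
rewrite ge0_integralZl//; first last.
- by move=> w _; rewrite lee_fin; case/andP: (hM w).
- exact/measurable_EFinP.
rewrite hr -EFinM /g => key.
have : (\int[P]_w (expR (tau * (r - h w)))%:E <= (1 + 2 * tau ^+ 2 * M ^+ 2)%:E)%E.
  rewrite -(leeD2rE (x := (tau * r)%:E))// -EFinD; apply: le_trans key _.
  by rewrite lee_fin; lra.
by move/le_trans; apply; rewrite lee_fin expR_ge1Dx.
Qed.

End MeanBounds.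

Section Deviations.
Context d (T : measurableType d) (R : realType) (P : probability T R).
Variables (X eps : R -> T -> R) (Xs epss : nat -> R -> T -> R).
Variables (G0 : (R -> R) -> R -> R) (Gt : R -> (R -> R) -> R) (M : R).
Hypotheses (gX : gaussian_process P X) (geps : gaussian_process P eps).
Hypothesis X_eps_indep : indep P <<s process_events X >> <<s process_events eps >>.
Hypothesis X_cont : forall w, C01 (X ^~ w).
Hypothesis Gt_meas : forall t, t \in `[0, 1] -> measurable_fun setT (fun z : paths => Gt t z.1).
Hypothesis GtE : forall x t, C01 x -> t \in `[0, 1] -> G0 x t = Gt t x.
Hypothesis eps_var : forall t, t \in `[0, 1] -> (\int[P]_w (eps t w ^+ 2)%:E <= M%:E)%E.
Hypothesis mXs : forall i, measurable_process (Xs i).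
Hypothesis mepss : forall i, measurable_process (epss i).
Hypothesis Xs_cont : forall i w, C01 (Xs i ^~ w).

Local Notation Y := (response G0 X eps).
Local Notation Ys := (fun i => response G0 (Xs i) (epss i)).

Lemma measurable_response Z eta : measurable_process Z -> measurable_process eta ->
  (forall w : T, C01 (Z ^~ w)) -> measurable_process (response G0 Z eta).
Proof.
move=> mZ meta Zc t t01; rewrite /response; apply: measurable_funD; last exact: meta.
rewrite (_ : (fun _ => _) = (fun w => Gt t (path_pair Z Z w).1)).
  exact: (measurableT_comp (Gt_meas t01) (measurable_path_pair mZ mZ)).
by apply/funext => w; rewrite GtE.
Qed.

Hypothesis XY_copies : forall i, same_law P (Xs i) (Ys i) X Y.
Hypothesis XY_indep : mutual_indep P (fun i : nat => <<s pair_events (Xs i) (Ys i) >>).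

Let mX : measurable_process X := gaussian_process_measurable gX.
Let meps : measurable_process eps := gaussian_process_measurable geps.
Let mY : measurable_process Y := measurable_response mX meps X_cont.
Let mYs i : measurable_process (Ys i) := measurable_response (mXs i) (mepss i) (@Xs_cont i).

Lemma mean_le_copy (f : paths -> R) c i : measurable_fun setT f -> (forall z, 0 <= f z) ->
  (\int[P]_w (f (path_pair X Y w))%:E <= c%:E)%E ->
  mean_le P (fun w => f (path_pair (Xs i) (Ys i) w)) c.
Proof.
move=> mf f0 fc; split=> //; first exact: (measurableT_comp mf (measurable_path_pair (mXs i) (mYs i))).
rewrite (same_law_integral (f := fun z => (f z)%:E) (mXs i) (mYs i) mX mY (XY_copies i))//.
exact/measurable_EFinP.
Qed.

Lemma mean_le_iid (f : paths -> R) c n tau : measurable_fun setT f ->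
  (\int[P]_w (expR (tau * f (path_pair X Y w)))%:E <= c%:E)%E ->
  mean_le P (fun w => expR (tau * \sum_(i < n) f (path_pair (Xs i) (Ys i) w))) (c ^+ n).
Proof.
move=> mf fc; split.
- apply: measurableT_comp => //; apply: measurable_funM => //; apply: measurable_sum => i.
  exact: (measurableT_comp mf (measurable_path_pair (mXs i) (mYs i))).
- by move=> w; exact: expR_ge0.
under eq_integral do rewrite mulr_sumr expR_sum.
have mE : measurable_fun setT (fun z : paths => expR (tau * f z)).
  by apply: measurableT_comp => //; exact: measurable_funM.
exact: (@iid_paths_prod_le R d T P Xs _ X Y _ n c mXs mYs mX mY XY_copies XY_indep mE
  (fun z => expR_ge0 _) fc).
Qed.

Lemma sample_dev (h : paths -> R) (r K tau : R) n : measurable_fun setT h ->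
  (forall z, 0 <= h z <= K) -> 0 <= tau -> tau * K <= 2^-1 ->
  (\int[P]_w (h (path_pair X Y w))%:E = r%:E)%E ->
  mean_le P (fun w => expR (tau * \sum_(i < n) (r - h (path_pair (Xs i) (Ys i) w))))
    (expR (2 * tau ^+ 2 * K ^+ 2) ^+ n).
Proof.
move=> mh hK tau0 tauK hr.
apply: (mean_le_iid (f := fun z => r - h z)); first exact: measurable_funB.
have mhX := measurableT_comp mh (measurable_path_pair mX mY).
by have [] := @mgf_bounded _ T R P (h \o path_pair X Y) K r tau mhX (fun w => hK _) tau0 tauK hr.
Qed.

Variables (L : nat) (v : nat -> R) (t : nat -> R).
Hypothesis v0 : forall l, (0 < l <= L)%N -> 0 <= v l.
Hypothesis v1 : \sum_(1 <= l < L.+1) v l = 1.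
Hypothesis t01 : forall l, (0 < l <= L)%N -> t l \in `[0, 1].

(** With the predictor frozen, Jensen's inequality over the quadrature weights reduces the sum to
    single locations. Any dependence of [eps] across locations is thus allowed, and only its
    pointwise variance enters. *)
Lemma noise_mgf (H : paths -> nat -> R) (K tau : R) :
  (forall l, (0 < l <= L)%N -> measurable_fun setT (fun z : paths => H z l)) ->
  (forall z l, (0 < l <= L)%N -> `|H z l| <= K) ->
  (\int[P]_w (expR (tau * \sum_(1 <= l < L.+1) v l * (eps (t l) w * H (path_pair X X w) l)))%:E
    <= (expR (4 * (tau * K) ^+ 2 * M))%:E)%E.
Proof.
move=> mH HK.
pose F := pair_events X X; pose G := pair_events eps eps.
have FG : indep P <<s F >> <<s G >> by rewrite /F /G /pair_events !setUid.
pose h (z : g_sigma_algebraType F * g_sigma_algebraType G) : \bar R :=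
  (expR (tau * \sum_(1 <= l < L.+1) v l * (eps (t l) z.2 * H (path_pair X X z.1) l)))%:E.
have mh : measurable_fun setT h.
  apply/measurable_EFinP; apply: measurableT_comp => //; apply: measurable_funM => //.
  rewrite (_ : (fun z => _) = (fun z : g_sigma_algebraType F * g_sigma_algebraType G =>
    \sum_(l <- index_iota 1 L.+1) (if (0 < l <= L)%N then v l * (eps (t l) z.2 * H (path_pair X X z.1) l) else 0))); last first.
    by apply/funext => z; apply: eq_big_nat => l; rewrite ltnS => ->.
  apply: measurable_sum => l; case: (boolP (0 < l <= L)%N) => // lL.
  apply: measurable_funM => //; apply: measurable_funM.
    have m2 := measurable_path_pair_events (X := eps) (Y := eps).
    have m3 := measurableT_comp (measurable_coord1 (t01 lL)) m2.
    exact: (measurableT_comp m3 measurable_snd).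
  have m2 := measurable_path_pair_events (X := X) (Y := X).
  have m3 := measurableT_comp (mH l lL) m2.
  exact: (measurableT_comp m3 measurable_fst).
rewrite (indep_fubini (h := h) (pair_events_measurable mX mX) (pair_events_measurable meps meps) FG)//; last first.
  by move=> z; rewrite lee_fin expR_ge0.
have [//|_ _] := @mean_le_cst _ T R P (expR (4 * (tau * K) ^+ 2 * M)).
apply: le_trans; apply: integral_mono => w.
  by apply: integral_ge0 => w' _; rewrite lee_fin expR_ge0.
rewrite /h /=; set a := fun l => tau * H (path_pair X X w) l.
have aM l : (0 < l <= L)%N -> mean_le P (fun w' => expR (a l * eps (t l) w')) (expR (4 * (tau * K) ^+ 2 * M)).
  move=> lL; have := eps_var (t01 lL); under eq_integral do rewrite -[X in X ^+ 2](subr0 (eps (t l) _)).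
  move=> ev; have M0 : 0 <= M.
    by rewrite -lee_fin; apply: le_trans ev; apply: integral_ge0 => w' _; rewrite lee_fin sqr_ge0.
  apply: mean_le_trans (gaussian_mgf_le (gaussian_process_coord geps (t01 lL)) ev (a l)).
  rewrite ler_expR ler_wpM2r// ler_wpM2l// /a !exprMn ler_wpM2l ?sqr_ge0//.
  have K0 : 0 <= K by apply: le_trans (HK (path_pair X X w) l lL).
  have := HK (path_pair X X w) l lL; rewrite ler_norml => /andP[hl hu].
  by rewrite -subr_ge0 subr_sqr mulr_ge0//; lra.
have := @mean_le_sum _ T R P nat (index_iota 1 L.+1) (fun l => (0 < l <= L)%N)
  (fun l w' => v l * expR (a l * eps (t l) w')) (fun l => v l * expR (4 * (tau * K) ^+ 2 * M)).
have vE (g : nat -> R) : \sum_(l <- index_iota 1 L.+1 | (0 < l <= L)%N) g l = \sum_(1 <= l < L.+1) g l.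
  by rewrite big_nat_cond [RHS]big_nat_cond; apply: eq_bigl => l; rewrite ltnS andbb andbT.
move=> /(_ (fun l lL => mean_leZ (v0 lL) (aM l lL))) [_ _].
rewrite vE -mulr_suml v1 mul1r; apply: le_trans.
apply: integral_mono => w'; rewrite lee_fin; first exact: expR_ge0.
rewrite vE; have -> : tau * (\sum_(1 <= l < L.+1) v l * (eps (t l) w' * H (path_pair X X w) l)) =
  \sum_(l <- index_iota 1 L.+1 | (0 < l <= L)%N) v l * (a l * eps (t l) w').
  by rewrite vE mulr_sumr; apply: eq_bigr => l _; rewrite /a; ring.
rewrite -vE; apply: expR_jensen; first by move=> l; exact: v0.
by rewrite vE.
Qed.

(** Only the joint law of predictor and response is copied, so the noise is written as
    [z.2 - Gt z.1], a function of the observed pair. Its exponential moment is then computed for the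
    population pair, where predictor and noise are independent. *)
Lemma noise_dev (H : paths -> nat -> R) (K tau : R) n :
  (forall l, (0 < l <= L)%N -> measurable_fun setT (fun z : paths => H z l)) ->
  (forall z l, (0 < l <= L)%N -> `|H z l| <= K) ->
  (forall x y y' l, H (x, y) l = H (x, y') l) ->
  mean_le P (fun w => expR (tau * \sum_(i < n) \sum_(1 <= l < L.+1)
      v l * (epss i (t l) w * H (path_pair (Xs i) (Ys i) w) l)))
    (expR (4 * (tau * K) ^+ 2 * M) ^+ n).
Proof.
move=> mH HK Hy.
pose f (z : paths) : R := \sum_(1 <= l < L.+1) v l * ((z.2 (t l) - Gt (t l) z.1) * H z l).
have fE Z eta : (forall w : T, C01 (Z ^~ w)) -> forall w, f (path_pair Z (response G0 Z eta) w) =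
  \sum_(1 <= l < L.+1) v l * (eta (t l) w * H (path_pair Z (response G0 Z eta) w) l).
  move=> Zc w; apply: eq_big_nat => l lL; congr (_ * (_ * _)).
  by rewrite /= /response -GtE ?t01// addrC addKr.
have mf : measurable_fun setT f.
  rewrite (_ : f = (fun z : paths =>
    \sum_(l <- index_iota 1 L.+1) (if (0 < l <= L)%N then v l * ((z.2 (t l) - Gt (t l) z.1) * H z l) else 0))); last first.
    by apply/funext => z; apply: eq_big_nat => l; rewrite ltnS => ->.
  apply: measurable_sum => l; case: (boolP (0 < l <= L)%N) => // lL.
  apply: measurable_funM => //; apply: measurable_funM; last exact: mH.
  by apply: measurable_funB; [exact: measurable_coord2 (t01 lL)|exact: Gt_meas (t01 lL)].
rewrite (_ : (fun w => _) = (fun w => expR (tau * \sum_(i < n) f (path_pair (Xs i) (Ys i) w)))); last first.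
  by apply/funext => w; congr (expR (_ * _)); apply: eq_bigr => i _; rewrite fE.
apply: mean_le_iid => //.
apply: le_trans (@noise_mgf H K tau mH HK); apply: integral_mono => w; first by rewrite lee_fin expR_ge0.
rewrite lee_fin ler_expR fE// le_eqVlt; apply/orP; left; apply/eqP; congr (_ * _).
by apply: eq_bigr => l _; congr (_ * (_ * _)); exact: Hy.
Qed.

Variables (n : nat) (e : nat -> nat -> T -> R) (se : R).
Hypothesis v_le1 : forall l, (0 < l <= L)%N -> v l <= 1.
Hypothesis e_gauss : forall i l, (i < n)%N -> (1 <= l <= L)%N ->
  centered_gaussian P (e i l) /\ ('V_P[e i l] <= (se ^+ 2)%:E)%E.
Hypothesis e_indep : mutual_indep P (fun il : 'I_n * 'I_L => events (e il.1 il.2.+1)).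
Hypothesis e_XY_indep : indep P
  <<s \bigcup_(i in [set i | (i < n)%N]) pair_events (Xs i) (Ys i) >>
  <<s \bigcup_(i in [set i | (i < n)%N])
      \bigcup_(l in [set l | (1 <= l <= L)%N]) events (e i l) >>.

Lemma error_var i l : (i < n)%N -> (1 <= l <= L)%N ->
  exists c, (\int[P]_w ((e i l w - c) ^+ 2)%:E <= (se ^+ 2)%:E)%E.
Proof.
move=> iN lL; have [_] := e_gauss iN lL; rewrite /variance unlock unlock => ev.
by exists (fine 'E_P[e i l]); under eq_integral do rewrite expr2; rewrite unlock.
Qed.

Lemma error_mgf (a : 'I_n -> 'I_L -> R) :
  (\int[P]_w (expR (\sum_(i < n) \sum_(l < L) a i l * e i l.+1 w))%:E <=
   (expR (\sum_(i < n) \sum_(l < L) 4 * a i l ^+ 2 * se ^+ 2))%:E)%E.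
Proof.
pose D := index_enum ('I_n * 'I_L)%type.
have bound k : mean_le P (fun w => expR (a k.1 k.2 * e k.1 k.2.+1 w))
    (expR (4 * a k.1 k.2 ^+ 2 * se ^+ 2)).
  have [c ev] := @error_var k.1 k.2.+1 (ltn_ord _) (ltn_ord _).
  have [gk _] := @e_gauss k.1 k.2.+1 (ltn_ord _) (ltn_ord _).
  exact: gaussian_mgf_le ev _.
have eD w : expR (\sum_(i < n) \sum_(l < L) a i l * e i l.+1 w) =
    \prod_(k <- D) expR (a k.1 k.2 * e k.1 k.2.+1 w).
  by rewrite pair_big/= expR_sum.
under eq_integral do rewrite eD.
have Em (k : 'I_n * 'I_L) : events (e k.1 k.2.+1) `<=` (measurable : set (set T)).
  have [[mk _] _] := @e_gauss k.1 k.2.+1 (ltn_ord k.1) (ltn_ord k.2).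
  by move=> _ [B mB <-]; exact: mk.
have Es (k : 'I_n * 'I_L) : sigma_algebra setT (events (e k.1 k.2.+1)).
  exact: sigma_algebra_preimage (sigma_algebra_measurable R).
rewrite (@mutual_indep_prod _ T R P _ (fun k : 'I_n * 'I_L => events (e k.1 k.2.+1)) Em Es e_indep)//; last first.
- move=> k A _ mA; have mg : measurable_fun setT (fun z : R => expR (a k.1 k.2 * z)).
    by apply: measurableT_comp => //; exact: measurable_funM.
  exists ((fun z => expR (a k.1 k.2 * z)) @^-1` A); last by rewrite setTI.
  by have := mg measurableT A mA; rewrite setTI.
- exact: index_enum_uniq.
rewrite pair_big/= expR_sum.
suff [c [-> c0]] : exists c, (\prod_(k <- D) \int[P]_w (expR (a k.1 k.2 * e k.1 k.2.+1 w))%:E)%E = c%:E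
    /\ 0 <= c <= \prod_(k <- D) expR (4 * a k.1 k.2 ^+ 2 * se ^+ 2).
  by rewrite lee_fin; case/andP: c0.
elim: D {eD} => [|k D [c [cE /andP[c0 cD]]]]; first by exists 1; rewrite !big_nil lexx ler01.
rewrite !big_cons cE; have [_ _ bk] := bound k.
have i0 : (0 <= \int[P]_w (expR (a k.1 k.2 * e k.1 k.2.+1 w))%:E)%E.
  by apply: integral_ge0 => w _; rewrite lee_fin expR_ge0.
have fk : (\int[P]_w (expR (a k.1 k.2 * e k.1 k.2.+1 w))%:E \is a fin_num)%E.
  by rewrite ge0_fin_numE// (le_lt_trans bk)// ltry.
rewrite -(fineK fk) -EFinM; eexists; split; first by [].
have f0 : 0 <= fine (\int[P]_w (expR (a k.1 k.2 * e k.1 k.2.+1 w))%:E) by exact: fine_ge0.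
rewrite mulr_ge0//= ler_pM//.
by rewrite -lee_fin fineK.
Qed.

(** With the sample of pairs frozen, the errors are independent over observations and locations, so
    the squared weights add up; [v l ^+ 2 <= v l] makes their sum over the locations at most 1. *)
Lemma error_dev (H : paths -> nat -> R) (K tau : R) :
  (forall l, (0 < l <= L)%N -> measurable_fun setT (fun z : paths => H z l)) ->
  (forall z l, (0 < l <= L)%N -> `|H z l| <= K) ->
  mean_le P (fun w => expR (tau * \sum_(i < n) \sum_(1 <= l < L.+1)
      v l * (e i l w * H (path_pair (Xs i) (Ys i) w) l)))
    (expR (4 * (tau * K) ^+ 2 * se ^+ 2) ^+ n).
Proof.
move=> mH HK.
pose F := \bigcup_(i in [set i | (i < n)%N]) pair_events (Xs i) (Ys i).
pose G := \bigcup_(i in [set i | (i < n)%N])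
      \bigcup_(l in [set l | (1 <= l <= L)%N]) events (e i l).
have Fm : F `<=` (measurable : set (set T)).
  by move=> A [i _]; exact: pair_events_measurable (mXs i) (mYs i) A.
have Gm : G `<=` (measurable : set (set T)).
  move=> A [i iN [l lL [B mB <-]]]; have [[me _] _] := e_gauss iN lL.
  exact: me.
pose g (z : g_sigma_algebraType F * g_sigma_algebraType G) : R :=
  tau * \sum_(i < n) \sum_(l < L) v l.+1 * (e i l.+1 z.2 * H (path_pair (Xs i) (Ys i) z.1) l.+1).
have mg : measurable_fun setT g.
  apply: measurable_funM => //; apply: measurable_sum => i; apply: measurable_sum => l.
  apply: measurable_funM => //; apply: measurable_funM.
    apply: (measurableT_comp (f := e i l.+1 : g_sigma_algebraType G -> R)); last exact: measurable_snd.
    move=> _ B mB; rewrite setTI; apply: sub_sigma_algebra.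
    exists (val i) => /=; first exact: ltn_ord.
    by exists l.+1 => /=; [exact: (ltn_ord l)|exists B => //; rewrite setTI].
  have m2 : measurable_fun setT (path_pair (Xs i) (Ys i) : g_sigma_algebraType F -> paths).
    apply: (measurable_fun_sub (T := g_sigma_algebraType F)
      (G := pair_events (Xs i) (Ys i))); last exact: measurable_path_pair_events.
    by move=> A iA; apply: sub_sigma_algebra; exists (val i) => /=; [exact: ltn_ord|].
  have m3 := measurableT_comp (mH l.+1 (ltn_ord l)) m2.
  exact: (measurableT_comp m3 measurable_fst).
have gE w : tau * \sum_(i < n) \sum_(1 <= l < L.+1)
      v l * (e i l w * H (path_pair (Xs i) (Ys i) w) l) = g (w, w).
  by congr (_ * _); apply: eq_bigr => i _; rewrite big_add1 big_mkord.
rewrite (_ : (fun w => _) = (fun w => expR (g (w, w)))); last by apply/funext => w; rewrite gE.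
have mgd : measurable_fun setT (fun w : T => g (w, w)).
  apply: (measurableT_comp mg); apply/measurable_fun_pairP; split => /=.
    exact: (measurable_id_sub Fm).
  exact: (measurable_id_sub Gm).
split; first exact: measurableT_comp.
  by move=> w; exact: expR_ge0.
have mh : measurable_fun setT (fun z => (expR (g z))%:E).
  by apply/measurable_EFinP; exact: measurableT_comp.
rewrite (indep_fubini (h := fun z => (expR (g z))%:E) Fm Gm e_XY_indep mh); last first.
  by move=> z; rewrite lee_fin expR_ge0.
have [|_ _] := @mean_le_cst _ T R P (expR (4 * (tau * K) ^+ 2 * se ^+ 2) ^+ n).
  by rewrite exprn_ge0// expR_ge0.
apply: le_trans; apply: integral_mono => w.
  by apply: integral_ge0 => w' _; rewrite lee_fin expR_ge0.
pose a (i : 'I_n) (l : 'I_L) := tau * v l.+1 * H (path_pair (Xs i) (Ys i) w) l.+1.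
have ge w' : g (w, w') = \sum_(i < n) \sum_(l < L) a i l * e i l.+1 w'.
  rewrite /g mulr_sumr; apply: eq_bigr => i _; rewrite mulr_sumr; apply: eq_bigr => l _.
  by rewrite /a /=; ring.
under eq_integral do rewrite ge.
apply: le_trans (error_mgf a) _; rewrite lee_fin -expRM_natl ler_expR.
rewrite -[n in n%:R * _]card_ord -sum1_card natr_sum mulr_suml; apply: ler_sum => i _.
rewrite mul1r; set C := 4 * (tau * K) ^+ 2 * se ^+ 2.
have -> : C = \sum_(l < L) v l.+1 * C.
  by rewrite -mulr_suml; move: v1; rewrite big_add1 big_mkord => ->; rewrite mul1r.
apply: ler_sum => l _.
have lL : (0 < l.+1 <= L)%N by exact: (ltn_ord l).
have v2 : v l.+1 ^+ 2 <= v l.+1 by rewrite expr2 ler_piMl ?v0 ?v_le1.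
have H2 : H (path_pair (Xs i) (Ys i) w) l.+1 ^+ 2 <= K ^+ 2.
  have := HK (path_pair (Xs i) (Ys i) w) _ lL; rewrite ler_norml => /andP[hl hu].
  by rewrite -subr_ge0 subr_sqr mulr_ge0//; lra.
rewrite /C /a !exprMn; set h2 := _ ^+ 2 in H2 *; set vv := v _ ^+ 2 in v2 *.
have -> : 4 * (tau ^+ 2 * vv * h2) * se ^+ 2 = (4 * tau ^+ 2 * se ^+ 2) * (vv * h2) by ring.
have -> : v l.+1 * (4 * (tau ^+ 2 * K ^+ 2) * se ^+ 2) = (4 * tau ^+ 2 * se ^+ 2) * (v l.+1 * K ^+ 2) by ring.
apply: ler_wpM2l; first exact: mulr_ge0 (mulr_ge0 (ler0n _ 4) (sqr_ge0 _)) (sqr_ge0 _).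
by apply: ler_pM => //; exact: sqr_ge0.
Qed.

End Deviations.

(** * Oracle inequality *)

Section BasicInequality.
Context {R : realType}.

(* With a = gh - gs, c = y - g and d = gs - g, the difference of the two squares is
   a^2 - 2 a (c - d) >= a^2 / 2 - 2 a c - 2 d^2. *)
Lemma oracle_term (V y g gs gh gk delta : R) : V = 0 \/ V = 1 ->
  (V = 0 -> gs = 0 /\ gh = 0 /\ gk = 0) -> `|gh - gk| <= delta ->
  (gk - gs) ^+ 2 <= 8 * ((y - g) * (gk - gs)) + 8 * (V * (gs - g) ^+ 2)
    + 8 * (delta * `|y - g|) + 2 * delta ^+ 2
    + 4 * (V * (y - gh) ^+ 2 - V * (y - gs) ^+ 2).
Proof.
move=> V01 Vz gd; have d0 : 0 <= delta by apply: le_trans gd.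
case: V01 => HV; rewrite HV in Vz *.
  have [-> [-> ->]] := Vz erefl; rewrite !subrr !mul0r !mulr0 expr0n/= addr0 !add0r.
  by rewrite addr_ge0 ?mulr_ge0 ?sqr_ge0.
have h1 : (gh - gk) * (y - g) <= delta * `|y - g|.
  by apply: le_trans (ler_norm _) _; rewrite normrM ler_wpM2r.
have h2 : (gh - gk) ^+ 2 <= delta ^+ 2.
  by move: gd; rewrite ler_norml => /andP[? ?]; rewrite -subr_ge0 subr_sqr mulr_ge0//; lra.
rewrite !mul1r; have := sqr_ge0 (gh - gs - 2 * (gs - g)); have := sqr_ge0 (gh - gs - (gk - gh)).
have := sqr_ge0 (gh - gs + 2 * (gs - g)); have := sqr_ge0 (gh - gs + (gk - gh)).
by move: h1 h2; set P1 := delta * _; set P2 := delta ^+ 2; nra.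
Qed.

(** Write [n r] as the centered sum plus the empirical loss of the net center, and bound the latter
    termwise by [oracle_term], whose last term is nonpositive in total by minimality. Exchanging
    [gh] for [gk] costs [delta] times the noise. *)
Lemma sample_oracle (n L : nat) (v V : nat -> R) (y g gs gh gk : nat -> nat -> R) (r delta : R) :
  (forall l, (0 < l < L.+1)%N -> 0 <= v l) -> \sum_(1 <= l < L.+1) v l = 1 ->
  (forall i, V i = 0 \/ V i = 1) ->
  (forall i l, V i = 0 -> gs i l = 0 /\ gh i l = 0 /\ gk i l = 0) ->
  (forall i l, (0 < l < L.+1)%N -> `|gh i l - gk i l| <= delta) ->
  \sum_(i < n) V i * \sum_(1 <= l < L.+1) v l * (y i l - gh i l) ^+ 2 <=
    \sum_(i < n) V i * \sum_(1 <= l < L.+1) v l * (y i l - gs i l) ^+ 2 ->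
  n%:R * r <= \sum_(i < n) (r - \sum_(1 <= l < L.+1) v l * (gk i l - gs i l) ^+ 2)
    + 8 * \sum_(i < n) \sum_(1 <= l < L.+1) v l * ((y i l - g i l) * (gk i l - gs i l))
    + 8 * \sum_(i < n) V i * \sum_(1 <= l < L.+1) v l * (gs i l - g i l) ^+ 2
    + 8 * (delta * \sum_(i < n) \sum_(1 <= l < L.+1) v l * `|y i l - g i l|)
    + 2 * delta ^+ 2 * n%:R.
Proof.
move=> v0 v1 V01 Vz gd basic.
rewrite sumrB sumr_const card_ord -[r *+ n]mulr_natl.
rewrite -!addrA lerDl addrC subr_ge0 !addrA.
have n1 : n%:R = \sum_(i < n) \sum_(1 <= l < L.+1) v l.
  by under eq_bigr do rewrite v1; rewrite sumr_const card_ord.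
apply: (@le_trans _ _ (8 * (\sum_(i < n) \sum_(1 <= l < L.+1) v l * ((y i l - g i l) * (gk i l - gs i l)))
    + 8 * (\sum_(i < n) V i * \sum_(1 <= l < L.+1) v l * (gs i l - g i l) ^+ 2)
    + 8 * (delta * \sum_(i < n) \sum_(1 <= l < L.+1) v l * `|y i l - g i l|)
    + 2 * delta ^+ 2 * n%:R
    + 4 * (\sum_(i < n) V i * (\sum_(1 <= l < L.+1) v l * (y i l - gh i l) ^+ 2)
      - \sum_(i < n) V i * \sum_(1 <= l < L.+1) v l * (y i l - gs i l) ^+ 2))); last first.
  by rewrite gerDl pmulr_rle0// subr_le0.
rewrite n1 -sumrB !mulr_sumr -!big_split/=; apply: ler_sum => i _.
rewrite -mulrBr -sumrB !mulr_sumr -!big_split/= big_nat_cond [leRHS]big_nat_cond.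
apply: ler_sum => l; rewrite andbT => lL.
have := oracle_term (y i l) (g i l) (V01 i) (Vz i l) (gd i l lL).
move=> /(ler_wpM2l (v0 l lL)) /le_trans; apply; rewrite le_eqVlt; apply/orP; left; apply/eqP.
ring.
Qed.

End BasicInequality.

Section PredictionLoss.
Context {R : realType}.
Variables (L : nat) (t : nat -> R).
Hypotheses (g : is_grid L t) (L2 : (1 < L)%N).

Lemma C01_measurable (f : R -> R) : C01 f -> measurable_fun (`[0, 1]%classic : set R) f.
Proof. by move=> fc; apply: subspace_continuous_measurable_fun. Qed.

Lemma lipschitz_C01 (f : R -> R) (k : R) :
  (forall s s', s \in `[0, 1] -> s' \in `[0, 1] -> `|f s - f s'| <= k * `|s - s'|) -> C01 f.
Proof.
move=> fk; apply/subspace_continuousP => t0 t01; apply/cvgrPdist_lt => e e0.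
have k1 : 0 < `|k| + 1 by rewrite ltr_wpDl.
rewrite near_withinE; apply/nbhs_ballP; exists (e / (`|k| + 1)) => /=; first exact: divr_gt0.
move=> s; rewrite /ball/= ltr_pdivlMr// => st s01; apply: le_lt_trans st.
apply: le_trans (fk _ _ t01 s01) _; rewrite mulrC ler_wpM2l//.
by apply: le_trans (ler_norm _) _; rewrite lerDl.
Qed.

(** Quadrature acts on the square of [f], a Lipschitz difference of networks; [h], which involves
    the operator, is only dominated pointwise. The factor 4 is the 2 of the domination times that of
    the Lipschitz constant [2 A k] of [f ^+ 2]. *)
Lemma prediction_loss_le (f h : R -> R) (k A c : R) : 0 <= k -> 0 <= A -> 0 <= c ->
  (forall s s', s \in `[0, 1] -> s' \in `[0, 1] -> `|f s - f s'| <= k * `|s - s'|) ->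
  (forall s, s \in `[0, 1] -> `|f s| <= A) ->
  (forall s, s \in `[0, 1] -> h s ^+ 2 <= 2 * f s ^+ 2 + c) ->
  (L2norm_sq h <= (2 * (\sum_(1 <= l < L.+1) quad_weight L t l * f (t l) ^+ 2) + c
    + 4 * k * A * spacing L t)%:E)%E.
Proof.
move=> k0 A0 c0 fk fA hf.
have fc := lipschitz_C01 fk.
pose f2 s := 2 * f s ^+ 2 + c.
have f20 s : 0 <= f2 s by rewrite addr_ge0// mulr_ge0// sqr_ge0.
apply: (@le_trans _ _ (\int[lebesgue_measure]_(s in `[0%R, 1%R]) (f2 s)%:E)%E).
  rewrite /L2norm_sq integral_mkcond [leRHS]integral_mkcond; apply: integral_mono => s.
    by rewrite patchE; case: ifPn => // _; rewrite lee_fin sqr_ge0.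
  rewrite !patchE; case: ifPn => // s01; rewrite lee_fin; apply: hf.
  by move: s01; rewrite inE.
have e0 : 0 <= 4 * k * A * spacing L t.
  have [t0 t1 tS] := g; rewrite !mulr_ge0//.
  by apply: le_trans (spacing_ge t (leq0n L)); rewrite subr_ge0 ltW// tS.
apply: le_trans (quadrature_le g L2 e0 f20 _ _) _.
- apply: measurable_funD => //; apply: measurable_funM => //; apply: measurable_funX.
  exact: C01_measurable.
- move=> l s lL s01 sl; have tl : t l \in `[0, 1] by apply: (is_grid_01 g); case/andP: lL => _ /leqW.
  have kd : `|f s - f (t l)| <= k * spacing L t.
    by apply: le_trans (fk _ _ s01 tl) _; rewrite ler_wpM2l.
  have fd : `|f s + f (t l)| <= 2 * A.
    by apply: le_trans (ler_normD _ _) _; rewrite mulr2n mulrDl mul1r lerD// fA.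
  have : f s ^+ 2 - f (t l) ^+ 2 <= (k * spacing L t) * (2 * A).
    by rewrite subr_sqr; apply: le_trans (ler_norm _) _; rewrite normrM ler_pM.
  by rewrite /f2; lra.
rewrite lee_fin lerD2r /f2; under eq_bigr do rewrite mulrDr.
rewrite big_split/= -mulr_suml sum_quad_weight// mul1r lerD2r mulr_sumr.
by rewrite le_eqVlt; apply/orP; left; apply/eqP; apply: eq_bigr => l _; ring.
Qed.

End PredictionLoss.

Section MeanTools.
Context d (T : measurableType d) (R : realType) (P : probability T R).

(** After the shift each exponential has mean at most the inverse of the number of codes. *)
Lemma union_dev (K : finType) (dev : K -> T -> R) (x tau : R) n : (0 < #|K|)%N ->
  (forall a, mean_le P (fun w => expR (tau * dev a w)) (expR x ^+ n)) ->
  mean_le P (fun w => \sum_a expR (tau * dev a w - (ln #|K|%:R + n%:R * x))) 1.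
Proof.
move=> K0 H; have K1 : 0 < #|K|%:R :> R by rewrite ltr0n.
have E : \sum_(a : K) (#|K|%:R^-1 : R) = 1.
  by rewrite sumr_const -[LHS]mulr_natr mulVf// gt_eqF.
rewrite -[X in mean_le _ _ X]E.
apply: mean_le_sum => a _.
have -> : (#|K|%:R^-1 : R) = expR (- (ln #|K|%:R + n%:R * x)) * expR x ^+ n.
  by rewrite -expRM_natl -expRD opprD addrNK expRN lnK.
rewrite (_ : (fun w => _) = fun w => expR (- (ln #|K|%:R + n%:R * x)) * expR (tau * dev a w)).
  by apply: mean_leZ; [exact: expR_ge0|exact: H].
by apply/funext => w; rewrite -expRD addrC.
Qed.

(** Where [Q] is infinite the right side is [+oo] because [A] is positive, so a bound on [g] is
    required only where [Q] is finite. *)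
Lemma affine_moment_le (f : T -> R) (g Q : T -> \bar R) (F A C : R) : mean_le P f F ->
  0 < A -> measurable_fun setT Q -> (forall w, 0 <= Q w)%E -> (\int[P]_w Q w <= C%:E)%E ->
  (forall w, 0 <= g w)%E ->
  (forall w q, (Q w <= q%:E)%E -> (g w <= (f w + A * q)%:E)%E) ->
  (\int[P]_w g w <= (F + A * C)%:E)%E.
Proof.
move=> [mf f0 fF] A0 mQ Q0 QC g0 gle.
apply: (@le_trans _ _ (\int[P]_w ((f w)%:E + A%:E * Q w))%E).
  apply: integral_mono => // w; have := gle w; have := Q0 w.
  case: (Q w) => [q| |] // _; first by move=> /(_ q (lexx _)); rewrite EFinD EFinM.
  by rewrite gt0_muley ?lte_fin// addey ?leey.
rewrite ge0_integralD//.
- have -> : (\int[P]_w (A%:E * Q w) = A%:E * \int[P]_w Q w)%E.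
    by apply: ge0_integralZl_EFin => //; exact: ltW.
  by rewrite EFinD; apply: leeD => //; rewrite EFinM; apply: lee_wpmul2l => //; rewrite lee_fin ltW.
- by move=> w _; rewrite lee_fin.
- exact/measurable_EFinP.
- by move=> w _; rewrite mule_ge0// lee_fin ltW.
- by apply: emeasurable_funM => //; exact: measurable_cst.
Qed.

End MeanTools.

Section OracleInequality.
Context {R : realType} d (T : measurableType d) (P : probability T R).
Variables (sigma : R -> R) (k : R).
Hypotheses (k0 : 0 <= k) (sigma_k : forall x y, `|sigma x - sigma y| <= k * `|x - y|).
Variables (X eps : R -> T -> R) (Xs epss : nat -> R -> T -> R).
Variables (G0 : (R -> R) -> R -> R) (Gt : R -> (R -> R) -> R) (M : R).
Hypotheses (gX : gaussian_process P X) (geps : gaussian_process P eps).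
Hypothesis X_eps_indep : indep P <<s process_events X >> <<s process_events eps >>.
Hypothesis X_cont : forall w, C01 (X ^~ w).
Hypothesis Gt_meas : forall t, t \in `[0, 1] -> measurable_fun setT (fun z : paths => Gt t z.1).
Hypothesis GtE : forall x t, C01 x -> t \in `[0, 1] -> G0 x t = Gt t x.
Hypothesis eps_var : forall t, t \in `[0, 1] -> (\int[P]_w (eps t w ^+ 2)%:E <= M%:E)%E.
Hypothesis mXs : forall i, measurable_process (Xs i).
Hypothesis mepss : forall i, measurable_process (epss i).
Hypothesis Xs_cont : forall i w, C01 (Xs i ^~ w).
Local Notation Y := (response G0 X eps).
Local Notation Ys := (fun i => response G0 (Xs i) (epss i)).
Hypothesis XY_copies : forall i, same_law P (Xs i) (Ys i) X Y.
Hypothesis XY_indep : mutual_indep P (fun i : nat => <<s pair_events (Xs i) (Ys i) >>).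

Variables (u b r B nu : R) (J p q : nat) (s : nat -> R).
Hypotheses (u1 : 1 <= u) (b1 : 1 <= b) (r1 : 1 <= r) (B0 : 0 <= B).
Hypotheses (sg : is_grid J s) (J0 : (0 < J)%N).
Local Notation sv := (sieve sigma B nu u b r J p q s).
Local Notation V := (truncation (grid_set J s) u).
Variables (L : nat) (t : nat -> R).
Hypotheses (tg : is_grid L t) (L2 : (1 < L)%N).
Variables (n : nat) (e : nat -> nat -> T -> R) (se : R).
Hypothesis n0 : (0 < n)%N.
Hypothesis e_gauss : forall i l, (i < n)%N -> (1 <= l <= L)%N ->
  centered_gaussian P (e i l) /\ ('V_P[e i l] <= (se ^+ 2)%:E)%E.
Hypothesis e_indep : mutual_indep P (fun il : 'I_n * 'I_L => events (e il.1 il.2.+1)).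
Hypothesis e_XY_indep : indep P
  <<s \bigcup_(i in [set i | (i < n)%N]) pair_events (Xs i) (Ys i) >>
  <<s \bigcup_(i in [set i | (i < n)%N])
      \bigcup_(l in [set l | (1 <= l <= L)%N]) events (e i l) >>.
Variables (m : nat) (th A0 A1 Cq : R).
Hypotheses (th0 : 0 < th) (A00 : 0 <= A0) (A10 : 0 < A1).
Hypothesis X_moment : (\int[P]_w path_moment m th (X ^~ w) <= Cq%:E)%E.
Variable Gst : (R -> R) -> R -> R.
Hypothesis svGst : sv Gst.
Hypothesis Gst_err : forall x c t, C01 x -> V x = 1 -> (path_moment m th x <= c%:E)%E ->
  t \in `[0, 1] -> (Gst x t - G0 x t) ^+ 2 <= A0 + A1 * c.
Variables (I : finType) (Gc : I -> (R -> R) -> R -> R) (delta : R).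
Hypothesis svGc : forall a, sv (Gc a).
Hypothesis d0 : 0 <= delta.
Hypothesis Gc_cover : forall G, sv G -> exists a, forall x t, t \in `[0, 1] ->
  `|G x t - Gc a x t| <= delta.
Variable Ghat : T -> (R -> R) -> R -> R.
Hypothesis Ghat_argmin : forall w, is_argmin sv
  (empirical_loss u n J L s t (fun i => Xs i ^~ w)
     (fun i l => response G0 (Xs i) (epss i) (t l) w + e i l w)) (Ghat w).

Let mX : measurable_process X := gaussian_process_measurable gX.
Let meps : measurable_process eps := gaussian_process_measurable geps.
Let mY : measurable_process Y := measurable_response Gt_meas GtE mX meps X_cont.
Let mYs i : measurable_process (Ys i) :=
  measurable_response Gt_meas GtE (mXs i) (mepss i) (@Xs_cont i).

Let K : R := B * u `^ nu.
Let Lam : R := p%:R * q%:R * b ^+ 2 * act_bound sigma u b r * k.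
Let wt := quad_weight L t.
Let u0 : 0 <= u. Proof. exact: le_trans u1. Qed.
Let K0 : 0 <= K. Proof. by rewrite mulr_ge0// powR_ge0. Qed.
Let Lam0 : 0 <= Lam.
Proof.
by rewrite mulr_ge0// mulr_ge0 ?act_bound_ge0// mulr_ge0 ?sqr_ge0// mulr_ge0.
Qed.
Let sp0 : 0 <= spacing L t.
Proof.
by have [_ _ tS] := tg; apply: le_trans (spacing_ge t (leq0n L)); rewrite subr_ge0 ltW// tS.
Qed.
Let wt0 l : (0 < l <= L)%N -> 0 <= wt l. Proof. exact: quad_weight_ge0. Qed.
Let wt1 l : (0 < l <= L)%N -> wt l <= 1. Proof. exact: quad_weight_le1. Qed.
Let wtS : \sum_(1 <= l < L.+1) wt l = 1. Proof. exact: sum_quad_weight. Qed.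
Let t01 l : (0 < l <= L)%N -> t l \in `[0, 1].
Proof. by move=> /andP[_ /leqW lL]; exact: (is_grid_01 tg). Qed.

Let H a (z : paths (R := R)) (l : nat) : R := Gc a z.1 (t l) - Gst z.1 (t l).
Let h a (z : paths (R := R)) : R := \sum_(1 <= l < L.+1) wt l * H a z l ^+ 2.
Let D (z : paths (R := R)) : R := V z.1 * \sum_(1 <= l < L.+1) wt l * (Gst z.1 (t l) - Gt (t l) z.1) ^+ 2.

Lemma measurable_wsum (f : nat -> paths (R := R) -> R) :
  (forall l, (0 < l <= L)%N -> measurable_fun setT (f l)) ->
  measurable_fun setT (fun z => \sum_(1 <= l < L.+1) wt l * f l z).
Proof.
move=> mf; rewrite (_ : (fun z => _) = (fun z => \sum_(l <- index_iota 1 L.+1)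
    (if (0 < l <= L)%N then wt l * f l z else 0))).
  apply: measurable_sum => l; case: (boolP (0 < l <= L)%N) => // lL.
  by apply: measurable_funM => //; exact: mf.
by apply/funext => z; apply: eq_big_nat => l; rewrite ltnS => ->.
Qed.

Lemma wsum_le (f : nat -> R) c : (forall l, (0 < l <= L)%N -> f l <= c) ->
  \sum_(1 <= l < L.+1) wt l * f l <= c.
Proof.
move=> fc; rewrite -[leRHS]mul1r -wtS mulr_suml big_nat_cond [leRHS]big_nat_cond.
by apply: ler_sum => l; rewrite andbT ltnS => lL; rewrite ler_wpM2l ?wt0 ?fc.
Qed.

Lemma wsum_ge0 (f : nat -> R) : (forall l, 0 <= f l) -> 0 <= \sum_(1 <= l < L.+1) wt l * f l.
Proof.
by move=> f0; rewrite big_nat_cond; apply: sumr_ge0 => l; rewrite andbT ltnS => lL; rewrite mulr_ge0 ?wt0.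
Qed.

Lemma mean_wsum (f : nat -> T -> R) c :
  (forall l, (0 < l <= L)%N -> mean_le P (f l) c) ->
  mean_le P (fun w => \sum_(1 <= l < L.+1) wt l * f l w) c.
Proof.
move=> fc; have wE (g : nat -> R) : \sum_(l <- index_iota 1 L.+1 | (0 < l <= L)%N) g l = \sum_(1 <= l < L.+1) g l.
  by rewrite big_nat_cond [RHS]big_nat_cond; apply: eq_bigl => l; rewrite ltnS andbb andbT.
rewrite -[c in X in mean_le _ _ X]mul1r -wtS mulr_suml -wE.
rewrite (_ : (fun w => _) = fun w => \sum_(l <- index_iota 1 L.+1 | (0 < l <= L)%N) wt l * f l w).
  by apply: mean_le_sum => l lL; apply: mean_leZ; [exact: wt0|exact: fc].
by apply/funext => w; rewrite wE.
Qed.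

Lemma sieve_diff G G' x z : sv G -> sv G' -> z \in `[0, 1] -> `|G x z - G' x z| <= 2 * K.
Proof.
move=> sG sG' z01; apply: le_trans (ler_normB _ _) _; rewrite mulr2n mulrDl mul1r.
apply: lerD; first exact: (sieve_bound u1 x sg J0 B0 sG z01).
exact: (sieve_bound u1 x sg J0 B0 sG' z01).
Qed.

Lemma code_diff a z l : (0 < l <= L)%N -> `|H a z l| <= 2 * K.
Proof. by move=> lL; apply: sieve_diff => //; exact: t01. Qed.

Lemma measurable_code_diff a l : measurable_fun setT (fun z : paths => H a z l).
Proof.
apply: measurable_funB; first exact: (measurable_sieve sigma_k (t l) u0 sg (svGc a)).
exact: (measurable_sieve sigma_k (t l) u0 sg svGst).
Qed.

Lemma sqr_le_norm (x y : R) : `|x| <= y -> x ^+ 2 <= y ^+ 2.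
Proof. by rewrite ler_norml => /andP[? ?]; rewrite -subr_ge0 subr_sqr mulr_ge0//; lra. Qed.

Lemma code_loss a z : 0 <= h a z <= (2 * K) ^+ 2.
Proof.
rewrite wsum_ge0/=; last by move=> l; exact: sqr_ge0.
by apply: wsum_le => l lL; apply/sqr_le_norm/code_diff.
Qed.

Lemma measurable_code_loss a : measurable_fun setT (h a).
Proof.
by apply: measurable_wsum => l lL; apply: measurable_funX; exact: measurable_code_diff.
Qed.

Lemma measurable_target_loss : measurable_fun setT D.
Proof.
apply: measurable_funM; first exact: measurable_truncation.
apply: measurable_wsum => l lL; apply: measurable_funX; apply: measurable_funB.
  exact: (measurable_sieve sigma_k (t l) u0 sg svGst).
exact: Gt_meas (t01 lL).
Qed.

Lemma target_loss_ge0 z : 0 <= D z.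
Proof.
by rewrite mulr_ge0 ?ler0n// wsum_ge0// => l; exact: sqr_ge0.
Qed.

Let mpm : measurable_fun setT (fun w => path_moment m th (X ^~ w)).
Proof. exact: (measurableT_comp (measurable_path_moment m th0) (measurable_path_pair mX mX)). Qed.

Lemma target_loss_mean : (\int[P]_w (D (path_pair X Y w))%:E <= (A0 + A1 * Cq)%:E)%E.
Proof.
apply: (affine_moment_le (mean_le_cst P A00) A10 mpm _ X_moment) => //.
- by move=> w; exact: path_moment_ge0.
- by move=> w; rewrite lee_fin target_loss_ge0.
move=> w c mc; rewrite lee_fin /D.
have c0 : 0 <= c by rewrite -lee_fin (le_trans _ mc)// path_moment_ge0.
have [->|V1] := @truncation01 _ u (grid_set J s) (path_pair X Y w).1.
  by rewrite mul0r addr_ge0// mulr_ge0// ltW.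
rewrite V1 mul1r; apply: wsum_le => l lL.
have xc : C01 (path_pair X Y w).1 by exact: X_cont.
by rewrite -(GtE xc (t01 lL)); exact: Gst_err xc V1 mc (t01 lL).
Qed.

Definition code_risk a : R := fine (\int[P]_w (h a (path_pair X Y w))%:E).

Lemma code_riskE a : (\int[P]_w (h a (path_pair X Y w))%:E = (code_risk a)%:E)%E.
Proof.
have [_ _ le] := mean_le_cst P (sqr_ge0 (2 * K)).
rewrite fineK// ge0_fin_numE; last first.
  by apply: integral_ge0 => w _; rewrite lee_fin; case/andP: (code_loss a (path_pair X Y w)).
apply: le_lt_trans (ltry ((2 * K) ^+ 2)); apply: le_trans le.
by apply: integral_mono => w; rewrite lee_fin; case/andP: (code_loss a (path_pair X Y w)).
Qed.

Lemma code_loss_mean a : mean_le P (fun w => h a (path_pair X Y w)) (code_risk a).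
Proof.
split; last by rewrite code_riskE.
  exact: (measurableT_comp (measurable_code_loss a) (measurable_path_pair mX mY)).
by move=> w; case/andP: (code_loss a (path_pair X Y w)).
Qed.

(** The training outcome is frozen and the fresh predictor integrated. The error splits into
    [Ghat - Gst], passed by quadrature to the nodes and then to the center [a], and [Gst - G0],
    controlled by the path moment; off the truncation event everything vanishes. *)
Lemma prediction_le w a : (forall x z, z \in `[0, 1] -> `|Ghat w x z - Gc a x z| <= delta) ->
  (\int[P]_w' L2norm_sq (fun z => (Ghat w (X ^~ w') z - V (X ^~ w') * G0 (X ^~ w') z)%R) <=
   (4 * code_risk a + 4 * delta ^+ 2 + 2 * A0 + 16 * Lam * K * spacing L t + 2 * A1 * Cq)%:E)%E.
Proof.
move=> cov; have [svh _] := Ghat_argmin w.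
have c0 : 0 <= 4 * delta ^+ 2 + 2 * A0 + 16 * Lam * K * spacing L t.
  exact: addr_ge0 (addr_ge0 (mulr_ge0 (ler0n _ 4) (sqr_ge0 _)) (mulr_ge0 (ler0n _ 2) A00))
    (mulr_ge0 (mulr_ge0 (mulr_ge0 (ler0n _ 16) Lam0) K0) sp0).
have mf := mean_leD (mean_leZ (ler0n R 4) (code_loss_mean a)) (mean_le_cst P c0).
have A12 : 0 < 2 * A1 by rewrite mulr_gt0.
have -> : 4 * code_risk a + 4 * delta ^+ 2 + 2 * A0 + 16 * Lam * K * spacing L t + 2 * A1 * Cq =
  4 * code_risk a + (4 * delta ^+ 2 + 2 * A0 + 16 * Lam * K * spacing L t) + 2 * A1 * Cq by ring.
apply: (affine_moment_le mf A12 mpm _ X_moment) => [w'|w'|w' c mc].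
- exact: path_moment_ge0.
- by apply: integral_ge0 => z _; rewrite lee_fin sqr_ge0.
set x := X ^~ w'; have xc : C01 x by exact: X_cont.
have cge0 : 0 <= c by rewrite -lee_fin (le_trans _ mc)// path_moment_ge0.
have K20 : 0 <= 2 * K by rewrite mulr_ge0.
have E0 : 0 <= 2 * (A0 + A1 * c) by rewrite mulr_ge0// addr_ge0// mulr_ge0// ltW.
have Lam20 : 0 <= 2 * Lam by rewrite mulr_ge0.
apply: le_trans (prediction_loss_le (f := fun z => Ghat w x z - Gst x z) tg L2 Lam20 K20 E0 _ _ _) _.
- move=> z z' z01 z'01.
  have -> : Ghat w x z - Gst x z - (Ghat w x z' - Gst x z') =
    (Ghat w x z - Ghat w x z') - (Gst x z - Gst x z') by ring.
  apply: le_trans (ler_normB _ _) _; rewrite -mulrA mulr2n mulrDl mul1r.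
  apply: lerD; first exact: (sieve_lip k0 sigma_k u1 b1 x svh z01 z'01).
  exact: (sieve_lip k0 sigma_k u1 b1 x svGst z01 z'01).
- by move=> z z01; exact: sieve_diff.
- move=> z z01; have [V0|V1] := @truncation01 _ u (grid_set J s) x.
    rewrite V0 mul0r subr0 (sieve_truncated (s := s) z svh V0) (sieve_truncated z svGst V0).
    by rewrite subrr expr0n/= mulr0 add0r.
  rewrite V1 mul1r; have := Gst_err xc V1 mc z01.
  have := sqr_ge0 (Ghat w x z - Gst x z - (Gst x z - G0 x z)).
  by move=> *; lra.
rewrite lee_fin.
have -> : 4 * (2 * Lam) * (2 * K) * spacing L t = 16 * Lam * K * spacing L t by ring.
suff : \sum_(1 <= l < L.+1) wt l * (Ghat w x (t l) - Gst x (t l)) ^+ 2 <=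
    2 * h a (path_pair X Y w') + 2 * delta ^+ 2 by move=> *; lra.
have -> : 2 * delta ^+ 2 = \sum_(1 <= l < L.+1) wt l * (2 * delta ^+ 2) by rewrite -mulr_suml wtS mul1r.
rewrite /h mulr_sumr -big_split/= big_nat_cond [leRHS]big_nat_cond.
apply: ler_sum => l; rewrite andbT ltnS => lL.
rewrite [2 * (wt l * _)]mulrCA -mulrDr ler_wpM2l ?wt0// /H/=.
have := sqr_le_norm (cov x (t l) (t01 lL)).
have := sqr_ge0 (Ghat w x (t l) - Gc a x (t l) - (Gc a x (t l) - Gst x (t l))).
by rewrite -/x; move=> *; lra.
Qed.

Let dev1 a w : R := \sum_(i < n) (code_risk a - h a (path_pair (Xs i) (Ys i) w)).
Let dev2 a w : R := \sum_(i < n) \sum_(1 <= l < L.+1)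
  wt l * (epss i (t l) w * H a (path_pair (Xs i) (Ys i) w) l).
Let dev3 a w : R := \sum_(i < n) \sum_(1 <= l < L.+1)
  wt l * (e i l w * H a (path_pair (Xs i) (Ys i) w) l).
Let loss w : R := \sum_(i < n) D (path_pair (Xs i) (Ys i) w).
Let noise w : R := \sum_(i < n) \sum_(1 <= l < L.+1) wt l * `|epss i (t l) w|
  + \sum_(i < n) \sum_(1 <= l < L.+1) wt l * `|e i l w|.

Lemma code_risk_le w a : (forall x z, z \in `[0, 1] -> `|Ghat w x z - Gc a x z| <= delta) ->
  n%:R * code_risk a <= dev1 a w + 8 * (dev2 a w + dev3 a w) + 8 * loss w
    + 8 * (delta * noise w) + 2 * delta ^+ 2 * n%:R.
Proof.
move=> cov; have [svh hmin] := Ghat_argmin w.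
have := hmin _ svGst; rewrite /empirical_loss ler_pM2l ?invr_gt0 ?ltr0n// => basic.
have trz G i l : sv G -> V (Xs i ^~ w) = 0 -> G (Xs i ^~ w) (t l) = 0.
  by move=> sG V0; exact: (sieve_truncated (t l) sG V0).
have := @sample_oracle R n L wt (fun i => V (Xs i ^~ w))
  (fun i l => response G0 (Xs i) (epss i) (t l) w + e i l w)
  (fun i l => G0 (Xs i ^~ w) (t l)) (fun i l => Gst (Xs i ^~ w) (t l))
  (fun i l => Ghat w (Xs i ^~ w) (t l)) (fun i l => Gc a (Xs i ^~ w) (t l)) (code_risk a) delta
  wt0 wtS (fun i => @truncation01 _ u (grid_set J s) _)
  (fun i l V0 => conj (trz _ _ _ svGst V0) (conj (trz _ _ _ svh V0) (trz _ _ _ (svGc a) V0)))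
  (fun i l lL => cov _ _ (t01 lL)) basic.
have resE i l : response G0 (Xs i) (epss i) (t l) w + e i l w - G0 (Xs i ^~ w) (t l) =
  epss i (t l) w + e i l w by rewrite /response; ring.
move=> /le_trans; apply; apply: lerD => //.
have E2 : \sum_(i < n) \sum_(1 <= l < L.+1) wt l *
   ((response G0 (Xs i) (epss i) (t l) w + e i l w - G0 (Xs i ^~ w) (t l)) *
   (Gc a (Xs i ^~ w) (t l) - Gst (Xs i ^~ w) (t l))) = dev2 a w + dev3 a w.
  rewrite /dev2 /dev3 -big_split/=; apply: eq_bigr => i _; rewrite -big_split/=.
  by apply: eq_bigr => l _; rewrite resE /H/=; ring.
have E3 : \sum_(i < n) V (Xs i ^~ w) * (\sum_(1 <= l < L.+1) wt l *
   (Gst (Xs i ^~ w) (t l) - G0 (Xs i ^~ w) (t l)) ^+ 2) = loss w.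
  apply: eq_bigr => i _; rewrite /D/=; congr (_ * _).
  by apply: eq_big_nat => l lL; rewrite GtE// t01.
rewrite E2 E3; apply: lerD => //; rewrite ler_pM2l// ler_wpM2l//.
rewrite /noise -big_split/=; apply: ler_sum => i _; rewrite -big_split/=.
rewrite big_nat_cond [leRHS]big_nat_cond; apply: ler_sum => l; rewrite andbT => lL.
by rewrite -mulrDr ler_wpM2l ?wt0// resE ler_normD.
Qed.

Variables (tau : R).
Hypotheses (tau0 : 0 < tau) (tauK : tau * (2 * K) ^+ 2 <= 2^-1).

Let N : nat := #|I|.
Let x1 : R := 2 * tau ^+ 2 * ((2 * K) ^+ 2) ^+ 2.
Let x2 : R := 4 * (tau * (2 * K)) ^+ 2 * M.
Let x3 : R := 4 * (tau * (2 * K)) ^+ 2 * se ^+ 2.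
(** Bounds all [dev a] at once. The center near the estimator varies with the sample, with no
    measurability of that choice; this quantity is free of it and has a mean bounded by
    [excess_mean]. *)
Let excess (dev : I -> T -> R) (x : R) w : R :=
  tau^-1 * (ln N%:R + n%:R * x + \sum_a expR (tau * dev a w - (ln N%:R + n%:R * x))).

Lemma dev_excess dev x a w : dev a w <= excess dev x w.
Proof.
rewrite /excess -(ler_pM2l tau0) mulrA mulfV ?gt_eqF// mul1r.
exact: (@le_expR_shift R I (fun a => tau * dev a w)).
Qed.

Lemma codes_inhabited : (0 < N)%N.
Proof. by have [a _] := Gc_cover svGst; apply/card_gt0P; exists a. Qed.

Lemma excess_mean dev x : 0 <= x ->
  (forall a, mean_le P (fun w => expR (tau * dev a w)) (expR x ^+ n)) ->
  mean_le P (excess dev x) (tau^-1 * (ln N%:R + n%:R * x + 1)).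
Proof.
move=> xge0 H'; apply: mean_leZ; first by rewrite invr_ge0 ltW.
apply: mean_leD; last exact: union_dev codes_inhabited H'.
apply: mean_le_cst; rewrite addr_ge0 ?mulr_ge0// ln_ge0// ler1n.
exact: codes_inhabited.
Qed.

Let M0 : 0 <= M.
Proof.
have z01 : (0 : R) \in `[0, 1] by rewrite in_itv/= lexx ler01.
by rewrite -lee_fin; apply: le_trans (eps_var z01); apply: integral_ge0 => w _; rewrite lee_fin sqr_ge0.
Qed.

Lemma dev1_mean : mean_le P (excess dev1 x1) (tau^-1 * (ln N%:R + n%:R * x1 + 1)).
Proof.
apply: excess_mean => [|a]; first exact: mulr_ge0 (mulr_ge0 (ler0n _ 2) (sqr_ge0 _)) (sqr_ge0 _).
by apply: (sample_dev gX geps X_cont Gt_meas GtE mXs mepss Xs_cont XY_copies XY_indep n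
  (measurable_code_loss a) (code_loss a) (ltW tau0) tauK (code_riskE a)).
Qed.

Lemma dev2_mean : mean_le P (excess dev2 x2) (tau^-1 * (ln N%:R + n%:R * x2 + 1)).
Proof.
apply: excess_mean => [|a]; first exact: mulr_ge0 (mulr_ge0 (ler0n _ 4) (sqr_ge0 _)) M0.
apply: (noise_dev gX geps X_eps_indep X_cont Gt_meas GtE eps_var mXs mepss Xs_cont XY_copies XY_indep
  wt0 wtS t01 tau n (H := H a) (K := 2 * K)) => //.
- by move=> l _; exact: measurable_code_diff.
- by move=> z l lL; exact: code_diff.
Qed.

Lemma dev3_mean : mean_le P (excess dev3 x3) (tau^-1 * (ln N%:R + n%:R * x3 + 1)).
Proof.
apply: excess_mean => [|a]; first exact: mulr_ge0 (mulr_ge0 (ler0n _ 4) (sqr_ge0 _)) (sqr_ge0 _).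
have mH l : (0 < l <= L)%N -> measurable_fun setT (fun z : paths => H a z l).
  by move=> _; exact: measurable_code_diff.
have := error_dev Gt_meas GtE mXs mepss Xs_cont wt0 wtS wt1 e_gauss e_indep e_XY_indep tau mH
  (fun z l lL => code_diff a z lL).
exact.
Qed.

Lemma mean_le_sum_ord (f : nat -> T -> R) c : (forall i, (i < n)%N -> mean_le P (f i) c) ->
  mean_le P (fun w => \sum_(i < n) f i w) (n%:R * c).
Proof.
move=> fc; have -> : n%:R * c = \sum_(i < n) c by rewrite sumr_const card_ord mulr_natl.
exact: (@mean_le_sum _ T R P _ (index_enum 'I_n) xpredT (fun i w => f i w) (fun=> c)
  (fun i _ => fc i (ltn_ord i))).
Qed.

Lemma loss_mean : mean_le P loss (n%:R * (A0 + A1 * Cq)).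
Proof.
apply: (mean_le_sum_ord (f := fun i w => D (path_pair (Xs i) (Ys i) w))) => i _.
apply: (mean_le_copy gX geps X_cont Gt_meas GtE mXs mepss Xs_cont XY_copies) => //.
- exact: measurable_target_loss.
- exact: target_loss_ge0.
- exact: target_loss_mean.
Qed.

Lemma noise_mean : mean_le P noise (n%:R * (2 * expR (4 * M)) + n%:R * (2 * expR (4 * se ^+ 2))).
Proof.
apply: mean_leD.
  apply: (mean_le_sum_ord (f := fun i w => \sum_(1 <= l < L.+1) wt l * `|epss i (t l) w|)) => i _.
  apply: mean_wsum => l lL; have tl := t01 lL.
  have mf : measurable_fun setT (fun z : paths (R := R) => `|z.2 (t l) - Gt (t l) z.1|).
    by apply: measurableT_comp => //; apply: measurable_funB; [exact: measurable_coord2|exact: Gt_meas].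
  have fE Z eta : (forall w : T, C01 (Z ^~ w)) -> forall w,
    `|(path_pair Z (response G0 Z eta) w).2 (t l) - Gt (t l) (path_pair Z (response G0 Z eta) w).1| = `|eta (t l) w|.
    by move=> Zc w; rewrite /= /response -GtE// addrC addKr.
  have := mean_le_copy gX geps X_cont Gt_meas GtE mXs mepss Xs_cont XY_copies (c := 2 * expR (4 * M)) i mf
    (fun z => normr_ge0 _).
  rewrite (_ : (fun w => _) = fun w => `|epss i (t l) w|); last by apply/funext => w; rewrite fE.
  apply; under eq_integral do rewrite fE//.
  have ev : (\int[P]_w ((eps (t l) w - 0) ^+ 2)%:E <= M%:E)%E.
    by under eq_integral do rewrite subr0; exact: eps_var.
  by have [] := gaussian_abs_le (gaussian_process_coord geps tl) ev.
apply: (mean_le_sum_ord (f := fun i w => \sum_(1 <= l < L.+1) wt l * `|e i l w|)) => i iN.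
apply: mean_wsum => l lL; have [c ev] := error_var e_gauss iN lL.
by have [ge _] := e_gauss iN lL; exact: gaussian_abs_le ge ev.
Qed.

(** For each training outcome the risk is bounded by [psi], from which the data-dependent center is
    eliminated; only the mean of [psi] remains to be bounded, term by term. *)
Lemma oracle_inequality :
  (\int[P \x P]_z L2norm_sq (fun v => (Ghat z.1 (X ^~ z.2) v
      - V (X ^~ z.2) * G0 (X ^~ z.2) v)%R) <=
   (4 * delta ^+ 2 + 2 * A0 + 16 * Lam * K * spacing L t + 2 * A1 * Cq +
    4 / n%:R * (tau^-1 * (ln N%:R + n%:R * x1 + 1)
      + 8 * (tau^-1 * (ln N%:R + n%:R * x2 + 1) + tau^-1 * (ln N%:R + n%:R * x3 + 1))
      + 8 * (n%:R * (A0 + A1 * Cq))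
      + 8 * (delta * (n%:R * (2 * expR (4 * M)) + n%:R * (2 * expR (4 * se ^+ 2))))
      + 2 * delta ^+ 2 * n%:R))%:E)%E.
Proof.
pose c0 := 4 * delta ^+ 2 + 2 * A0 + 16 * Lam * K * spacing L t + 2 * A1 * Cq.
pose psi w : R := c0 + 4 / n%:R * (excess dev1 x1 w + 8 * (excess dev2 x2 w + excess dev3 x3 w)
  + 8 * loss w + 8 * (delta * noise w) + 2 * delta ^+ 2 * n%:R).
apply: (@le_trans _ _ (\int[P]_w (psi w)%:E)%E).
  apply: (@lower_fubini _ _ T T R P P (fun z => L2norm_sq (fun v => (Ghat z.1 (X ^~ z.2) v
      - V (X ^~ z.2) * G0 (X ^~ z.2) v)%R)) (fun w => (psi w)%:E)) => [z|w].
    by apply: integral_ge0 => v _; rewrite lee_fin sqr_ge0.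
  have [svh _] := Ghat_argmin w; have [a cov] := Gc_cover svh.
  apply: le_trans (prediction_le cov) _; rewrite lee_fin /psi /c0.
  have nr : (0 : R) < n%:R by rewrite ltr0n.
  suff : 4 * code_risk a <= 4 / n%:R * (excess dev1 x1 w + 8 * (excess dev2 x2 w + excess dev3 x3 w)
    + 8 * loss w + 8 * (delta * noise w) + 2 * delta ^+ 2 * n%:R) by move=> *; lra.
  have -> : 4 * code_risk a = 4 / n%:R * (n%:R * code_risk a) by field; rewrite gt_eqF.
  rewrite ler_wpM2l ?divr_ge0//; apply: le_trans (code_risk_le cov) _.
  have := dev_excess dev1 x1 a w; have := dev_excess dev2 x2 a w; have := dev_excess dev3 x3 a w.
  by move=> *; lra.
have c00 : 0 <= c0.
  have C0 : 0 <= Cq.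
    by rewrite -lee_fin; apply: le_trans X_moment; apply: integral_ge0 => w _; exact: path_moment_ge0.
  apply: addr_ge0; last exact: mulr_ge0 (mulr_ge0 (ler0n _ 2) (ltW A10)) C0.
  exact: addr_ge0 (addr_ge0 (mulr_ge0 (ler0n _ 4) (sqr_ge0 _)) (mulr_ge0 (ler0n _ 2) A00))
    (mulr_ge0 (mulr_ge0 (mulr_ge0 (ler0n _ 16) Lam0) K0) sp0).
suff [] : mean_le P psi (c0 + 4 / n%:R * (tau^-1 * (ln N%:R + n%:R * x1 + 1)
      + 8 * (tau^-1 * (ln N%:R + n%:R * x2 + 1) + tau^-1 * (ln N%:R + n%:R * x3 + 1))
      + 8 * (n%:R * (A0 + A1 * Cq))
      + 8 * (delta * (n%:R * (2 * expR (4 * M)) + n%:R * (2 * expR (4 * se ^+ 2))))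
      + 2 * delta ^+ 2 * n%:R)) by [].
apply: mean_leD; first exact: mean_le_cst.
apply: mean_leZ; first by rewrite divr_ge0.
apply: mean_leD; last by apply: mean_le_cst; rewrite !mulr_ge0 ?sqr_ge0.
apply: mean_leD; last by do 2 (apply: mean_leZ => //); exact: noise_mean.
apply: mean_leD; last by apply: mean_leZ => //; exact: loss_mean.
apply: mean_leD; first exact: dev1_mean.
by apply: mean_leZ => //; apply: mean_leD; [exact: dev2_mean|exact: dev3_mean].
Qed.

End OracleInequality.

(** * Rates *)

Section Rates.
Context {R : realType}.

Lemma activation_nonzero (sigma : R -> R) : tauber_wiener sigma -> exists z, sigma z != 0.
Proof.
move=> TW; apply: contrapT => /forallNP H.
have s0 z : sigma z = 0 by apply/eqP; move: (H z) => /negP; rewrite negbK.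
have [|m [c [l [th /(_ 0)]]]] := TW 0 1 ltr01 (fun=> 1) _ 1 ltr01.
  by move=> z; exact: cst_continuous.
rewrite in_itv/= lexx ler01 => /(_ isT); rewrite big1 ?subr0 ?normr1 ?ltxx// => i _.
by rewrite s0 mulr0.
Qed.

(** Some point where [sigma] does not vanish enters the range of arguments once [b] is large. The
    bound is needed because [act_bound] occurs inside the logarithm of the rate condition. *)
Lemma activation_lower_bound (sigma : R -> R) (k u : R) (b r : nat -> R) : 1 <= u ->
  (forall x y, `|sigma x - sigma y| <= k * `|x - y|) -> 0 <= k ->
  tauber_wiener sigma -> (forall n, 1 <= b n) -> (forall n, 1 <= r n) -> b n @[n --> \oo] --> +oo ->
  exists c0 : R, [/\ 0 < c0, c0 <= 1 & \forall n \near \oo, c0 <= act_bound sigma u (b n) (r n)].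
Proof.
move=> u1 sk k0 TW b1 r1 boo; have [z sz] := activation_nonzero TW.
exists (Num.min 1 `|sigma z|); split; first by rewrite lt_min ltr01 normr_gt0.
  by rewrite ge_min lexx.
have : \forall n \near \oo, `|z| <= b n by move/cvgryPge: boo; exact.
apply: filterS => n zn; rewrite ge_min; apply/orP; right.
apply: (act_bound_ub k0 sk); apply: le_trans zn _; rewrite ler_peMr ?(le_trans ler01)//.
by rewrite lerDr mulr_ge0 ?(le_trans ler01).
Qed.

(** All sizes are polynomial in [W = Z / c0], up to factors depending on [k], [u] and [delta]. The
    logarithm of the number of values per item of a code is therefore of order [ln Z], and
    [1 <= ln Z] absorbs the constants. *)
Lemma cover_constants (k u c0 delta : R) : 0 <= k -> 1 <= u -> 0 < c0 -> c0 <= 1 -> 0 < delta ->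
  exists2 C : R, 0 <= C & forall (b A r : R) (J p q : nat),
    1 <= b -> c0 <= A -> 1 <= r -> (0 < J)%N -> (0 < p)%N -> (0 < q)%N ->
    1 <= ln (b * J%:R * p%:R * q%:R * A) ->
  exists eta M, [/\ 0 < eta, 2 * b / eta < M.+1%:R,
    p%:R * q%:R * (eta * (A * (A + b * k * (J%:R * u + 3)))) <= delta &
    forall N : nat, (0 < N)%N -> (N <= (2 * J * M.+1) ^ (5 * p * q * Num.truncn r))%N ->
      ln N%:R <= C * (p%:R * q%:R * r * ln (b * J%:R * p%:R * q%:R * A))].
Proof.
move=> k0 u1 c00 c01 d0.
pose C1 : R := 2 * (2 * (2 + k * (u + 3)) / delta + 1).
exists (5 * (4 + `|ln C1 - 4 * ln c0|)); first by rewrite mulr_ge0// addr_ge0.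
move=> b A r J p q b1 cA r1 J0 p0 q0; set Z := b * _ * _ * _ * _ => lnZ.
have J1 : 1 <= J%:R :> R by rewrite ler1n.
have p1 : 1 <= p%:R :> R by rewrite ler1n.
have q1 : 1 <= q%:R :> R by rewrite ler1n.
have A0 : 0 < A by exact: lt_le_trans cA.
have b0 : 0 < b by exact: lt_le_trans b1.
have u0 : 0 <= u by exact: le_trans u1.
have K0 : 0 <= A + b * k * (J%:R * u + 3).
  apply: addr_ge0; first exact: ltW.
  by apply: mulr_ge0; [exact: mulr_ge0 (ltW b0) k0|rewrite addr_ge0// mulr_ge0].
pose S := p%:R * q%:R * (A * (A + b * k * (J%:R * u + 3))).
have S0 : 0 <= S by apply: mulr_ge0; rewrite ?mulr_ge0// ltW.
have S1 : 0 < S + 1 by rewrite ltr_wpDl.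
(* [S] is the factor of [eta] in [network_close], so this mesh makes the net radius at most [delta];
   the added 1 keeps the denominator positive. *)
pose eta := delta / (S + 1); pose M := Num.truncn (2 * b / eta).
have eta0 : 0 < eta by rewrite divr_gt0.
have be0 : 0 <= 2 * b / eta by apply: divr_ge0; [exact: mulr_ge0 (ler0n _ 2) (ltW b0)|exact: ltW].
exists eta, M; split=> //.
- by rewrite -truncn_le_nat.
- have -> : p%:R * q%:R * (eta * (A * (A + b * k * (J%:R * u + 3)))) = delta * (S / (S + 1)).
    by rewrite /eta /S; field; rewrite gt_eqF.
  apply: ler_piMr; first exact: ltW.
  by rewrite ler_pdivrMr// mul1r lerDl.
move=> N N0 NM.
pose P : R := p%:R * q%:R; have P1 : 1 <= P by exact: mulr_ege1.
have ZE : Z = b * J%:R * P * A by rewrite /Z /P; ring.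
have Z0 : 0 < Z by rewrite ZE !mulr_gt0// ?ltr0n// (lt_le_trans ltr01).
have Z1 : 1 <= Z by have := expR_ge1Dx (ln Z); rewrite lnK ?posrE//; lra.
pose W := Z / c0; have WZ : Z = c0 * W by rewrite /W mulrC divfK// gt_eqF.
have ZW : Z <= W by rewrite /W ler_pdivlMr// ler_piMr// ltW.
have W1 : 1 <= W by exact: le_trans ZW.
have W0 : 0 < W by exact: lt_le_trans W1.
have bJ1 : 1 <= b * J%:R by exact: mulr_ege1.
have bJW : b * J%:R <= W.
  rewrite /W ler_pdivlMr// ZE; apply: ler_pM => //; rewrite ?(ltW c00)// ?(le_trans ler01 bJ1)//.
  by rewrite ler_peMr// (le_trans ler01 bJ1).
have bW : b <= W by apply: le_trans bJW; rewrite ler_peMr// ltW.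
have JW : J%:R <= W by apply: le_trans bJW; rewrite ler_peMl.
have PAW : P * A <= W.
  apply: le_trans ZW; rewrite ZE -mulrA ler_peMl// mulr_ge0// ?(le_trans ler01 P1)//.
  exact: ltW.
have AW : A <= W by apply: le_trans PAW; rewrite ler_peMl// ltW.
pose E := 2 + k * (u + 3).
have E0 : 0 <= E by rewrite /E addr_ge0// mulr_ge0// addr_ge0.
have SW : S + 1 <= W ^+ 2 * E.
  have SE : S = (P * A) * (A + b * k * (J%:R * u + 3)) by rewrite /S /P; ring.
  have h1 : A + b * k * (J%:R * u + 3) <= W * (1 + k * (u + 3)).
    rewrite [leRHS]mulrDr [W * 1]mulr1; apply: lerD => //.
    apply: (@le_trans _ _ ((b * J%:R) * (k * (u + 3)))); last first.
      by rewrite ler_wpM2r// mulr_ge0// addr_ge0.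
    have -> : b * k * (J%:R * u + 3) = (b * k) * (J%:R * u + 3 * 1) by rewrite mulr1.
    have -> : b * J%:R * (k * (u + 3)) = (b * k) * (J%:R * u + 3 * J%:R) by ring.
    apply: ler_wpM2l; first exact: mulr_ge0 (ltW b0) k0.
    by rewrite lerD2l ler_pM2l.
  have h2 : S <= W * (W * (1 + k * (u + 3))).
    by rewrite SE; apply: ler_pM => //; rewrite mulr_ge0// ?ltW// (lt_le_trans ltr01).
  have h3 : 1 <= W ^+ 2 by rewrite exprn_ege1.
  by apply: le_trans (lerD h2 h3) _; rewrite le_eqVlt; apply/orP; left; apply/eqP; rewrite /E; ring.
have MW : M.+1%:R <= W ^+ 3 * (2 * E / delta + 1).
  have M1 : M%:R <= 2 * b / eta by rewrite truncn_le.
  have h3 : 1 <= W ^+ 3 by rewrite exprn_ege1.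
  rewrite -natr1 mulrDr mulr1; apply: lerD => //; apply: le_trans M1 _.
  have -> : 2 * b / eta = 2 / delta * (b * (S + 1)).
    by rewrite /eta; field; rewrite !gt_eqF.
  have -> : W ^+ 3 * (2 * E / delta) = 2 / delta * (W * (W ^+ 2 * E)) by ring.
  apply: ler_wpM2l; first by rewrite divr_ge0// ltW.
  by apply: ler_pM => //; exact: ltW.
pose X : R := (2 * J * M.+1)%:R.
have X1 : 1 <= X by rewrite ler1n !muln_gt0 J0.
have X0 : 0 < X by exact: lt_le_trans X1.
have XW : X <= W ^+ 4 * C1.
  rewrite /X !natrM; apply: (@le_trans _ _ ((2 * W) * (W ^+ 3 * (2 * E / delta + 1)))).
    by apply: ler_pM => //; rewrite ?mulr_ge0// ler_pM2l.
  by rewrite /C1 -/E le_eqVlt; apply/orP; left; apply/eqP; ring.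
have C10 : 0 < C1.
  by rewrite /C1 -/E mulr_gt0// ltr_wpDl// divr_ge0 ?mulr_ge0// ltW.
have lnX : ln X <= (4 + `|ln C1 - 4 * ln c0|) * ln Z.
  apply: (@le_trans _ _ (ln (W ^+ 4 * C1))).
    by rewrite ler_ln ?posrE// mulr_gt0// exprn_gt0.
  rewrite lnM ?posrE ?exprn_gt0// lnXn// /W ln_div ?posrE// -[(_ - _) *+ 4]mulr_natl.
  have := ler_norm (ln C1 - 4 * ln c0); set c := ln C1 - _ => cn.
  have -> : 4 * (ln Z - ln c0) + ln C1 = 4 * ln Z + c by rewrite /c; ring.
  rewrite [leRHS]mulrDl lerD2l; apply: le_trans cn _.
  by rewrite ler_peMr.
have lnX0 : 0 <= ln X by rewrite ln_ge0.
have rt : (Num.truncn r)%:R <= r by rewrite truncn_le (le_trans ler01).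
apply: (@le_trans _ _ ((5 * p * q * Num.truncn r)%:R * ln X)).
  rewrite mulr_natl -lnXn// ler_ln ?posrE ?ltr0n ?exprn_gt0//.
  by rewrite /X -natrX ler_nat.
rewrite !natrM; have P0 : 0 <= P by exact: le_trans P1.
have -> : 5 * (4 + `|ln C1 - 4 * ln c0|) * (p%:R * q%:R * r * ln Z) =
  (5 * P) * (r * ((4 + `|ln C1 - 4 * ln c0|) * ln Z)) by rewrite /P; ring.
have -> : 5 * p%:R * q%:R * (Num.truncn r)%:R * ln X = (5 * P) * ((Num.truncn r)%:R * ln X).
  by rewrite /P; ring.
by apply: ler_wpM2l; [rewrite mulr_ge0|apply: ler_pM].
Qed.

Lemma sieve_entropy (sigma : R -> R) (k u c0 delta : R) : 0 <= k ->
  (forall x y, `|sigma x - sigma y| <= k * `|x - y|) ->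
  1 <= u -> 0 < c0 -> c0 <= 1 -> 0 < delta ->
  exists2 C : R, 0 <= C & forall (b r B nu : R) (J p q : nat) (s : nat -> R),
    let A := act_bound sigma u b r in let Z := b * J%:R * p%:R * q%:R * A in
    1 <= b -> c0 <= A -> 1 <= r -> (0 < J)%N -> (0 < p)%N -> (0 < q)%N -> 1 <= ln Z ->
    (exists G, sieve sigma B nu u b r J p q s G) ->
  exists (I : finType) (Gc : I -> (R -> R) -> R -> R),
    [/\ forall a, sieve sigma B nu u b r J p q s (Gc a),
        forall G, sieve sigma B nu u b r J p q s G -> exists a, forall x t, t \in `[0, 1] ->
          `|G x t - Gc a x t| <= delta &
        ln #|I|%:R <= C * (p%:R * q%:R * r * ln Z)].
Proof.
move=> k0 sk u1 c00 c01 d0; have [C C0 H] := cover_constants k0 u1 c00 c01 d0.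
exists C => // b r B nu J p q s A Z b1 cA r1 J0 p0 q0 lnZ exG.
have [eta [M [eta0 bM small card]]] := H _ _ _ _ _ _ b1 cA r1 J0 p0 q0 lnZ.
have [Gc [svGc cover]] := sieve_cover k0 sk u1 b1 r1 eta0 bM exG.
exists _, Gc; split=> //.
  move=> G sG; have [a Ga] := cover G sG; exists a => x t t01.
  exact: le_trans (Ga x t t01) small.
apply: card; last exact: card_code.
by have [G sG] := exG; have [a _] := cover G sG; apply/card_gt0P; exists a.
Qed.

(** One [e] per hypothesis, after collecting terms: 34 is 2 + 4 * 8 for the bias, 68 is 4 * (1 + 8 +
    8) for the entropy of the three deviations, and 12 is 4 + 4 * 2 for the squared radius. *)
Lemma oracle_rhs_le (n : nat) (delta A0 A1 Cq D lnN tau x1 x2 x3 W1 W2 e : R) :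
  (0 < n)%N -> 0 < tau -> 0 <= delta -> delta <= 1 -> 0 <= W1 -> 0 <= W2 ->
  delta * (12 + 32 * (W1 + W2)) <= e -> 34 * (A0 + A1 * Cq) <= e -> D <= e ->
  68 * tau^-1 * ((lnN + 1) / n%:R) <= e -> 4 * tau^-1 * (x1 + 8 * (x2 + x3)) <= e ->
  4 * delta ^+ 2 + 2 * A0 + D + 2 * A1 * Cq +
    4 / n%:R * (tau^-1 * (lnN + n%:R * x1 + 1)
      + 8 * (tau^-1 * (lnN + n%:R * x2 + 1) + tau^-1 * (lnN + n%:R * x3 + 1))
      + 8 * (n%:R * (A0 + A1 * Cq)) + 8 * (delta * (n%:R * W1 + n%:R * W2))
      + 2 * delta ^+ 2 * n%:R) <= 5 * e.
Proof.
move=> n0 tau0 d0 d1 W10 W20 h1 h2 h3 h4 h5.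
have nr : n%:R != 0 :> R by rewrite pnatr_eq0 -lt0n.
have tn : tau != 0 by rewrite gt_eqF.
set lhs := (X in X <= _); have -> : lhs = 12 * delta ^+ 2 + 34 * (A0 + A1 * Cq) + D
    + 68 * tau^-1 * ((lnN + 1) / n%:R) + 4 * tau^-1 * (x1 + 8 * (x2 + x3))
    + 32 * delta * (W1 + W2).
  by rewrite /lhs; field; rewrite nr tn.
have : delta ^+ 2 <= delta by rewrite expr2 ler_piMr.
by move=> *; lra.
Qed.

End Rates.

(** * Choice of the constants and passage to the limit *)

Lemma near_mul_le (R : realType) (f : nat -> R) (c e : R) : f n @[n --> \oo] --> (0 : R) ->
  0 <= c -> 0 < e -> \forall n \near \oo, c * f n <= e.
Proof.
move=> f0 c0 e0; have c1 : 0 < c + 1 by rewrite ltr_wpDl.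
have fn : \forall n \near \oo, f n < e / (c + 1) by apply: (cvgr_lt 0 f0); exact: divr_gt0.
near=> n; apply: (@le_trans _ _ (c * (e / (c + 1)))).
  by rewrite ler_wpM2l// ltW//; near: n.
by rewrite mulrA ler_pdivrMr// mulrC ler_pM2l// lerDl.
Unshelve. all: by end_near.
Qed.

Lemma lipschitz_dist (R : realType) (sigma : R -> R) : (exists k : R, k.-lipschitz sigma) ->
  exists2 k : R, 0 <= k & forall x y, `|sigma x - sigma y| <= k * `|x - y|.
Proof.
move=> [k sl]; exists `|k| => // x y.
have := sl (x, y) (conj Logic.I Logic.I); rewrite /self_sub/= => /le_trans; apply.
by rewrite ler_wpM2r// ler_norm.
Qed.

Lemma ereal_cvg0 (R : realType) (F : nat -> \bar R) : (forall n, 0 <= F n)%E ->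
  (forall e : R, 0 < e -> \forall n \near \oo, (F n <= e%:E)%E) -> F n @[n --> \oo] --> 0%E.
Proof.
move=> F0 Fe; apply/fine_cvgP; split.
  have := Fe 1 ltr01; apply: filterS => n Fn.
  by rewrite ge0_fin_numE// (le_lt_trans Fn)// ltry.
apply/cvgrPdist_le => e e0; have := Fe e e0; apply: filterS => n Fn.
rewrite sub0r normrN ger0_norm ?fine_ge0// -lee_fin fineK//.
by rewrite ge0_fin_numE// (le_lt_trans Fn)// ltry.
Qed.

Lemma grid_nested (R : realType) (J : nat -> nat) (s : nat -> nat -> R) m n :
  (forall n, grid_set (J n) (s n) `<=` grid_set (J n.+1) (s n.+1)) -> (m <= n)%N ->
  grid_set (J m) (s m) `<=` grid_set (J n) (s n).
Proof.
move=> nest; elim: n => [|n IH]; first by rewrite leqn0 => /eqP->.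
rewrite leq_eqVlt => /orP[/eqP->//|]; rewrite ltnS => /IH H.
exact: subset_trans H (nest n).
Qed.

Theorem theorem3p1
  (R : realType) (d : measure_display) (T : measurableType d)
  (P : probability T R)
  (* activation function *)
  (sigma : R -> R)
  (sigma_lip : exists k : R, k.-lipschitz sigma)
  (sigma_TW : tauber_wiener sigma)
  (* population model *)
  (X eps : R -> T -> R)
  (X_gauss : gaussian_process P X)
  (eps_gauss : gaussian_process P eps)
  (X_eps_indep : indep P <<s process_events X >> <<s process_events eps >>)
  (X_L2 : forall w, L2_01 (X ^~ w))
  (eps_L2 : forall w, L2_01 (eps ^~ w))
  (* processes *)
  (lam beta : R) (lam_gt0 : 0 < lam) (beta_gt0 : 0 < beta) (beta_le1 : beta <= 1)
  (X_hoelder : forall s t : R, s \in `[0, 1] -> t \in `[0, 1] ->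
    ('E_P[fun w => ((X s w - X t w) ^+ 2)%R] `^ 2^-1
       <= (lam * `|s - t| `^ beta)%:E)%E)
  (X_cont : forall w, C01 (X ^~ w))
  (eps_cov : exists M : R, forall s t : R, s \in `[0, 1] -> t \in `[0, 1] ->
    (`|'E_P[fun w => (eps s w * eps t w)%R]| <= M%:E)%E)
  (* regression operator; dG0 x is the derivative of G0 x *)
  (G0 dG0 : (R -> R) -> R -> R) (alpha nu C0 : R)
  (G0_C01 : forall x, C01 x -> C01 (G0 x))
  (G0_0 : forall t : R, t \in `[0, 1] -> G0 (cst 0) t = 0)
  (alpha_gt0 : 0 < alpha) (alpha_le1 : alpha <= 1) (nu_gt0 : 0 < nu)
  (G0_hoelder : forall u : R, 1 <= u -> forall x1 x2 : R -> R,
    C01 x1 -> C01 x2 -> supnorm `[0, 1] x1 <= u -> supnorm `[0, 1] x2 <= u ->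
    supnorm `[0, 1] (fun t => G0 x1 t - G0 x2 t) <=
      C0 * u `^ nu * supnorm `[0, 1] (fun t => x1 t - x2 t) `^ alpha)
  (G0_growth : forall x, C01 x ->
    supnorm `[0, 1] (G0 x) <= C0 * Num.max 1 (supnorm `[0, 1] x `^ nu))
  (G0_AC : forall x, C01 x -> abs_continuous 0 1 (G0 x) /\
    {ae lebesgue_measure, forall t : R, t \in `]0, 1[ ->
       is_derive t (1 : R) (G0 x) (dG0 x t)})
  (dG0_moment : (\int[P]_w ess_sup lebesgue_measure
     (fun t : R => (\1_`]0, 1[ t * `|dG0 (X ^~ w) t| ^+ 2)%:E) < +oo)%E)
  (* sampling *)
  (Xs epss : nat -> R -> T -> R)
  (Xs_epss_meas : forall i (t : R), t \in `[0, 1] ->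
    measurable_fun setT (Xs i t) /\ measurable_fun setT (epss i t))
  (Xs_cont : forall i w, C01 (Xs i ^~ w))
  (XY_copies : forall i, same_law P (Xs i) (response G0 (Xs i) (epss i))
                                    X (response G0 X eps))
  (XY_indep : mutual_indep P (fun i : nat =>
     <<s pair_events (Xs i) (response G0 (Xs i) (epss i)) >>))
  (J L : nat -> nat) (s t : nat -> nat -> R)
  (s_grid : forall n, is_grid (J n) (s n))
  (t_grid : forall n, is_grid (L n) (t n))
  (J_infty : J n @[n --> \oo] --> \oo)
  (L_infty : L n @[n --> \oo] --> \oo)
  (s_nested : forall n, grid_set (J n) (s n) `<=` grid_set (J n.+1) (s n.+1))
  (J_log : ln (J n)%:R / n%:R @[n --> \oo] --> (0 : R))
  (s_spacing : spacing (J n) (s n) @[n --> \oo] --> (0 : R))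
  (t_spacing : spacing (L n) (t n) @[n --> \oo] --> (0 : R))
  (e : nat -> nat -> nat -> T -> R) (sigma_e : R)
  (e_gauss : forall n i l, (i < n)%N -> (1 <= l <= L n)%N ->
     centered_gaussian P (e n i l) /\ ('V_P[e n i l] <= (sigma_e ^+ 2)%:E)%E)
  (e_indep : forall n, mutual_indep P (fun il : 'I_n * 'I_(L n) =>
     events (e n il.1 il.2.+1)))
  (e_XY_indep : forall n, indep P
     <<s \bigcup_(i in [set i | (i < n)%N])
           pair_events (Xs i) (response G0 (Xs i) (epss i)) >>
     <<s \bigcup_(i in [set i | (i < n)%N])
         \bigcup_(l in [set l | (1 <= l <= L n)%N]) events (e n i l) >>)
  (* network *)
  (B : R) (B_ge : C0 <= B)
  (b r : nat -> R) (p q : nat -> nat)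
  (b_ge1 : forall n, 1 <= b n) (r_ge1 : forall n, 1 <= r n)
  (p_ge1 : forall n, (1 <= p n)%N) (q_ge1 : forall n, (1 <= q n)%N)
  (b_nd : {homo b : m n / (m <= n)%N >-> m <= n})
  (r_nd : {homo r : m n / (m <= n)%N >-> m <= n})
  (p_nd : {homo p : m n / (m <= n)%N})
  (q_nd : {homo q : m n / (m <= n)%N})
  (b_infty : b n @[n --> \oo] --> +oo)
  (r_infty : r n @[n --> \oo] --> +oo)
  (p_infty : p n @[n --> \oo] --> \oo)
  (q_infty : q n @[n --> \oo] --> \oo)
  (rate1 : forall u : R, 1 <= u ->
     (p n)%:R * (q n)%:R * b n ^+ 2 * spacing (L n) (t n)
       * supnorm [set z | `|z| <= b n * (r n * u + 1)] sigma
     @[n --> \oo] --> (0 : R))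
  (rate2 : forall u : R, 1 <= u ->
     (p n)%:R * (q n)%:R * r n
       * ln (b n * (J n)%:R * (p n)%:R * (q n)%:R
             * supnorm [set z | `|z| <= b n * (r n * u + 1)] sigma)
       / n%:R
     @[n --> \oo] --> (0 : R))
  (* estimator *)
  (u : R) (u_ge1 : 1 <= u)
  (Ghat : nat -> T -> (R -> R) -> R -> R)
  (Ghat_argmin : forall n w, is_argmin
     (sieve sigma B nu u (b n) (r n) (J n) (p n) (q n) (s n))
     (empirical_loss u n (J n) (L n) (s n) (t n) (fun i => Xs i ^~ w)
        (fun i l => response G0 (Xs i) (epss i) (t n l) w + e n i l w))
     (Ghat n w))
  (Ghat_meas : forall n x z, C01 x -> z \in `[0, 1] ->
     measurable_fun setT (fun w => Ghat n w x z)) :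
  (* the first component of z carries the training sample, the second one the
     independent copy of the predictor *)
  (\int[P \x P]_z L2norm_sq (fun v => (Ghat n z.1 (X ^~ z.2) v
      - truncation (grid_set (J n) (s n)) u (X ^~ z.2) * G0 (X ^~ z.2) v)%R))%E
  @[n --> \oo] --> 0%E.
Proof.
have u0 : 0 < u by exact: lt_le_trans u_ge1.
have [k k0 sk] := lipschitz_dist sigma_lip.
have C00 : 0 <= C0 := growth_ge0 G0_growth.
have B0 : 0 <= B by exact: le_trans B_ge.
have mXs i : measurable_process (Xs i) by move=> z z01; case: (Xs_epss_meas i z z01).
have mepss i : measurable_process (epss i) by move=> z z01; case: (Xs_epss_meas i z z01).
have [Gt [Gt_meas GtE]] := measurable_operator sk sigma_TW G0_C01 alpha_gt0 C00 G0_hoelder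
  s_grid J_infty s_spacing.
have [M eps_var] : exists M : R, forall z, z \in `[0, 1] ->
    (\int[P]_w (eps z w ^+ 2)%:E <= M%:E)%E.
  have [M ec] := eps_cov; exists M => z z01; have := ec z z z01 z01; rewrite unlock.
  by move/(le_trans (lee_abs _)); under eq_integral do rewrite -expr2.
(* The first condition makes the path moment integrable, the second lets it dominate the squared
   Hoelder error. *)
have [m hm1 hm2] : exists2 m : nat, 4 <= beta * m%:R & 2 * nu + 2 * alpha <= m%:R.
  pose y := Num.max (4 / beta) (2 * nu + 2 * alpha).
  have ym : y <= (Num.truncn y).+1%:R by rewrite ltW// -truncn_le_nat.
  exists (Num.truncn y).+1; last by apply: le_trans ym; rewrite le_max lexx orbT.
  by rewrite mulrC -ler_pdivrMr//; apply: le_trans ym; rewrite le_max lexx.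
have [Cq X_moment] := path_moment_expectation X_gauss lam_gt0 X_hoelder hm1.
set th := moment_base beta in X_moment.
have th0 : 0 < th := moment_base_gt0 beta.
have Cq0 : 0 <= Cq.
  by rewrite -lee_fin; apply: le_trans X_moment; apply: integral_ge0 => w _; exact: path_moment_ge0.
have [C [vth [C_ge0 vth0 vth1 interp_err]]] := operator_interp_error G0_C01 alpha_gt0 nu_gt0 C00
  G0_hoelder th0 (moment_base_lt1 beta_gt0) hm2.
have [c0 [c00 c01 act_ge]] := activation_lower_bound u_ge1 sk k0 sigma_TW b_ge1 r_ge1 b_infty.
pose K : R := B * u `^ nu; have K0 : 0 <= K by rewrite mulr_ge0// powR_ge0.
have M0 : 0 <= M.
  have z01 : (0 : R) \in `[0, 1] by rewrite in_itv/= lexx ler01.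
  rewrite -lee_fin; apply: le_trans (eps_var _ z01); apply: integral_ge0 => w _.
  by rewrite lee_fin sqr_ge0.
apply: ereal_cvg0 => [n|e5 e50].
  by apply: integral_ge0 => z _; apply: integral_ge0 => v _; rewrite lee_fin sqr_ge0.
(* Five error terms, each to be at most [e0]. The exponent [tau], the radius [delta], the accuracy
   [d2], the interpolation level [k2] and the coarse grid [N0] are all fixed before [n]. *)
pose e0 := e5 / 5; have e00 : 0 < e0 by rewrite divr_gt0.
pose W1 : R := 2 * expR (4 * M); pose W2 : R := 2 * expR (4 * sigma_e ^+ 2).
have W10 : 0 <= W1 by rewrite mulr_ge0// expR_ge0.
have W20 : 0 <= W2 by rewrite mulr_ge0// expR_ge0.
(* The three deviation exponents are quadratic in [tau]; this is the coefficient of [tau] that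
   remains after the division by [tau] in the oracle inequality. *)
pose dev_cst : R := 4 * (2 * ((2 * K) ^+ 2) ^+ 2 + 8 * (4 * (2 * K) ^+ 2 * M + 4 * (2 * K) ^+ 2 * sigma_e ^+ 2)).
have dev_cst0 : 0 <= dev_cst.
  have K2 := sqr_ge0 (2 * K); apply: mulr_ge0 (ler0n _ 4) (addr_ge0 (mulr_ge0 (ler0n _ 2) (sqr_ge0 _)) _).
  apply: mulr_ge0 (ler0n _ 8) (addr_ge0 _ _); first exact: mulr_ge0 (mulr_ge0 (ler0n _ 4) K2) M0.
  exact: mulr_ge0 (mulr_ge0 (ler0n _ 4) K2) (sqr_ge0 _).
pose Q : R := 2 * (2 * K) ^+ 2; have Q0 : 0 <= Q := mulr_ge0 (ler0n _ 2) (sqr_ge0 _).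
have dE0 : 0 <= dev_cst / e0 := divr_ge0 dev_cst0 (ltW e00).
(* [Q] secures [tauK], the second summand [tauC]; the 1 keeps the denominator positive. *)
pose tau : R := (Q + dev_cst / e0 + 1)^-1.
have taud : 0 < Q + dev_cst / e0 + 1 := ltr_wpDl (addr_ge0 Q0 dE0) ltr01.
have tau0 : 0 < tau by rewrite invr_gt0.
have tauK : tau * (2 * K) ^+ 2 <= 2^-1.
  rewrite /tau mulrC ler_pdivrMr//.
  have -> : (2 * K) ^+ 2 = 2^-1 * Q by rewrite /Q; field.
  by rewrite ler_pM2l ?invr_gt0// -addrA lerDl addr_ge0.
have tauC : tau * dev_cst <= e0.
  rewrite /tau mulrC ler_pdivrMr//.
  have -> : e0 * (Q + dev_cst / e0 + 1) = dev_cst + e0 * (Q + 1) by field; rewrite gt_eqF.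
  by rewrite lerDl mulr_ge0 ?(ltW e00)// addr_ge0.
have scale (c : R) : 0 <= c -> exists2 z : R, 0 < z <= 1 & z * c <= e0.
  move=> cge0; have d0 : 0 < c + e0 by rewrite ltr_wpDl.
  exists (e0 / (c + e0)); first by rewrite divr_gt0//= ler_pdivrMr// mul1r lerDr.
  by rewrite mulrAC ler_pdivrMr// ler_pM2l// lerDl ltW.
have [delta /andP[d0 d1] dW] := scale (12 + 32 * (W1 + W2)) (addr_ge0 (ler0n _ 12) (mulr_ge0 (ler0n _ 32) (addr_ge0 W10 W20))).
have [d2 /andP[d20 d21] dA] := scale (68 * (2 + Cq)) (mulr_ge0 (ler0n _ 68) (addr_ge0 (ler0n _ 2) Cq0)).
have [k2 hk2] : exists k2, 68 * (C * (2 + 2 * Cq)) * vth ^+ k2 <= e0.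
  have vc : vth ^+ n @[n --> \oo] --> (0 : R) by apply: cvg_expr; rewrite ger0_norm.
  have c1 : 0 <= 68 * (C * (2 + 2 * Cq)) by rewrite !mulr_ge0// addr_ge0// mulr_ge0.
  exact: filter_ex (near_mul_le vc c1 e00).
pose Cv := C * vth ^+ k2; have Cv0 : 0 <= Cv by rewrite mulr_ge0// exprn_ge0.
(* The coarse grid is itself a sampling grid: by nestedness its points belong to every later one, so
   a fixed network can still read the path there. *)
have [N0 [JN sN]] : exists N0, (0 < J N0)%N /\ spacing (J N0) (s N0) <= 2 ^- k2.
  have h1 := near_infty_ge 1 J_infty.
  have h2 : \forall n \near \oo, spacing (J n) (s n) < 2 ^- k2.
    by apply: (cvgr_lt 0 s_spacing); rewrite invr_gt0 exprn_gt0.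
  by have [N0 [? /ltW ?]] := filter_ex (filterI h1 h2); exists N0.
have [p0 [b0 Gst_ex]] := sieve_operator_approx sigma_TW u_ge1 B_ge G0_C01 alpha_gt0 nu_gt0
  G0_hoelder G0_growth (s_grid N0) JN d20.
have [Ce Ce0 entropy] := sieve_entropy k0 sk u_ge1 c00 c01 d0.
(* From [(Gst - G0)^2 <= 2 d2^2 + 2 Cv (1 + c)]. The extra [d2 ^+ 2] keeps [A1] positive, as
   [affine_moment_le] requires, even if [Cv] is 0. *)
pose A0 : R := 2 * d2 ^+ 2 + 2 * Cv; pose A1 : R := 2 * Cv + d2 ^+ 2.
have A00 : 0 <= A0 := addr_ge0 (mulr_ge0 (ler0n _ 2) (sqr_ge0 _)) (mulr_ge0 (ler0n _ 2) Cv0).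
have A10 : 0 < A1 by rewrite ltr_wpDl ?exprn_gt0// mulr_ge0.
have A_le : 34 * (A0 + A1 * Cq) <= e0.
  have h1 : d2 ^+ 2 * (68 * (2 + Cq)) <= e0.
    apply: le_trans dA; rewrite ler_wpM2r//; first by rewrite mulr_ge0// addr_ge0.
    by rewrite expr2 ler_piMr// ltW.
  have h2 : 68 * (2 + 2 * Cq) * Cv <= e0.
    by apply: le_trans hk2; rewrite /Cv le_eqVlt; apply/orP; left; apply/eqP; ring.
  have -> : 34 * (A0 + A1 * Cq) =
      2^-1 * (d2 ^+ 2 * (68 * (2 + Cq))) + 2^-1 * (68 * (2 + 2 * Cq) * Cv).
    by rewrite /A0 /A1; field.
  by move: h1 h2; clear; lra.
have near_r : \forall n \near \oo, (J N0)%:R <= r n by move/cvgryPge: r_infty; exact.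
(* Besides admitting the approximating weights, this makes [Z] at least [expR 1], so that
   [1 <= ln Z]. *)
have near_b : \forall n \near \oo, Num.max b0 (expR 1 / c0) <= b n by move/cvgryPge: b_infty; exact.
have near1 := near_mul_le (rate1 u u_ge1) (mulr_ge0 (mulr_ge0 (ler0n _ 16) k0) K0) e00.
(* The 1 added to [Ce] absorbs the 1 next to the log-cardinality, since [p q r ln Z] is at least
   1. *)
have c2 : 0 <= 68 * tau^-1 * (Ce + 1) by rewrite mulr_ge0 ?addr_ge0// mulr_ge0// invr_ge0 ltW.
have near2 := near_mul_le (rate2 u u_ge1) c2 e00.
near=> n.
have n0 : (0 < n)%N by near: n; exact: nbhs_infty_gt.
have nN : (N0 <= n)%N by near: n; exact: nbhs_infty_ge.
have Jn : (0 < J n)%N by near: n; exact: near_infty_ge 1 J_infty.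
have Ln : (1 < L n)%N by near: n; exact: near_infty_ge 2 L_infty.
have pn : (p0 <= p n)%N by near: n; exact: near_infty_ge p0 p_infty.
have rn : (J N0)%:R <= r n by near: n.
have bn : Num.max b0 (expR 1 / c0) <= b n by near: n.
have an : c0 <= act_bound sigma u (b n) (r n) by near: n.
have rate1n : 16 * k * K * ((p n)%:R * (q n)%:R * b n ^+ 2 * spacing (L n) (t n)
    * act_bound sigma u (b n) (r n)) <= e0 by near: n; exact: near1.
set Z := b n * (J n)%:R * (p n)%:R * (q n)%:R * act_bound sigma u (b n) (r n).
have rate2n : 68 * tau^-1 * (Ce + 1) * ((p n)%:R * (q n)%:R * r n * ln Z / n%:R) <= e0.
  by rewrite /Z; near: n; exact: near2.
have b1 := b_ge1 n; have bpos : 0 < b n := lt_le_trans ltr01 b1.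
have J1 : 1 <= (J n)%:R :> R by rewrite ler1n.
have p1 : 1 <= (p n)%:R :> R by rewrite ler1n p_ge1.
have q1 : 1 <= (q n)%:R :> R by rewrite ler1n q_ge1.
have Z_ge : b n * c0 <= Z.
  apply: ler_pM => //; try exact: ltW.
  by rewrite -!mulrA ler_peMr ?(ltW bpos)// mulr_ege1// mulr_ege1.
move: bn; rewrite ge_max ler_pdivrMr// => /andP[bn1 bn2].
have lnZ : 1 <= ln Z.
  have eZ : expR 1 <= Z := le_trans bn2 Z_ge.
  have Z0 : 0 < Z := lt_le_trans (expR_gt0 1) eZ.
  by rewrite -ler_expR lnK ?posrE.
have [Gst svGst Gst_app] := Gst_ex (J n) (p n) (q n) (s n) (b n) (r n) (s_grid n)
  (grid_nested s_nested nN) pn (q_ge1 n) bn1 rn.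
have [I [Gc [svGc cover card]]] := entropy (b n) (r n) B nu (J n) (p n) (q n) (s n) b1 an
  (r_ge1 n) Jn (p_ge1 n) (q_ge1 n) lnZ (ex_intro _ Gst svGst).
have Gst_err x c z : C01 x -> truncation (grid_set (J n) (s n)) u x = 1 ->
    (path_moment m th x <= c%:E)%E -> z \in `[0, 1] -> (Gst x z - G0 x z) ^+ 2 <= A0 + A1 * c.
  move=> xc V1 mc z01; have c_ge0 : 0 <= c by rewrite -lee_fin (le_trans _ mc)// path_moment_ge0.
  have h1 := sqr_le_norm (Gst_app x z V1 z01).
  have := interp_err x c k2 (J N0) (s N0) z xc (s_grid N0) JN sN mc z01.
  rewrite -(mulrA C) mulrCA -/Cv; move: h1; set g := G0 (interp _ _ _) z => h1 h2.
  have := sqr_ge0 ((Gst x z - g) + (G0 x z - g)).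
  have := mulr_ge0 (sqr_ge0 d2) c_ge0.
  have -> : A0 + A1 * c = 2 * d2 ^+ 2 + 2 * (Cv * (1 + c)) + d2 ^+ 2 * c by rewrite /A0 /A1; ring.
  by move: h1 h2; clear; lra.
apply: le_trans (oracle_inequality k0 sk X_gauss eps_gauss X_eps_indep X_cont Gt_meas GtE eps_var
  mXs mepss Xs_cont XY_copies XY_indep u_ge1 b1 B0 (s_grid n) Jn (t_grid n) Ln n0 (e_gauss n)
  (e_indep n) (e_XY_indep n) th0 A00 A10 X_moment svGst Gst_err svGc (ltW d0) cover
  (Ghat_argmin n) tau0 tauK) _.
rewrite lee_fin; have -> : e5 = 5 * e0 by rewrite /e0; field.
apply: oracle_rhs_le => //; first exact: ltW.
- apply: le_trans rate1n; rewrite le_eqVlt; apply/orP; left; apply/eqP; rewrite /K; ring.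
- apply: le_trans rate2n; set y := _ * ln Z.
  have -> : 68 * tau^-1 * (Ce + 1) * (y / n%:R) = 68 * tau^-1 * ((Ce + 1) * y / n%:R) by rewrite -!mulrA.
  apply: ler_wpM2l; first by rewrite mulr_ge0// invr_ge0 ltW.
  apply: ler_wpM2r; first by rewrite invr_ge0.
  rewrite mulrDl mul1r; apply: lerD; first exact: card.
  by rewrite /y !mulr_ege1.
apply: le_trans tauC; rewrite le_eqVlt; apply/orP; left; apply/eqP; rewrite /dev_cst /K.
by field; rewrite gt_eqF.
Unshelve. all: by end_near.
Qed.
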